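(* Let $X$ be a connected CW-complex which is locally finite or countable. Then $X$ is aspherical if and only if it has the distinguished path property (dpp).
   Context: A CW-complex is locally finite if every point is contained in a finite number of (closed) cells, and countable if it has countably many cells. A space $X$ is aspherical if it is path connected and $\pi_n(X)=0$ for all $n\geq 2$. For a path connected, locally path connected and semilocally simply connected space $X$ (for example a connected CW-complex), an open subset $U\subseteq X$ is nice if it is path connected and the inclusion induces the trivial map $\pi_1(U,x)\to\pi_1(X,x)$ for every $x\in U$; the nice open sets form a basis of the topology. Let $I=[0,1]$ and let $X^I$ be the space of all continuous paths $I\to X$ with the compact-open topology. $\Pi(X)$ is the set of homotopy classes relative to endpoints $[\gamma]$ of paths $\gamma:I\to X$, with the topology having as basis the sets $S(U,V,[\gamma])=\{[\delta_1*\gamma*\delta_2]\}$, where $U,V\subseteq X$ are nice open sets, $\gamma$ is a path with $\gamma(0)\in U$ and $\gamma(1)\in V$, and $\delta_1$ (resp. $\delta_2$) ranges over the paths contained in $U$ ending at $\gamma(0)$ (resp. contained in $V$ starting at $\gamma(1)$); $*$ is concatenation. Let $q:X^I\to\Pi(X)$ be the quotient map $q(\gamma)=[\gamma]$. $X$ has the distinguished path property (dpp) if there is a continuous map $g:\Pi(X)\to X^I$ with $q\circ g=\mathrm{id}$. *)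

(* Defs.v *)
From HB Require Import structures.
From mathcomp Require Import all_boot all_order all_algebra generic_quotient.
From mathcomp Require Import finmap lra.
From mathcomp Require Import all_classical all_reals.
From mathcomp Require Import topology normedtype homotopy.

Set Implicit Arguments.
Unset Strict Implicit.
Unset Printing Implicit Defensive.

Import Order.TTheory GRing.Theory Num.Theory numFieldNormedType.Exports.
Local Open Scope classical_set_scope.
Local Open Scope ring_scope.
Local Open Scope quotient_scope.

Definition I01 (R : realType) : topologicalType := set_type `[0 : R, 1]%classic.

Lemma clamp01_subproof (R : realType) (x : R) :
  Num.max 0 (Num.min x 1) \in `[0 : R, 1]%classic.
Proof.
by rewrite inE /= in_itv /= le_max lexx /= ge_max ler01 ge_min lexx orbT.
Qed.

Definition clamp01 (R : realType) (x : R) : I01 R :=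
  exist _ (Num.max 0 (Num.min x 1)) (clamp01_subproof x).

Definition zero01 (R : realType) : I01 R := clamp01 0.
Definition one01 (R : realType) : I01 R := clamp01 1.

Definition ends01 (R : realType) : set (I01 R) := [set zero01 R; one01 R].
Arguments ends01 : clear implicits.

Section clamp.
Context {R : realType}.

Lemma val_clamp01 (x : R) : 0 <= x <= 1 -> \val (clamp01 x) = x.
Proof. by move=> /andP[x0 x1] /=; rewrite (min_idPl x1) (max_idPr x0). Qed.

Lemma itv01P (t : I01 R) : 0 <= \val t <= 1.
Proof. by case: t => t /= /set_mem /=; rewrite in_itv. Qed.

Lemma clamp01K (t : I01 R) : clamp01 (\val t) = t.
Proof. by apply/val_inj/val_clamp01/itv01P. Qed.

Lemma clamp01_ge1 (x : R) : 1 <= x -> clamp01 x = one01 R.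
Proof.
move=> x1; apply: val_inj; rewrite [RHS]val_clamp01 ?ler01 ?lexx //=.
by rewrite (min_idPr x1) (max_idPr ler01).
Qed.

Lemma clamp01_le0 (x : R) : x <= 0 -> clamp01 x = zero01 R.
Proof.
move=> x0; apply: val_inj; rewrite [RHS]val_clamp01 ?ler01 ?lexx //=.
by rewrite (min_idPl (le_trans x0 ler01)) (max_idPl x0).
Qed.

Lemma clamp01_0 : clamp01 0 = zero01 R. Proof. by []. Qed.

Lemma clamp01_1 : clamp01 1 = one01 R. Proof. by []. Qed.

Lemma val01_continuous : continuous (\val : I01 R -> R).
Proof. exact: initial_continuous. Qed.

Lemma val01M_continuous (a : R) : continuous (fun s : I01 R => a * \val s).
Proof.
move=> s; apply: (continuous_comp (g := *%R a)); first exact: val01_continuous.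
exact: mulrl_continuous.
Qed.

Lemma val01MB_continuous (a b : R) :
  continuous (fun s : I01 R => a * \val s - b).
Proof.
move=> s; apply: (@cvgB R R _ (nbhs s) _ (fun s => a * \val s) (cst b)).
  exact: val01M_continuous.
exact: cvg_cst.
Qed.

Lemma clamp01_continuous : continuous (@clamp01 R).
Proof.
apply: continuous_comp_initial => x.
rewrite (_ : _ \o _ = fun x : R => Num.max 0 (Num.min x 1)) //.
apply: (@continuous_max _ _ (cst 0) (fun x : R => Num.min x 1)).
  exact: cst_continuous.
by apply: continuous_min => //; exact: cst_continuous.
Qed.

End clamp.

Lemma glue_continuous (R : realType) (T X : topologicalType) (c : T -> R)
    (a : R) (f g : T -> X) :
  continuous c -> continuous f -> continuous g ->
  (forall t, c t = a -> f t = g t) ->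
  continuous (fun t => if c t <= a then f t else g t).
Proof.
move=> cc cf cg fg.
set h := fun t => _.
have cA : closed [set t | c t <= a].
  by apply: (@preimage_closed _ _ c [set x | x <= a]) => //; exact: closed_le.
have cB : closed [set t | a <= c t].
  by apply: (@preimage_closed _ _ c [set x | a <= x]) => //; exact: closed_ge.
have : {within [set t | c t <= a] `|` [set t | a <= c t], continuous h}.
  apply: withinU_continuous => //.
    apply: (@subspace_eq_continuous _ _ _ f).
      by move=> t /set_mem /= ct; rewrite /from_subspace /h ct.
    exact: continuous_subspaceT.
  apply: (@subspace_eq_continuous _ _ _ g).
    move=> t /set_mem /= ct; rewrite /from_subspace /h; case: leP => // ct'.
    by rewrite fg //; apply/eqP; rewrite eq_le ct ct'.
  exact: continuous_subspaceT.
have -> : [set t | c t <= a] `|` [set t | a <= c t] = setT.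
  by apply/seteqP; split=> // t _ /=; case: (leP (c t) a) => [|/ltW]; [left|right].
by move=> ch; apply/continuous_subspace_setT.
Qed.

Section homotopy.
Context {R : realType}.
Implicit Types T X Y : topologicalType.

Definition homotopic T X (A : set T) (f g : continuousType T X) : Prop :=
  exists H : T * I01 R -> X,
    [/\ continuous H,
        forall t, H (t, zero01 R) = f t,
        forall t, H (t, one01 R) = g t &
        forall t s, A t -> H (t, s) = f t].

Definition homotopicb T X (A : set T) : rel (continuousType T X) :=
  fun f g => `[< homotopic A f g >].
Arguments homotopicb : clear implicits.

Lemma zero01E : \val (zero01 R) = 0.
Proof. by rewrite val_clamp01// lexx ler01. Qed.

Lemma one01E : \val (one01 R) = 1.
Proof. by rewrite val_clamp01// ler01 lexx. Qed.

Lemma pair2_continuous (S T U : topologicalType) (g : S -> U) :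
  continuous g -> continuous (fun p : T * S => (p.1, g p.2)).
Proof.
move=> cg p; apply: cvg_pair; first exact: cvg_fst.
by apply: (continuous_comp (f := snd)); [exact: cvg_snd|exact: cg].
Qed.

Lemma clamp01_comp_continuous (T : topologicalType) (u : T -> R) :
  continuous u -> continuous (fun t => clamp01 (u t)).
Proof.
by move=> cu t; apply: continuous_comp; [exact: cu|exact: clamp01_continuous].
Qed.

Lemma val01_comp_continuous (T : topologicalType) (u : T -> I01 R) :
  continuous u -> continuous (fun t => \val (u t)).
Proof.
by move=> cu t; apply: continuous_comp; [exact: cu|exact: val01_continuous].
Qed.

Lemma homotopicb_refl T X (A : set T) : reflexive (homotopicb T X A).
Proof.
move=> f; apply/asboolP; exists (f \o fst); split=> //.
by move=> p; apply: continuous_comp; [exact: cvg_fst|exact: cts_fun].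
Qed.

Lemma homotopic_sym T X (A : set T) (f g : continuousType T X) :
  homotopic A f g -> homotopic A g f.
Proof.
move=> [H [cH H0 H1 HA]].
exists (fun p => H (p.1, clamp01 (1 - \val p.2))); split.
- move=> p; apply: (continuous_comp (f := fun p : T * I01 R =>
    (p.1, clamp01 (1 - \val p.2)))); last exact: cH.
  apply: (@pair2_continuous _ _ _ (fun s : I01 R => clamp01 (1 - \val s))).
  apply: clamp01_comp_continuous => s.
  by apply: continuousB; [exact: cst_continuous|exact: val01_continuous].
- by move=> t; cbn [fst snd]; rewrite zero01E subr0 clamp01_1.
- by move=> t; cbn [fst snd]; rewrite one01E subrr clamp01_0.
- by move=> t s At /=; rewrite HA // -H1 HA.
Qed.

Lemma homotopicb_sym T X (A : set T) : symmetric (homotopicb T X A).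
Proof.
by move=> f g; apply/idP/idP => /asboolP h; apply/asboolP/homotopic_sym.
Qed.

Lemma homotopicb_trans T X (A : set T) : transitive (homotopicb T X A).
Proof.
move=> g f h /asboolP[H [cH H0 H1 HA]] /asboolP[K [cK K0 K1 KA]].
apply/asboolP; exists (fun p => if \val p.2 <= 2^-1
  then H (p.1, clamp01 (2 * \val p.2))
  else K (p.1, clamp01 (2 * \val p.2 - 1))).
have half1 : (1 <= 2^-1 :> R) = false.
  by apply/negbTE; rewrite -ltNge invf_lt1 ?ltr1n.
have two1 : 2 - 1 = 1 :> R by rewrite -[2]/(1 + 1) addrK.
split.
- apply: glue_continuous.
  + by apply: val01_comp_continuous => p; exact: cvg_snd.
  + move=> p; apply: (continuous_comp (f := fun p : T * I01 R =>
      (p.1, clamp01 (2 * \val p.2)))); last exact: cH.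
    apply: (@pair2_continuous _ _ _ (fun s : I01 R => clamp01 (2 * \val s))).
    apply: clamp01_comp_continuous => s.
    exact: val01M_continuous.
  + move=> p; apply: (continuous_comp (f := fun p : T * I01 R =>
      (p.1, clamp01 (2 * \val p.2 - 1)))); last exact: cK.
    apply: (@pair2_continuous _ _ _ (fun s : I01 R => clamp01 (2 * \val s - 1))).
    apply: clamp01_comp_continuous => s; exact: val01MB_continuous.
  + by move=> p /= ->; rewrite divff ?pnatr_eq0// subrr clamp01_1 H1 clamp01_0 K0.
- by move=> t; cbn [fst snd]; rewrite zero01E invr_ge0 ler0n mulr0 clamp01_0.
- by move=> t; cbn [fst snd]; rewrite one01E half1 mulr1 two1 clamp01_1 K1.
- move=> t s At /=; case: ifP => _; first exact: HA.
  by rewrite KA // -(HA t (one01 R)) // H1.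
Qed.

Definition homotopic_equiv T X (A : set T) : equiv_rel (continuousType T X) :=
  EquivRel (homotopicb T X A) (@homotopicb_refl T X A) (@homotopicb_sym T X A)
    (@homotopicb_trans T X A).

End homotopy.

Arguments homotopic : clear implicits.
Arguments homotopic R {T X} A f g.
Arguments homotopic_equiv R {T} X A.

Definition hclass (R : realType) (T X : topologicalType) (A : set T) : Type :=
  {eq_quot homotopic_equiv R X A}.
HB.instance Definition _ (R : realType) (T X : topologicalType) (A : set T) :=
  Quotient.on (hclass R X A).
HB.instance Definition _ (R : realType) (T X : topologicalType) (A : set T) :=
  Choice.on (hclass R X A).

Definition hcl (R : realType) (T X : topologicalType) (A : set T)
  (f : continuousType T X) : hclass R X A := \pi f.
Arguments hcl R {T X} A f.

Lemma hclP (R : realType) (T X : topologicalType) (A : set T)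
    (f g : continuousType T X) :
  hcl R A f = hcl R A g <-> homotopic R A f g.
Proof.
by split=> [/eqmodP/asboolP //|h]; apply/eqmodP/asboolP.
Qed.

Lemma hcl_repr (R : realType) (T X : topologicalType) (A : set T)
  (c : hclass R X A) : hcl R A (repr c) = c.
Proof. exact: reprK. Qed.

Definition hclass_map (R : realType) (T X Y : topologicalType) (A : set T)
  (f : continuousType X Y) (c : hclass R X A) : hclass R Y A :=
  hcl R A (f \o repr c).

Lemma hclass_mapE (R : realType) (T X Y : topologicalType) (A : set T)
    (f : continuousType X Y) (g : continuousType T X) :
  hclass_map f (hcl R A g) = hcl R A (f \o g).
Proof.
apply/hclP; have /hclP[H [cH H0 H1 HA]] := hcl_repr (hcl R A g).
exists (f \o H); split=> /=.
- by move=> p; apply: continuous_comp; [exact: cH|exact: cts_fun].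
- by move=> t; rewrite H0.
- by move=> t; rewrite H1.
- by move=> t s At; rewrite HA.
Qed.

Definition pointed_hclasses (R : realType) (T X : topologicalType) (A : set T)
  (x : X) : set (hclass R X A) :=
  [set c | exists2 f : continuousType T X,
    (forall t, A t -> f t = x) & c = hcl R A f].
Arguments pointed_hclasses R {T X} A x.

Definition cube (R : realType) (n : nat) : topologicalType := 'rV[I01 R]_n.

Definition cube_boundary (R : realType) (n : nat) : set (cube R n) :=
  [set t | exists i, ends01 R (t 0 i)].
Arguments cube_boundary : clear implicits.

(* The underlying set of $\pi_n(X,x)$ as classes of maps
    $(I^n,\partial I^n)\to(X,x)$, and that of $\pi_1(X,x)$ as classes of loops. *)
Definition pi_n (R : realType) (X : topologicalType) (n : nat) (x : X) :
  set (hclass R X (cube_boundary R n)) :=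
  pointed_hclasses R (cube_boundary R n) x.
Arguments pi_n R {X} n x.

Definition pi_1 (R : realType) (X : topologicalType) (x : X) :
  set (hclass R X (ends01 R)) :=
  pointed_hclasses R (ends01 R) x.
Arguments pi_1 R {X} x.

Definition path_connected (R : realType) (X : topologicalType) : Prop :=
  forall x y : X, exists p : continuousType (I01 R) X,
    p (zero01 R) = x /\ p (one01 R) = y.

Definition aspherical (R : realType) (X : topologicalType) : Prop :=
  path_connected R X /\
  forall (n : nat) (x : X), (2 <= n)%N ->
    pi_n R n x = [set hcl R (cube_boundary R n) (cst x)].

Definition inclusion (X : topologicalType) (U : set X) : set_type U -> X :=
  set_val.

Lemma inclusion_continuous (X : topologicalType) (U : set X) :
  continuous (@inclusion X U).
Proof. exact: initial_continuous. Qed.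

HB.instance Definition _ (X : topologicalType) (U : set X) :=
  isContinuous.Build (set_type U) X (@inclusion X U) (@inclusion_continuous X U).

Definition nice (R : realType) (X : topologicalType) (U : set X) : Prop :=
  [/\ open U, path_connected R (set_type U) &
      forall (x : set_type U) c, pi_1 R x c ->
        hclass_map (@inclusion X U) c = hcl R (ends01 R) (cst (inclusion x))].

Definition pathspace (R : realType) (X : topologicalType) : Type :=
  continuousType (I01 R) X.
HB.instance Definition _ (R : realType) (X : topologicalType) :=
  Topological.copy (pathspace R X)
    (initial_topology (id : continuousType (I01 R) X ->
       {compact-open, I01 R -> X})).

Section concatenation.
Context (R : realType) (X : topologicalType).
Implicit Types p q : pathspace R X.

Definition path_cat_fun p q (t : I01 R) : X :=
  if \val t <= 2^-1 then p (clamp01 (2 * \val t))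
  else q (clamp01 (2 * \val t - 1)).

Lemma path_cat_continuous p q :
  p (one01 R) = q (zero01 R) -> continuous (path_cat_fun p q).
Proof.
move=> pq; apply: glue_continuous.
- exact: val01_continuous.
- move=> t; apply: (continuous_comp (f := fun t : I01 R =>
    clamp01 (2 * \val t))); last exact: cts_fun.
  apply: clamp01_comp_continuous => s.
  exact: val01M_continuous.
- move=> t; apply: (continuous_comp (f := fun t : I01 R =>
    clamp01 (2 * \val t - 1))); last exact: cts_fun.
  apply: clamp01_comp_continuous => s; exact: val01MB_continuous.
- by move=> t ->; rewrite divff ?pnatr_eq0// subrr.
Qed.

(* Junk value [p] when [p] does not end where [q] starts. *)
Definition path_cat p q : pathspace R X :=
  if pselect (p (one01 R) = q (zero01 R)) is left pq
  then mkcts (path_cat_continuous pq) else p.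

End concatenation.

Definition Pi (R : realType) (X : topologicalType) : Type :=
  hclass R X (ends01 R).
HB.instance Definition _ (R : realType) (X : topologicalType) :=
  Choice.on (Pi R X).

Definition Pi_class (R : realType) (X : topologicalType) (p : pathspace R X) :
  Pi R X := hcl R (ends01 R) p.

Definition Pi_basic (R : realType) (X : topologicalType) (U V : set X)
  (p : pathspace R X) : set (Pi R X) :=
  [set c | exists d1 d2 : pathspace R X,
    [/\ range d1 `<=` U, d1 (one01 R) = p (zero01 R),
        range d2 `<=` V, d2 (zero01 R) = p (one01 R) &
        c = Pi_class (path_cat (path_cat d1 p) d2)]].

Definition Pi_basics (R : realType) (X : topologicalType) : set (set (Pi R X)) :=
  [set W | exists (U V : set X) (p : pathspace R X),
    [/\ nice R U, nice R V, U (p (zero01 R)), V (p (one01 R)) &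
        W = Pi_basic U V p]].
Arguments Pi_basics : clear implicits.

(* The sets [Pi_basics] need not form a basis unless the nice open
   sets form one of [X], so they are declared as a subbase;
   [Pi_basics_basis] below shows that in that case they are a basis. *)
HB.instance Definition _ (R : realType) (X : topologicalType) :=
  isSubBaseTopological.Build (Pi R X) (Pi_basics R X) id.

(* [lra] rejects contexts holding equations between points of a space. *)
Ltac lraR := repeat match goal with H : @eq (Nbhs.sort _) _ _ |- _ => clear H end;
  lra.

Section Pi_topology.
Context {R : realType} {X : topologicalType}.
Implicit Types p q : pathspace R X.

Lemma path_catE p q t : p (one01 R) = q (zero01 R) ->
  path_cat p q t = path_cat_fun p q t.
Proof. by rewrite /path_cat; case: pselect. Qed.

Lemma path_cat0 p q : p (one01 R) = q (zero01 R) ->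
  path_cat p q (zero01 R) = p (zero01 R).
Proof.
move=> pq; rewrite path_catE// /path_cat_fun zero01E invr_ge0 ler0n mulr0.
by rewrite clamp01_0.
Qed.

Lemma path_cat1 p q : p (one01 R) = q (zero01 R) ->
  path_cat p q (one01 R) = q (one01 R).
Proof.
move=> pq; rewrite path_catE// /path_cat_fun one01E.
have -> : (1 <= 2^-1 :> R) = false by apply/negP => ?; lraR.
by rewrite mulr1 (_ : 2 - 1 = 1 :> R) ?clamp01_1//; lraR.
Qed.

Lemma range_path_cat p q (U : set X) : p (one01 R) = q (zero01 R) ->
  range p `<=` U -> range q `<=` U -> range (path_cat p q) `<=` U.
Proof.
move=> pq pU qU _ [t _ <-]; rewrite path_catE// /path_cat_fun.
by case: ifP => _; [apply: pU|apply: qU]; eexists.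
Qed.

Lemma Pi_class_ends p q : Pi_class p = Pi_class q ->
  p (zero01 R) = q (zero01 R) /\ p (one01 R) = q (one01 R).
Proof.
move=> /hclP[H [_ _ H1 HA]].
by split; rewrite -H1 HA //; [left|right].
Qed.

Lemma Pi_class_reparam p q q' (phi psi : I01 R -> I01 R) :
  continuous phi -> continuous psi ->
  phi (zero01 R) = psi (zero01 R) -> phi (one01 R) = psi (one01 R) ->
  q =1 p \o phi -> q' =1 p \o psi -> Pi_class q = Pi_class q'.
Proof.
move=> cphi cpsi e0 e1 qE q'E; apply/hclP.
have cval (f : I01 R -> I01 R) : continuous f ->
    continuous (fun z : I01 R * I01 R => \val (f z.1) : R).
  move=> cf; apply: val01_comp_continuous => z.
  by apply: continuous_comp; [exact: cvg_fst|exact: cf].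
have csnd : continuous (fun z : I01 R * I01 R => \val z.2 : R).
  by apply: val01_comp_continuous => z; exact: cvg_snd.
exists (fun z => p (clamp01 (\val (phi z.1) + \val z.2 *
   (\val (psi z.1) - \val (phi z.1))))); split.
- move=> z; apply: (continuous_comp (f := fun z : I01 R * I01 R =>
    clamp01 (_ : R))); last exact: cts_fun.
  apply: clamp01_comp_continuous => {}z.
  apply: (@cvgD R R _ (nbhs z) _); first exact: cval.
  apply: cvgM; first exact: csnd.
  by apply: cvgB; exact: cval.
- by move=> t; cbn [fst snd]; rewrite zero01E mul0r addr0 clamp01K qE.
- by move=> t; cbn [fst snd]; rewrite one01E mul1r addrC subrK clamp01K q'E.
- move=> t s te; cbn [fst snd].
  have -> : phi t = psi t by case: te => ->.
  rewrite subrr mulr0 addr0 clamp01K qE /=.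
  by congr (p _); case: te => ->.
Qed.

Lemma Pi_class_catP p p' q q' : p (one01 R) = q (zero01 R) ->
  Pi_class p = Pi_class p' -> Pi_class q = Pi_class q' ->
  Pi_class (path_cat p q) = Pi_class (path_cat p' q').
Proof.
move=> pq /[dup] /Pi_class_ends[p0 p1] /hclP[H [cH H0 H1 HA]].
move=> /[dup] /Pi_class_ends[q0 q1] /hclP[K [cK K0 K1 KA]].
have pq' : p' (one01 R) = q' (zero01 R) by rewrite -p1 -q0.
apply/hclP; exists (fun z => if \val z.1 <= 2^-1
  then H (clamp01 (2 * \val z.1), z.2)
  else K (clamp01 (2 * \val z.1 - 1), z.2)); split.
- have cfst : continuous (fun z : I01 R * I01 R => z.1) by move=> z; exact: cvg_fst.
  have aux (u : I01 R -> R) : continuous u ->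
      continuous (fun z : I01 R * I01 R => (clamp01 (u z.1), z.2)).
    move=> cu; have cz := @pair2_continuous (I01 R) (I01 R) _ _
      (clamp01_comp_continuous cu).
    move=> z; have := cvg_comp _ _ (@swap_continuous _ _ z) (cz _).
    move=> /cvg_comp /(_ (@swap_continuous _ _ _)).
    exact.
  apply: glue_continuous.
  + exact: val01_comp_continuous.
  + move=> z; apply: (continuous_comp (f := fun z : I01 R * I01 R =>
      (clamp01 (2 * \val z.1), z.2))); last exact: cH.
    by apply: (aux (fun t => 2 * \val t)); exact: val01M_continuous.
  + move=> z; apply: (continuous_comp (f := fun z : I01 R * I01 R =>
      (clamp01 (2 * \val z.1 - 1), z.2))); last exact: cK.
    by apply: (aux (fun t => 2 * \val t - 1)); exact: val01MB_continuous.
  + move=> [t s]; cbn [fst snd] => ->.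
    rewrite divff ?pnatr_eq0// subrr clamp01_1 clamp01_0.
    by rewrite HA; [rewrite KA //; left|right].
- by move=> t; rewrite path_catE// /path_cat_fun; cbn [fst snd]; rewrite H0 K0.
- by move=> t; rewrite path_catE// /path_cat_fun; cbn [fst snd]; rewrite H1 K1.
- move=> t s te; cbn [fst snd]; rewrite path_catE// /path_cat_fun.
  case: ifP => th.
    rewrite HA //; case: te => te; move: th; rewrite te.
      by rewrite zero01E mulr0 clamp01_0; left.
    by rewrite one01E => ?; exfalso; lraR.
  rewrite KA //; case: te => te; move: th; rewrite te.
    by rewrite zero01E => /negP[]; lraR.
  by rewrite one01E (_ : 2 * 1 - 1 = 1 :> R) ?clamp01_1; [right|lraR].
Qed.

Lemma catA_reparamE (x : R) :
  Num.min (2 * x) (Num.min (x + 4^-1) ((x + 1) / 2)) =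
  if x <= 4^-1 then 2 * x else if x <= 2^-1 then x + 4^-1 else (x + 1) / 2.
Proof.
rewrite !minEle; case: (leP (x + 4^-1)) => ?; case: (leP (2 * x)) => ?;
  case: (leP x 4^-1) => ?; case: (leP x 2^-1) => ?; lra.
Qed.

Lemma Pi_class_catA (a b c : pathspace R X) : a (one01 R) = b (zero01 R) ->
  b (one01 R) = c (zero01 R) ->
  Pi_class (path_cat (path_cat a b) c) = Pi_class (path_cat a (path_cat b c)).
Proof.
move=> ab bc.
pose phi (t : I01 R) : I01 R := clamp01
  (Num.min (2 * \val t) (Num.min (\val t + 4^-1) ((\val t + 1) / 2))).
have phiE (t : I01 R) : \val (phi t) =
    Num.min (2 * \val t) (Num.min (\val t + 4^-1) ((\val t + 1) / 2)).
  have /andP[t0 t1] := itv01P t; rewrite val_clamp01//.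
  by rewrite !le_min !ge_min; lraR.
apply: (@Pi_class_reparam (path_cat a (path_cat b c)) _ _ phi id) => //.
- apply: clamp01_comp_continuous.
  have cv := @val01_continuous R.
  move=> t; apply: (@continuous_min R _ (fun t : I01 R => 2 * \val t)
    (fun t : I01 R => Num.min (\val t + 4^-1) ((\val t + 1) / 2))).
    exact: val01M_continuous.
  apply: (@continuous_min R _ (fun t : I01 R => \val t + 4^-1)
    (fun t : I01 R => (\val t + 1) / 2)).
    by apply: (@cvgD R R _ (nbhs t) _); [exact: cv|exact: cvg_cst].
  apply: (@cvgM R _ (nbhs t) _); last exact: cvg_cst.
  by apply: (@cvgD R R _ (nbhs t) _); [exact: cv|exact: cvg_cst].
- by move=> t; exact: cvg_id.
- by apply: val_inj; rewrite phiE catA_reparamE zero01E invr_ge0 ler0n mulr0.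
- apply: val_inj; rewrite phiE catA_reparamE one01E.
  by case: leP => ?; [lraR|case: leP => ?; lraR].
- move=> t; have /andP[t0 t1] := itv01P t.
  rewrite -[RHS]/(path_cat a (path_cat b c) (phi t)).
  rewrite path_catE ?path_cat1// /path_cat_fun.
  rewrite [RHS]path_catE ?path_cat0// /path_cat_fun phiE catA_reparamE.
  have [th|th] := leP (\val t) (2^-1).
    rewrite path_catE// /path_cat_fun val_clamp01; last lraR.
    have [tq|tq] := leP (2 * \val t) (2^-1).
      have -> : \val t <= 4^-1 by lraR.
      by rewrite tq.
    have -> : (\val t <= 4^-1) = false by apply/negP => ?; lraR.
    have -> : (\val t + 4^-1 <= 2^-1) = (\val t <= 4^-1) by apply/idP/idP => ?; lraR.
    have -> : (\val t <= 4^-1) = false by apply/negP => ?; lraR.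
    rewrite path_catE// /path_cat_fun val_clamp01; last lraR.
    have -> : 2 * (\val t + 4^-1) - 1 = 2 * \val t - 2^-1 by lraR.
    rewrite ifT; last lraR.
    by congr (b (clamp01 _)); lraR.
  have -> : (\val t <= 4^-1) = false by apply/negP => ?; lraR.
  have -> : ((\val t + 1) / 2 <= 2^-1) = false by apply/negP => ?; lraR.
  rewrite path_catE// /path_cat_fun val_clamp01; last lraR.
  have -> : (2 * ((\val t + 1) / 2) - 1 <= 2^-1) = false by apply/negP => ?; lraR.
  by congr (c (clamp01 _)); lraR.
Qed.

Lemma Pi_class_cst_cat (p : pathspace R X) :
  Pi_class (path_cat (cst (p (zero01 R))) p) = Pi_class p.
Proof.
apply: (@Pi_class_reparam p _ _ (fun t => clamp01 (2 * \val t - 1)) id) => //.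
- by apply: clamp01_comp_continuous; exact: val01MB_continuous.
- by move=> t; exact: cvg_id.
- by rewrite clamp01_le0// zero01E; lraR.
- by rewrite clamp01_ge1// one01E; lraR.
- move=> t; rewrite path_catE// /path_cat_fun; case: ifP => // ?.
  rewrite -[RHS]/(p (clamp01 (2 * \val t - 1))).
  have -> : clamp01 (2 * \val t - 1) = zero01 R by apply: clamp01_le0; lraR.
  by [].
Qed.

Lemma Pi_class_cat_cst (p : pathspace R X) :
  Pi_class (path_cat p (cst (p (one01 R)))) = Pi_class p.
Proof.
apply: (@Pi_class_reparam p _ _ (fun t => clamp01 (2 * \val t)) id) => //.
- by apply: clamp01_comp_continuous; exact: val01M_continuous.
- by move=> t; exact: cvg_id.
- by rewrite clamp01_le0// zero01E; lraR.
- by rewrite clamp01_ge1// one01E; lraR.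
- move=> t; rewrite path_catE// /path_cat_fun; case: leP => // ?.
  rewrite -[RHS]/(p (clamp01 (2 * \val t))).
  have -> : clamp01 (2 * \val t) = one01 R by apply: clamp01_ge1; lraR.
  by [].
Qed.

Lemma Pi_basic_refl (U V : set X) p : U (p (zero01 R)) -> V (p (one01 R)) ->
  Pi_basic U V p (Pi_class p).
Proof.
move=> Up Vp; exists (cst (p (zero01 R))), (cst (p (one01 R))); split=> //.
- by move=> _ [t _ <-].
- by move=> _ [t _ <-].
rewrite -[LHS]Pi_class_cat_cst.
by apply: Pi_class_catP => //; rewrite Pi_class_cst_cat.
Qed.

Lemma Pi_basic_sub (U V U' V' : set X) p q : Pi_basic U V p (Pi_class q) ->
  U' `<=` U -> V' `<=` V -> Pi_basic U' V' q `<=` Pi_basic U V p.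
Proof.
move=> [e1 [e2 [e1U e1p e2V e2p qE]]] U'U V'V _ [d1 [d2 [d1U d1q d2V d2q ->]]].
have [q0 q1] := Pi_class_ends qE.
rewrite path_cat0 ?path_cat1 ?path_cat0// in q0 q1.
have d1e1 : d1 (one01 R) = e1 (zero01 R) by rewrite d1q.
have e2d2 : e2 (one01 R) = d2 (zero01 R) by rewrite d2q.
exists (path_cat d1 e1), (path_cat e2 d2); split.
- by apply: range_path_cat => //; exact: subset_trans U'U.
- by rewrite path_cat1.
- by apply: range_path_cat => //; exact: subset_trans V'V.
- by rewrite path_cat0.
rewrite -Pi_class_catA ?path_cat1//.
apply: Pi_class_catP => //; first by rewrite path_cat1.
rewrite (@Pi_class_catP d1 d1 _ _ _ _ qE)//.
rewrite -Pi_class_catA ?path_cat1 ?path_cat0//.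
apply: Pi_class_catP => //; first by rewrite path_cat1 ?path_cat0// path_cat1.
by rewrite -Pi_class_catA.
Qed.

Lemma Pi_basics_open : Pi_basics R X `<=` open.
Proof.
move=> W bW; exists [set W]; last by rewrite bigcup_set1.
move=> _ ->; exists [fset W]%fset; last by rewrite set_fset1 bigcap_set1.
by move=> V; rewrite in_fset1 => /eqP ->; exact: mem_set.
Qed.

Lemma Pi_basics_basis : basis [set U : set X | nice R U] -> basis (Pi_basics R X).
Proof.
move=> [_ niceX]; split=> [|c]; first exact: Pi_basics_open.
move=> N; rewrite nbhsE => -[O [[D DfI <-] [B DB Bc]] ON].
have [F FD FB] := DfI _ DB.
pose p : pathspace R X := repr c.
have pc : Pi_class p = c by exact: hcl_repr.
have /= FW W : W \in F -> exists UV : set X * set X, [/\ nbhs (p (zero01 R)) UV.1,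
    nbhs (p (one01 R)) UV.2 & forall U V, U `<=` UV.1 -> V `<=` UV.2 ->
    Pi_basic U V p `<=` W].
  move=> WF; have := FD _ WF; rewrite inE => -[U [V [q [nU nV Uq Vq WE]]]].
  have Wc : Pi_basic U V q (Pi_class p).
    by rewrite pc -WE; move: Bc; rewrite -FB; exact.
  exists (U, V); split => /=.
  - apply: open_nbhs_nbhs; split; first by case: nU.
    have [d1 [d2 [d1U d1q d2V d2q /Pi_class_ends[p0 p1]]]] := Wc.
    rewrite p0 !path_cat0 ?path_cat1//.
    by apply: d1U; exists (zero01 R).
  - apply: open_nbhs_nbhs; split; first by case: nV.
    have [d1 [d2 [d1U d1q d2V d2q /Pi_class_ends[p0 p1]]]] := Wc.
    rewrite p1 !path_cat1//.
    by apply: d2V; exists (one01 R).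
  by move=> U' V' U'U V'V; rewrite WE; exact: Pi_basic_sub Wc _ _.
pose UV W := if pselect (W \in F) is left WF then sval (cid (FW _ WF)) else (setT, setT).
have UVP W : W \in F -> [/\ nbhs (p (zero01 R)) (UV W).1,
    nbhs (p (one01 R)) (UV W).2 & forall U V, U `<=` (UV W).1 ->
    V `<=` (UV W).2 -> Pi_basic U V p `<=` W].
  by move=> WF; rewrite /UV; case: pselect => // ?; case: cid.
have n0 : nbhs (p (zero01 R)) (\bigcap_(W in [set` F]) (UV W).1).
  by apply: filter_bigI => W /UVP[].
have n1 : nbhs (p (one01 R)) (\bigcap_(W in [set` F]) (UV W).2).
  by apply: filter_bigI => W /UVP[].
have [U [nU Up] UF] := niceX _ _ n0.
have [V [nV Vp] VF] := niceX _ _ n1.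
exists (Pi_basic U V p); first split.
- by exists U, V, p; split.
- by rewrite -pc; exact: Pi_basic_refl.
move=> x xW; apply: ON; exists B => //; change (B x); rewrite -FB => W WF.
have [_ _] := UVP _ WF; apply; last exact: xW.
- by move=> y /UF /(_ _ WF).
- by move=> y /VF /(_ _ WF).
Qed.

End Pi_topology.

Definition dpp (R : realType) (X : topologicalType) : Prop :=
  exists g : Pi R X -> pathspace R X,
    continuous g /\ @Pi_class R X \o g = id.

Section cw.
Context (R : realType).

Definition sqnorm (n : nat) (v : 'rV[R]_n) : R := \sum_(i < n) v 0 i ^+ 2.
Definition disc (n : nat) : set 'rV[R]_n := [set v | sqnorm v <= 1].
Definition open_disc (n : nat) : set 'rV[R]_n := [set v | sqnorm v < 1].
Definition sphere (n : nat) : set 'rV[R]_n := [set v | sqnorm v = 1].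
Arguments disc : clear implicits.
Arguments open_disc : clear implicits.
Arguments sphere : clear implicits.

(* Whitehead's definition, by characteristic maps of Euclidean discs; [cw_map a]
   is only relevant on the disc. As [X] is Hausdorff, the discs are compact and
   the boundary of a cell misses its interior, injectivity on the open disc makes
   [cw_map a] a homeomorphism of it onto the open cell. *)
Record cw_structure (X : topologicalType) := CWStructure {
  cw_cell : Type;
  cw_dim : cw_cell -> nat;
  cw_map : forall a : cw_cell, 'rV[R]_(cw_dim a) -> X;
  cw_hausdorff : hausdorff_space X;
  cw_continuous : forall a,
    {within disc (cw_dim a), continuous (@cw_map a)};
  cw_injective : forall a,
    {in open_disc (cw_dim a) &, injective (@cw_map a)};
  cw_disjoint : trivIset [set: cw_cell]
    (fun a => @cw_map a @` open_disc (cw_dim a));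
  cw_cover : \bigcup_a (@cw_map a @` open_disc (cw_dim a)) = [set: X];
  cw_closure_finite : forall a, exists F : set cw_cell,
    [/\ finite_set F, forall b, F b -> (cw_dim b < cw_dim a)%N &
        @cw_map a @` sphere (cw_dim a) `<=`
          \bigcup_(b in F) (@cw_map b @` open_disc (cw_dim b))];
  cw_weak : forall C : set X,
    (forall a, closed (disc (cw_dim a) `&` @cw_map a @^-1` C)) -> closed C
}.
Arguments cw_map {X} c a _.

Definition closed_cell (X : topologicalType) (K : cw_structure X)
  (a : cw_cell K) : set X := cw_map K a @` disc (cw_dim a).

Definition cw_locally_finite (X : topologicalType) (K : cw_structure X) : Prop :=
  forall x : X, finite_set [set a : cw_cell K | closed_cell a x].

Definition cw_countable (X : topologicalType) (K : cw_structure X) : Prop :=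
  countable [set: cw_cell K].

End cw.

(* Main.v *)
(* A continuous section g of the quotient map turns the cone structure of a cube
   into a null-homotopy of any spheroid f: send y to the class of the image under f
   of a segment from a base point of the boundary to y, and evaluate g on it. As
   n >= 2, the boundary of the cube is connected and is sent to the trivial class.

   Conversely, distinguished paths are built by induction on pairs of cells: over
   the product of two cells the obstruction is a spheroid of dimension at least 2
   (in total dimension 1, the homotopy class of the path takes care of it). The
   product topology on X x X need not be the weak topology of the product cells.
   To get around this, deform the identity of X to a map r that collapses a collar
   of the boundary in every cell. Each open cell then has an open star in X that
   retracts to it, and r factors through this retraction. A family of paths from
   r x to r y that is constant along the collars in x and in y separately is
   continuous on X x X as soon as it is so on each product of open cells.
   Conjugating with the tracks of the deformation gives paths from x to y. *)

Require Import Defs.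
From mathcomp Require Import all_boot all_order all_algebra.
From mathcomp Require Import finmap ring lra.
From mathcomp Require Import all_classical all_reals.
From mathcomp Require Import topology normedtype homotopy realfun.

Set Implicit Arguments.
Unset Strict Implicit.
Unset Printing Implicit Defensive.

Import Order.TTheory GRing.Theory Num.Theory numFieldNormedType.Exports.
Local Open Scope classical_set_scope.
Local Open Scope ring_scope.

(** A family of paths over a k-dimensional product of cells, with ends given everywhere and values
    given on the boundary, is a map on the boundary of a (k+1)-dimensional cylinder, that is a
    k-spheroid. Hence the groups pi_k with k >= 2 occur, while k = 1 asks for a commuting square of
    classes. The section is sought as a function [G x y e] of two points and a class e from r x to r
    y, not of a class from x to y: moving x along a collar changes neither r x nor e, so constancy
    along collars is an equality of values of G. No universal cover is built. A cell is the image of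
    a convex set, so a class over a product of two cells is determined by its ends and by one class
    z joining the images of the centres; z labels a sheet of Pi(X) over the product, and continuity
    of G is asked on each sheet. In the other implication the section may send the trivial class to
    a loop that is not constant. An annulus around the cube gives room to contract it. *)

Section continuity.
Context {R : realType}.
Implicit Types (S T U : topologicalType) (V W : normedModType R).

Lemma cont_id T : continuous (fun x : T => x).
Proof. by move=> x; exact: cvg_id. Qed.

Lemma cont_cst T U (u : U) : continuous (fun _ : T => u).
Proof. by move=> x; exact: cvg_cst. Qed.

Lemma cont_comp S T U (f : S -> T) (g : T -> U) :
  continuous f -> continuous g -> continuous (fun x => g (f x)).
Proof. by move=> cf cg x; apply: continuous_comp; [exact: cf|exact: cg]. Qed.

Lemma cont_pair S T U (f : S -> T) (g : S -> U) :
  continuous f -> continuous g -> continuous (fun x => (f x, g x)).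
Proof. by move=> cf cg x; apply: cvg_pair; [exact: cf|exact: cg]. Qed.

Lemma cont_fst S T : continuous (fun x : S * T => x.1).
Proof. by move=> x; exact: cvg_fst. Qed.

Lemma cont_snd S T : continuous (fun x : S * T => x.2).
Proof. by move=> x; exact: cvg_snd. Qed.

Lemma cont_fst_comp S T U (f : S -> U) :
  continuous f -> continuous (fun x : S * T => f x.1).
Proof. by apply: cont_comp; exact: cont_fst. Qed.

Lemma cont_snd_comp S T U (f : T -> U) :
  continuous f -> continuous (fun x : S * T => f x.2).
Proof. by apply: cont_comp; exact: cont_snd. Qed.

Lemma contD T V (f g : T -> V) :
  continuous f -> continuous g -> continuous (fun x => f x + g x).
Proof. by move=> cf cg x; apply: cvgD; [exact: cf|exact: cg]. Qed.

Lemma contN T V (f : T -> V) : continuous f -> continuous (fun x => - f x).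
Proof. by move=> cf x; apply: cvgN; exact: cf. Qed.

Lemma contB T V (f g : T -> V) :
  continuous f -> continuous g -> continuous (fun x => f x - g x).
Proof. by move=> cf cg; apply: contD => //; exact: contN. Qed.

Lemma contZ T V (k : T -> R) (f : T -> V) :
  continuous k -> continuous f -> continuous (fun x => k x *: f x).
Proof. by move=> ck cf x; apply: cvgZ; [exact: ck|exact: cf]. Qed.

Lemma contM T (f g : T -> R) :
  continuous f -> continuous g -> continuous (fun x => f x * g x).
Proof. by move=> cf cg x; apply: cvgM; [exact: cf|exact: cg]. Qed.

Lemma contV T (f : T -> R) : (forall x, f x != 0) ->
  continuous f -> continuous (fun x => (f x)^-1).
Proof. by move=> f0 cf x; apply: cvgV => //; exact: cf. Qed.

Lemma cont_max T (f g : T -> R) : continuous f -> continuous g ->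
  continuous (fun x => Num.max (f x) (g x)).
Proof. by move=> cf cg x; apply: continuous_max; [exact: cf|exact: cg]. Qed.

Lemma cont_min T (f g : T -> R) : continuous f -> continuous g ->
  continuous (fun x => Num.min (f x) (g x)).
Proof. by move=> cf cg x; apply: continuous_min; [exact: cf|exact: cg]. Qed.

Lemma within_comp S T U (A : set S) (B : set T) (f : S -> T) (g : T -> U) :
  {within A, continuous f} -> {within B, continuous g} ->
  (forall x, A x -> B (f x)) -> {within A, continuous (fun x => g (f x))}.
Proof.
move=> /subspace_continuousP cf /subspace_continuousP cg AB.
apply/subspace_continuousP => x Ax.
apply: (@cvg_comp _ _ _ f g _ (within B (nbhs (f x)))); last exact/cg/AB.
move=> W /= BW; have := cf _ Ax _ BW; rewrite !nbhs_simpl /= /within /=.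
by apply: filterS => y h Ay; apply: h => //; exact: AB.
Qed.

Lemma within_cont_comp S T U (A : set S) (f : S -> T) (g : T -> U) :
  {within A, continuous f} -> continuous g ->
  {within A, continuous (fun x => g (f x))}.
Proof.
move=> cf cg; apply: (@within_comp _ _ _ _ setT) => //.
exact: continuous_subspaceT.
Qed.

Lemma cont_within_comp S T U (A : set S) (B : set T) (f : S -> T) (g : T -> U) :
  continuous f -> {within B, continuous g} ->
  (forall x, A x -> B (f x)) -> {within A, continuous (fun x => g (f x))}.
Proof. by move=> cf; apply: within_comp; exact: continuous_subspaceT. Qed.

Lemma within_pair S T U (A : set S) (f : S -> T) (g : S -> U) :
  {within A, continuous f} -> {within A, continuous g} ->
  {within A, continuous (fun x => (f x, g x))}.
Proof.
move=> /subspace_continuousP cf /subspace_continuousP cg.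
apply/subspace_continuousP => x Ax; apply: cvg_pair; [exact: cf|exact: cg].
Qed.

Lemma within_eq S T (A : set S) (f g : S -> T) :
  (forall x, A x -> f x = g x) ->
  {within A, continuous f} -> {within A, continuous g}.
Proof.
move=> fg cf; apply: subspace_eq_continuous cf => x /set_mem Ax.
by rewrite /from_subspace fg.
Qed.

Lemma within_setT S T (A : set S) (f : S -> T) : (forall x, A x) ->
  {within A, continuous f} -> continuous f.
Proof.
move=> AT /subspace_continuousP cf x; have := cf _ (AT x).
suff -> : A = setT by rewrite withinET.
by apply/seteqP; split.
Qed.

Lemma closed_leR T (f g : T -> R) : continuous f -> continuous g ->
  closed [set x | f x <= g x].
Proof.
move=> cf cg; have -> : [set x | f x <= g x] = (fun x => f x - g x) @^-1` [set y | y <= 0].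
  by apply/seteqP; split => x /=; rewrite subr_le0.
by apply: preimage_closed; [move=> x _; exact: contB|exact: closed_le].
Qed.

Lemma open_ltR T (f g : T -> R) : continuous f -> continuous g ->
  open [set x | f x < g x].
Proof.
move=> cf cg; have -> : [set x | f x < g x] = ~` [set x | g x <= f x].
  by apply/seteqP; split => x /=; rewrite ltNge => /negP.
by rewrite openC; exact: closed_leR.
Qed.

Lemma open_preimage S T (f : S -> T) (O : set T) :
  continuous f -> open O -> open (f @^-1` O).
Proof. by move=> /continuousP; apply. Qed.

Lemma glue_le T U (c d : T -> R) (f g : T -> U) : continuous c -> continuous d ->
  {within [set t | c t <= d t], continuous f} ->
  {within [set t | d t <= c t], continuous g} ->
  (forall t, c t = d t -> f t = g t) ->
  continuous (fun t => if c t <= d t then f t else g t).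
Proof.
move=> cc cd cf cg fg.
apply: (@within_setT _ _ ([set t | c t <= d t] `|` [set t | d t <= c t])).
  by move=> t /=; case: (leP (c t) (d t)) => [|/ltW]; [left|right].
apply: withinU_continuous; [exact: closed_leR|exact: closed_leR| |].
  by apply: within_eq cf => t /= ->.
apply: within_eq cg => t /= dc; case: leP => // cd'.
by rewrite fg//; apply/eqP; rewrite eq_le dc cd'.
Qed.

(* Closed sets pull back to images of compact sets. *)
Lemma compact_factor S T U (A : set S) (f : S -> T) (g : S -> U) :
  compact A -> hausdorff_space T -> {within A, continuous f} ->
  {within A, continuous g} ->
  (forall x y, A x -> A y -> f x = f y -> g x = g y) ->
  (exists x, A x) ->
  exists2 F : T -> U, {within f @` A, continuous F} &
    forall x, A x -> F (f x) = g x.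
Proof.
move=> cA hT cf cg fg [a Aa].
pose F (y : T) : U := if pselect ((f @` A) y) is left e then g (sval (cid2 e)) else g a.
have FE x : A x -> F (f x) = g x.
  move=> Ax; rewrite /F; case: pselect => [e|]; last by case; exists x.
  by case: cid2 => z Az /= /fg; apply.
exists F => //; apply/continuous_closedP => C cC.
have [D cD DE] := (closed_subspaceP _ _).1 ((continuous_closedP _).1 cg _ cC).
apply/closed_subspaceP; exists (f @` (A `&` D)).
  apply: compact_closed => //; apply: continuous_compact.
    by apply: continuous_subspaceW cf => x [].
  exact: compact_closedI.
apply/seteqP; split => y [].
  move=> [x [Ax Dx] <-] _; split; last by exists x.
  have : (D `&` A) x by [].
  by rewrite DE => -[+ _]; rewrite /= /from_subspace FE.
move=> /= + [x Ax fx]; rewrite /from_subspace -fx FE // => Cg.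
split; last by exists x.
exists x => //; split => //.
by suff [] : (D `&` A) x by []; rewrite DE.
Qed.

End continuity.

(** * The path space with the compact-open topology *)

Section paths.
Context {R : realType} {X : topologicalType}.
Implicit Types (p q : pathspace R X) (c d : Pi R X).

Lemma I01_compact : compact [set: I01 R].
Proof.
have c01 : compact `[0 : R, 1]%classic by exact: segment_compact.
have -> : [set: I01 R] = @clamp01 R @` `[0 : R, 1]%classic.
  apply/seteqP; split => // t _; exists (\val t); last exact: clamp01K.
  by rewrite /= in_itv /= itv01P.
apply: continuous_compact => //.
by apply: continuous_subspaceT; exact: clamp01_continuous.
Qed.

Lemma I01_hausdorff : hausdorff_space (I01 R).
Proof.
move=> s t st; apply: val_inj; apply: (@Rhausdorff R) => A B As Bt.
have [z [Az Bz]] := st _ _ (val01_continuous As) (val01_continuous Bt).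
by exists (\val z).
Qed.

Lemma I01_locally_compact : locally_compact [set: I01 R].
Proof.
move=> t _; exists setT; first exact: filterT.
by split; [exact: I01_compact|exact: closedT].
Qed.

Lemma I01_regular : regular_space (I01 R).
Proof.
move=> t; apply: (@compact_regular _ _ setT) => //.
- exact: I01_hausdorff.
- exact: I01_compact.
- exact: filterT.
Qed.

(** The interval is locally compact and regular, so evaluation is jointly continuous. With
    [cont_curry], continuous families of paths are then the same as maps on [T * I01 R]. *)
Lemma eval_path_continuous :
  continuous (fun z : pathspace R X * I01 R => z.1 z.2).
Proof.
have -> : (fun z : pathspace R X * I01 R => z.1 z.2) =
    @eval (I01 R) X by apply/funext => -[].
exact: (@eval_continuous (I01 R) X I01_locally_compact I01_regular).
Qed.

Lemma path_continuous p : continuous p. Proof. exact: cts_fun. Qed.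
Arguments path_continuous : clear implicits.

Lemma cont_uncurry (T : topologicalType) (f : T -> pathspace R X) :
  continuous f -> continuous (fun z : T * I01 R => f z.1 z.2).
Proof.
move=> cf; apply: (@cont_comp _ _ _ (fun z : T * I01 R => (f z.1, z.2))
  (fun z => z.1 z.2)); last exact: eval_path_continuous.
by apply: cont_pair; [exact: cont_fst_comp|exact: cont_snd].
Qed.

Lemma within_uncurry (T : topologicalType) (A : set T) (f : T -> pathspace R X)
    (g : T -> I01 R) :
  {within A, continuous f} -> {within A, continuous g} ->
  {within A, continuous (fun z => f z (g z))}.
Proof.
move=> cf cg; apply: (@within_cont_comp _ _ _ _ (fun z => (f z, g z))
  (fun z => z.1 z.2)); last exact: eval_path_continuous.
exact: within_pair.
Qed.

Lemma cont_curry (T : topologicalType) (f : T -> pathspace R X) :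
  continuous (fun z : T * I01 R => f z.1 z.2) -> continuous f.
Proof.
move=> cf; apply: continuous_comp_initial.
exact: (continuous_curry_fun cf).
Qed.

(* Junk value, a constant path, at discontinuous functions. *)
Definition to_path (f : I01 R -> X) : pathspace R X :=
  if pselect (continuous f) is left cf then mkcts cf else cst (f (zero01 R)).

Lemma to_pathE f : continuous f -> to_path f =1 f.
Proof. by rewrite /to_path; case: pselect. Qed.

Lemma path_cat_cvg (T : topologicalType) (f g : T -> pathspace R X) :
  (forall t, f t (one01 R) = g t (zero01 R)) ->
  continuous f -> continuous g -> continuous (fun t => path_cat (f t) (g t)).
Proof.
move=> fg cf cg; apply: cont_curry.
have -> : (fun z : T * I01 R => path_cat (f z.1) (g z.1) z.2) =
    fun z => if \val z.2 <= 2^-1 then f z.1 (clamp01 (2 * \val z.2))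
             else g z.1 (clamp01 (2 * \val z.2 - 1)).
  by apply/funext => z; rewrite path_catE.
have aux (u : I01 R -> R) (k : T -> pathspace R X) :
    continuous u -> continuous k ->
    continuous (fun z : T * I01 R => k z.1 (clamp01 (u z.2))).
  move=> cu ck; apply: (@cont_comp _ _ _ (fun z : T * I01 R => (z.1, clamp01 (u z.2)))
    (fun z => k z.1 z.2)); last exact: cont_uncurry.
  apply: cont_pair; first exact: cont_fst.
  by apply: clamp01_comp_continuous; exact: cont_snd_comp.
apply: glue_continuous.
- by apply: val01_comp_continuous; exact: cont_snd.
- by apply: (aux (fun t => 2 * \val t)) => //; exact: val01M_continuous.
- by apply: (aux (fun t => 2 * \val t - 1)) => //; exact: val01MB_continuous.
- move=> [t s] /= ->; rewrite divff ?pnatr_eq0// subrr.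
  by rewrite clamp01_1 clamp01_0.
Qed.

Definition path_rev p : pathspace R X := to_path (fun t => p (clamp01 (1 - \val t))).

Lemma rev01_continuous : continuous (fun t : I01 R => clamp01 (1 - \val t)).
Proof.
apply: clamp01_comp_continuous.
by apply: contB; [exact: cont_cst|exact: val01_continuous].
Qed.

Lemma path_revE p t : path_rev p t = p (clamp01 (1 - \val t)).
Proof.
rewrite to_pathE //; apply: (cont_comp rev01_continuous); exact: path_continuous.
Qed.

Lemma path_rev0 p : path_rev p (zero01 R) = p (one01 R).
Proof. by rewrite path_revE zero01E subr0. Qed.

Lemma path_rev1 p : path_rev p (one01 R) = p (zero01 R).
Proof. by rewrite path_revE one01E subrr. Qed.

Lemma path_rev_cvg : continuous path_rev.
Proof.
apply: cont_curry.
have -> : (fun z : pathspace R X * I01 R => path_rev z.1 z.2) =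
    fun z => z.1 (clamp01 (1 - \val z.2)).
  by apply/funext => z; rewrite path_revE.
apply: (@cont_comp _ _ _ (fun z : pathspace R X * I01 R => (z.1, clamp01 (1 - \val z.2)))
  (fun z => z.1 z.2)); last exact: eval_path_continuous.
apply: cont_pair; first exact: cont_fst.
exact: (cont_comp (@cont_snd _ _) rev01_continuous).
Qed.

End paths.
Arguments path_continuous {R X} p.

(** * The groupoid of homotopy classes of paths *)

Section groupoid.
Context {R : realType} {X : topologicalType}.
Implicit Types (p q : pathspace R X) (a b c d : Pi R X) (x y : X).

Definition src c : X := repr c (zero01 R).
Definition tgt c : X := repr c (one01 R).
(** Meaningful only if [tgt c = src d]: otherwise [path_cat] returns its first argument. Hence the
    side conditions in the groupoid laws, for which [Pi_ends] is made. *)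
Definition Pi_mul c d : Pi R X := Pi_class (path_cat (repr c) (repr d)).
Definition Pi_one x : Pi R X := Pi_class (cst x : pathspace R X).
Definition Pi_inv c : Pi R X := Pi_class (path_rev (repr c)).

Lemma Pi_reprK c : Pi_class (repr c) = c. Proof. exact: hcl_repr. Qed.

Lemma src_class p : src (Pi_class p) = p (zero01 R).
Proof. by have [] := Pi_class_ends (Pi_reprK (Pi_class p)). Qed.

Lemma tgt_class p : tgt (Pi_class p) = p (one01 R).
Proof. by have [] := Pi_class_ends (Pi_reprK (Pi_class p)). Qed.

Lemma Pi_mul_class p q : p (one01 R) = q (zero01 R) ->
  Pi_mul (Pi_class p) (Pi_class q) = Pi_class (path_cat p q).
Proof.
move=> pq; apply: Pi_class_catP; rewrite ?Pi_reprK//.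
by rewrite -/(tgt _) -/(src _) tgt_class src_class.
Qed.

Lemma src_Pi_mul c d : tgt c = src d -> src (Pi_mul c d) = src c.
Proof. by move=> cd; rewrite src_class path_cat0. Qed.

Lemma tgt_Pi_mul c d : tgt c = src d -> tgt (Pi_mul c d) = tgt d.
Proof. by move=> cd; rewrite tgt_class path_cat1. Qed.

Lemma src_Pi_one x : src (Pi_one x) = x. Proof. by rewrite src_class. Qed.

Lemma tgt_Pi_one x : tgt (Pi_one x) = x. Proof. by rewrite tgt_class. Qed.

Lemma src_Pi_inv c : src (Pi_inv c) = tgt c.
Proof. by rewrite src_class path_rev0. Qed.

Lemma tgt_Pi_inv c : tgt (Pi_inv c) = src c.
Proof. by rewrite tgt_class path_rev1. Qed.

Lemma Pi_mulA a b c : tgt a = src b -> tgt b = src c ->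
  Pi_mul (Pi_mul a b) c = Pi_mul a (Pi_mul b c).
Proof.
move=> ab bc; rewrite -[c in LHS]Pi_reprK Pi_mul_class ?path_cat1//.
rewrite -[a in RHS]Pi_reprK Pi_mul_class ?path_cat0//.
exact: Pi_class_catA.
Qed.

Lemma Pi_mul1c x c : src c = x -> Pi_mul (Pi_one x) c = c.
Proof.
by move=> <-; rewrite -{2}[c]Pi_reprK Pi_mul_class// Pi_class_cst_cat Pi_reprK.
Qed.

Lemma Pi_mulc1 x c : tgt c = x -> Pi_mul c (Pi_one x) = c.
Proof.
by move=> <-; rewrite -{1}[c]Pi_reprK Pi_mul_class// Pi_class_cat_cst Pi_reprK.
Qed.

End groupoid.

Ltac Pi_ends := rewrite ?src_Pi_one ?tgt_Pi_one ?src_Pi_inv ?tgt_Pi_inv; try done;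
  first [ rewrite src_Pi_mul; Pi_ends | rewrite tgt_Pi_mul; Pi_ends | idtac ].

(** * Classes of paths that factor through a normed space *)

Section lines.
Context {R : realType}.

Definition line (V : normedModType R) (u v : V) (t : R) : V := (1 - t) *: u + t *: v.

Lemma line0 (V : normedModType R) (u v : V) : line u v 0 = u.
Proof. by rewrite /line subr0 scale1r scale0r addr0. Qed.

Lemma line1 (V : normedModType R) (u v : V) : line u v 1 = v.
Proof. by rewrite /line subrr scale1r scale0r add0r. Qed.

Lemma cont_line (T : topologicalType) (V : normedModType R) (f g : T -> V) (k : T -> R) :
  continuous f -> continuous g -> continuous k ->
  continuous (fun x => line (f x) (g x) (k x)).
Proof.
move=> cf cg ck; apply: contD; apply: contZ => //.
by apply: contB => //; exact: cont_cst.
Qed.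

Context {X : topologicalType}.

Definition lpath (V : normedModType R) (F : V -> X) (u v : V) : pathspace R X :=
  to_path (fun t => F (line u v (\val t))).

(** As V is convex, every path in V from u to v has the same class under F ([lcl_path]). Within a
    cell this does the work of a lift to the universal cover. *)
Definition lcl (V : normedModType R) (F : V -> X) (u v : V) : Pi R X :=
  Pi_class (lpath F u v).

Section one_space.
Context {V : normedModType R} {F : V -> X}.
Hypothesis cF : continuous F.

Lemma lpathE u v t : lpath F u v t = F (line u v (\val t)).
Proof.
rewrite to_pathE//; apply: cont_comp cF.
by apply: cont_line; [exact: cont_cst|exact: cont_cst|exact: val01_continuous].
Qed.

Lemma lpath0 u v : lpath F u v (zero01 R) = F u.
Proof. by rewrite lpathE zero01E line0. Qed.

Lemma lpath1 u v : lpath F u v (one01 R) = F v.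
Proof. by rewrite lpathE one01E line1. Qed.

Lemma src_lcl u v : src (lcl F u v) = F u.
Proof. by rewrite src_class lpath0. Qed.

Lemma tgt_lcl u v : tgt (lcl F u v) = F v.
Proof. by rewrite tgt_class lpath1. Qed.

(** The straight-line homotopy in V from [al] to the segment between its ends is fixed at both ends;
    F carries it to X. *)
Lemma lcl_path (al : I01 R -> V) (p : pathspace R X) : continuous al ->
  (forall t, p t = F (al t)) -> Pi_class p = lcl F (al (zero01 R)) (al (one01 R)).
Proof.
move=> cal pE; apply/hclP.
exists (fun z => F (line (al z.1) (line (al (zero01 R)) (al (one01 R)) (\val z.1))
  (\val z.2))); split.
- apply: cont_comp cF; apply: cont_line.
  + exact: cont_fst_comp.
  + apply: cont_line; [exact: cont_cst|exact: cont_cst|].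
    by apply: val01_comp_continuous; exact: cont_fst.
  + by apply: val01_comp_continuous; exact: cont_snd.
- by move=> t; cbn [fst snd]; rewrite zero01E line0.
- by move=> t; cbn [fst snd]; rewrite one01E line1 lpathE.
- move=> t s te; cbn [fst snd]; rewrite pE; congr F.
  have lineE (w : V) (k : R) : line w w k = w.
    by rewrite /line -scalerDl subrK scale1r.
  by case: te => ->; rewrite ?zero01E ?one01E ?line0 ?line1 lineE.
Qed.

Lemma lcl_refl u : lcl F u u = Pi_one (F u).
Proof.
rewrite /Pi_one (@lcl_path (cst u)) //; exact: cont_cst.
Qed.

Lemma Pi_mul_lcl u v w : Pi_mul (lcl F u v) (lcl F v w) = lcl F u w.
Proof.
have uvw : lpath F u v (one01 R) = lpath F v w (zero01 R).
  by rewrite lpath1 lpath0.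
rewrite Pi_mul_class//.
pose al (t : I01 R) := if \val t <= 2^-1 then line u v (\val (clamp01 (2 * \val t)))
  else line v w (\val (clamp01 (2 * \val t - 1))).
have cl (a b : V) (k : I01 R -> R) : continuous k ->
    continuous (fun t => line a b (\val (clamp01 (k t)))).
  move=> ck; apply: cont_line; [exact: cont_cst|exact: cont_cst|].
  apply: (@cont_comp _ _ _ (fun t => clamp01 (k t))); last exact: val01_continuous.
  exact: clamp01_comp_continuous.
rewrite (@lcl_path al).
- congr lcl; rewrite /al.
    by rewrite zero01E invr_ge0 ler0n mulr0 clamp01_0 zero01E line0.
  rewrite one01E ifF; last by apply/negbTE; rewrite -ltNge invf_lt1 ?ltr1n.
  by rewrite mulr1 (_ : 2 - 1 = 1 :> R) ?one01E ?line1// -[2]/(1 + 1) addrK.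
- apply: glue_continuous.
  + exact: val01_continuous.
  + by apply: cl; exact: val01M_continuous.
  + by apply: cl; exact: val01MB_continuous.
  + move=> t ->; rewrite divff ?pnatr_eq0// subrr.
    by rewrite clamp01_1 clamp01_0 one01E zero01E line0 line1.
- move=> t; rewrite path_catE// /path_cat_fun /al.
  by case: ifP => _; rewrite lpathE.
Qed.

Lemma Pi_inv_lcl u v : Pi_inv (lcl F u v) = lcl F v u.
Proof.
rewrite /Pi_inv.
have /hclP[H [cH H0 H1 HA]] := Pi_reprK (lcl F u v).
(* [Pi_inv] reverses a chosen representative. Reversing the homotopy in its path variable replaces
   this representative by [lpath F u v]. *)
have -> : Pi_class (path_rev (repr (lcl F u v))) = Pi_class (path_rev (lpath F u v)).
  apply/hclP; exists (fun z => H (clamp01 (1 - \val z.1), z.2)); split.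
  - apply: (@cont_comp _ _ _ (fun z : I01 R * I01 R => (clamp01 (1 - \val z.1), z.2)) H) => //.
    apply: cont_pair; last exact: cont_snd.
    exact: (cont_comp (@cont_fst _ _) rev01_continuous).
  - by move=> t; rewrite path_revE H0.
  - by move=> t; rewrite path_revE H1.
  - move=> t s te; rewrite path_revE HA //; case: te => ->; cbn [fst snd].
      by rewrite zero01E subr0; right.
    by rewrite one01E subrr; left.
rewrite (@lcl_path (fun t => line u v (\val (clamp01 (1 - \val t))))).
- by rewrite zero01E one01E subr0 subrr clamp01_1 clamp01_0 one01E zero01E line0 line1.
- apply: cont_line; [exact: cont_cst|exact: cont_cst|].
  exact: (cont_comp rev01_continuous (@val01_continuous R)).
- by move=> t; rewrite path_revE lpathE.
Qed.

End one_space.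

Lemma lcl_comp (V W : normedModType R) (F : W -> X) (phi : V -> W) (u v : V) :
  continuous F -> continuous phi ->
  lcl (fun w => F (phi w)) u v = lcl F (phi u) (phi v).
Proof.
move=> cF cphi; rewrite /lcl [LHS](@lcl_path _ _ cF (fun t => phi (line u v (\val t)))).
- by rewrite zero01E one01E line0 line1.
- apply: cont_comp cphi.
  by apply: cont_line; [exact: cont_cst|exact: cont_cst|exact: val01_continuous].
- by move=> t; rewrite lpathE//; exact: (cont_comp cphi cF).
Qed.

Lemma clamp_path_continuous (p : pathspace R X) :
  continuous (fun t : R => p (clamp01 t)).
Proof.
apply: (@cont_comp R (I01 R) X (@clamp01 R) p); first exact: clamp01_continuous.
exact: path_continuous.
Qed.
Arguments clamp_path_continuous : clear implicits.

(** Every path factors through the real line, so the inverse laws of the groupoid reduce to the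
    composition of segments. *)
Lemma Pi_class_lcl (p : pathspace R X) :
  Pi_class p = lcl (fun t : R => p (clamp01 t)) 0 1.
Proof.
have cp := clamp_path_continuous p.
rewrite [LHS](@lcl_path _ _ cp (fun t : I01 R => \val t)) ?zero01E ?one01E//.
  exact: val01_continuous.
by move=> t; rewrite clamp01K.
Qed.

Lemma Pi_lclP (c : Pi R X) : exists2 p : pathspace R X,
  c = Pi_class p & c = lcl (fun t : R => p (clamp01 t)) 0 1.
Proof. by exists (repr c); rewrite -?Pi_class_lcl Pi_reprK. Qed.

Lemma Pi_mulcV (c : Pi R X) : Pi_mul c (Pi_inv c) = Pi_one (src c).
Proof.
have [p _ ->] := Pi_lclP c.
have cp := clamp_path_continuous p.
by rewrite Pi_inv_lcl// Pi_mul_lcl// lcl_refl// src_lcl.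
Qed.

Lemma Pi_mulVc (c : Pi R X) : Pi_mul (Pi_inv c) c = Pi_one (tgt c).
Proof.
have [p _ ->] := Pi_lclP c.
have cp := clamp_path_continuous p.
by rewrite Pi_inv_lcl// Pi_mul_lcl// lcl_refl// tgt_lcl.
Qed.

Lemma Pi_mulKV (a b : Pi R X) : tgt a = src b -> Pi_mul (Pi_inv a) (Pi_mul a b) = b.
Proof.
by move=> ab; rewrite -Pi_mulA ?tgt_Pi_inv// Pi_mulVc Pi_mul1c.
Qed.

Lemma Pi_mulVK (a b : Pi R X) : src a = src b -> Pi_mul a (Pi_mul (Pi_inv a) b) = b.
Proof.
by move=> ab; rewrite -Pi_mulA ?src_Pi_inv ?tgt_Pi_inv// Pi_mulcV Pi_mul1c.
Qed.

Lemma Pi_class_rev (p : pathspace R X) : Pi_class (path_rev p) = Pi_inv (Pi_class p).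
Proof.
have cp := clamp_path_continuous p.
rewrite [Pi_class p]Pi_class_lcl Pi_inv_lcl//.
rewrite [LHS](@lcl_path _ _ cp (fun t : I01 R => 1 - \val t)).
- by rewrite zero01E one01E subr0 subrr.
- by apply: contB; [exact: cont_cst|exact: val01_continuous].
- by move=> t; rewrite path_revE.
Qed.

(** The sets [Pi_basic U V p] are declared as a subbase. A filter is stable under finite
    intersections, so they suffice to test convergence before they are known to form a basis. *)
Lemma Pi_cvg (S : Type) (Fi : set_system S) (f : S -> Pi R X) (c : Pi R X) :
  Filter Fi ->
  (forall (U V : set X) (p : pathspace R X), nice R U -> nice R V ->
    U (p (zero01 R)) -> V (p (one01 R)) ->
    Pi_basic U V p c -> Fi (f @^-1` Pi_basic U V p)) ->
  f @ Fi --> c.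
Proof.
move=> FF H N; rewrite nbhsE => -[O [[D DfI <-] [B DB Bc]] ON].
have [F FD FB] := DfI _ DB.
apply: (@filterS _ Fi _ (\bigcap_(W in [set` F]) f @^-1` W)).
  move=> s sF; apply: ON; exists B => //; change (B (f s)); rewrite -FB => W WF.
  exact: sF.
apply: filter_bigI => W WF.
have := FD _ WF; rewrite inE => -[U [V [q [nU nV Uq Vq WE]]]].
rewrite WE; apply: H => //.
by rewrite -WE; move: Bc; rewrite -FB; exact.
Qed.

Lemma lcl_in_Pi_basic (V1 V2 : normedModType R) (A : V1 -> X) (B : V2 -> X)
    (z : Pi R X) (U V : set X) (p : pathspace R X) (v v' : V1) (w w' : V2) :
  continuous A -> continuous B -> src z = A v -> tgt z = B w ->
  Pi_basic U V p z -> range (lpath A v' v) `<=` U -> range (lpath B w w') `<=` V ->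
  Pi_basic U V p (Pi_mul (Pi_mul (lcl A v' v) z) (lcl B w w')).
Proof.
move=> cA cB zA zB pz UA VB.
apply: (@Pi_basic_sub _ _ U V U V p (repr z)) => //; first by rewrite Pi_reprK.
exists (lpath A v' v), (lpath B w w'); split => //.
- by rewrite lpath1// -zA.
- by rewrite lpath0// -zB.
have e1 : lpath A v' v (one01 R) = repr z (zero01 R) by rewrite lpath1// -zA.
have e2 : repr z (one01 R) = lpath B w w' (zero01 R) by rewrite lpath0// -zB.
rewrite /lcl -{1}[z]Pi_reprK (Pi_mul_class e1) Pi_mul_class//.
by rewrite path_cat1.
Qed.

(** Balls are convex. Both directions are stated because a class is extended at its source by a
    segment towards v, and at its target by a segment away from it. *)
Lemma line_near (V : normedModType R) (v : V) (A : set V) : nbhs v A ->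
  \forall v' \near v, forall t, 0 <= t <= 1 -> A (line v v' t) /\ A (line v' v t).
Proof.
move=> /nbhs_normP[e /= e0 eA].
near=> v'.
have vv' : `|v - v'| < e by near: v'; apply/nbhs_normP; exists e.
move=> t /andP[t0 t1].
split; apply: eA; rewrite /=.
- have -> : v - line v v' t = t *: (v - v').
    by rewrite /line scalerBl scale1r opprD opprB addrA addrCA subrr addr0 scalerBr.
  rewrite normrZ ger0_norm//; apply: le_lt_trans vv'.
  by rewrite ler_piMl.
- have -> : v - line v' v t = (1 - t) *: (v - v').
    by rewrite /line scalerBr !scalerBl !scale1r opprD addrA [v - _ - _]addrAC.
  rewrite normrZ ger0_norm ?subr_ge0//; apply: le_lt_trans vv'.
  by rewrite ler_piMl// lerBlDl lerDr.
Unshelve. all: by end_near. Qed.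

(** The map (v, w) -> (A v, B w) lifts to Pi(X) along the sheet through z. Near (v, w) the class
    changes only by images of short segments, which stay in any given U and V. *)
Lemma lcl_Pi_continuous (V1 V2 : normedModType R) (A : V1 -> X) (B : V2 -> X)
    (v0 : V1) (w0 : V2) (z : Pi R X) :
  continuous A -> continuous B -> src z = A v0 -> tgt z = B w0 ->
  continuous (fun vw : V1 * V2 =>
    Pi_mul (Pi_mul (lcl A vw.1 v0) z) (lcl B w0 vw.2)).
Proof.
move=> cA cB zA zB [v w].
apply: Pi_cvg => U V p [oU _ _] [oV _ _] _ _ /=.
set c := Pi_mul _ _ => pc.
have [cv cw] : src c = A v /\ tgt c = B w.
  by split; rewrite /c; Pi_ends; rewrite ?src_lcl ?tgt_lcl.
have [Uv Vw] : U (A v) /\ V (B w).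
  have [d1 [d2 [d1U d1q d2V d2q cE]]] := pc.
  rewrite -cv -cw cE src_class tgt_class !path_cat0 ?path_cat1//.
  by split; [apply: d1U|apply: d2V]; eexists.
have nU : nbhs v (A @^-1` U) by apply: cA; exact: open_nbhs_nbhs.
have nV : nbhs w (B @^-1` V) by apply: cB; exact: open_nbhs_nbhs.
exists (
  [set v' | forall t, 0 <= t <= 1 -> (A @^-1` U) (line v v' t) /\ (A @^-1` U) (line v' v t)],
  [set w' | forall t, 0 <= t <= 1 -> (B @^-1` V) (line w w' t) /\ (B @^-1` V) (line w' w t)]).
  by split; exact: line_near.
move=> [v' w'] [/= hv hw].
(* Both segments are broken at v and w, so that the class is compared with its value c at (v, w)
   instead of z. *)
have -> : Pi_mul (Pi_mul (lcl A v' v0) z) (lcl B w0 w') =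
    Pi_mul (Pi_mul (lcl A v' v) c) (lcl B w w').
  rewrite /c -(Pi_mul_lcl cA v' v v0) -(Pi_mul_lcl cB w0 w w').
  by rewrite !Pi_mulA; Pi_ends; rewrite ?src_lcl ?tgt_lcl.
apply: lcl_in_Pi_basic => //.
- by move=> _ [t _ <-]; rewrite lpathE//; apply: (hv _ (itv01P t)).2.
- by move=> _ [t _ <-]; rewrite lpathE//; apply: (hw _ (itv01P t)).1.
Qed.

End lines.

(** * A distinguished path property kills higher homotopy *)

Section cubes.
Context {R : realType}.

Lemma cont_row (T U : topologicalType) n (f : 'I_n -> T -> U) :
  (forall i, continuous (f i)) -> continuous (fun t => (\row_i f i t) : 'rV[U]_n).
Proof.
move=> cf t A [P Pt PA]; rewrite nbhs_simpl /=.
have : \forall s \near t, forall i, P ord0 i (f i s).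
  by apply: filter_forall => i; apply: cf; have := Pt ord0 i; rewrite mxE.
by apply: filterS => s Ps; apply: PA => i j; rewrite ord1 mxE.
Qed.

Lemma cont_coord (U : topologicalType) n i : continuous (fun M : 'rV[U]_n => M 0 i).
Proof.
move=> M A MA; rewrite nbhs_simpl /=.
exists (fun k j => if j == i then A else setT).
  by move=> k j; case: eqP => [->|_]; [rewrite ord1|exact: filterT].
by move=> N /= /(_ 0 i); rewrite eqxx.
Qed.

Lemma coord_le_norm n (y : 'rV[R]_n) i : `|y 0 i| <= `|y|.
Proof.
rewrite [leRHS]/Num.norm /= mx_normrE; apply/bigmax_geP; right => /=.
by exists (0, i).
Qed.

Lemma norm_coord n (y : 'rV[R]_n) : 0 < `|y| -> exists i, `|y| = `|y 0 i|.
Proof.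
rewrite [X in 0 < X]/Num.norm /= => /lt0r_neq0 /mx_norm_neq0[[k i]] /= e.
by exists i; rewrite [LHS]/Num.norm /= e ord1.
Qed.

Lemma norm_le_coord n (y : 'rV[R]_n) (e : R) :
  0 <= e -> (forall i, `|y 0 i| <= e) -> `|y| <= e.
Proof.
move=> e0 h; case: (leP `|y| 0) => [|/norm_coord[i ->]//].
by move=> /le_trans; apply.
Qed.

(** The cube becomes the unit ball of the maximum norm, where its boundary is [|y| = 1] and
    dilations are available. *)
Definition of_cube n (t : cube R n) : 'rV[R]_n := \row_i (2 * \val (t 0 i) - 1).

Definition to_cube n (y : 'rV[R]_n) : cube R n :=
  \row_i clamp01 ((y 0 i + 1) / 2).

Lemma of_cube_continuous n : continuous (@of_cube n).
Proof.
apply: cont_row => i; apply: (@cont_comp _ _ _ (fun M : 'rV[I01 R]_n => M 0 i)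
  (fun s => 2 * \val s - 1)); first exact: cont_coord.
exact: val01MB_continuous.
Qed.

Lemma to_cube_continuous n : continuous (@to_cube n).
Proof.
apply: cont_row => i; apply: clamp01_comp_continuous.
apply: contM; last exact: cont_cst.
by apply: contD; [exact: cont_coord|exact: cont_cst].
Qed.

Lemma of_cubeK n : cancel (@of_cube n) (@to_cube n).
Proof.
move=> t; apply/rowP => i; rewrite !mxE -[RHS]clamp01K; congr clamp01.
by rewrite subrK mulrAC divff ?pnatr_eq0// mul1r.
Qed.

Lemma of_cube_le1 n (t : cube R n) : `|of_cube t| <= 1.
Proof.
apply: norm_le_coord => // i; rewrite mxE ler_norml.
by have := itv01P (t 0 i); set x := \val _; lra.
Qed.

Lemma of_cube_boundary n (t : cube R n) : cube_boundary R n t -> `|of_cube t| = 1.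
Proof.
move=> [i ti]; apply/eqP; rewrite eq_le of_cube_le1 /=.
apply: le_trans (coord_le_norm _ i); rewrite mxE.
by case: ti => ->; rewrite ?zero01E ?one01E ler_normr; lra.
Qed.

Lemma to_cube_boundary n (y : 'rV[R]_n) : 1 <= `|y| -> cube_boundary R n (to_cube y).
Proof.
move=> y1; have [|i yi] := norm_coord (lt_le_trans _ y1); first exact: ltr01.
exists i; rewrite mxE; move: y1; rewrite yi ler_normr => /orP[] y1.
  by right; rewrite clamp01_ge1//; lra.
by left; rewrite clamp01_le0//; lra.
Qed.

Lemma cont_norm (V : normedModType R) : continuous (fun v : V => `|v|).
Proof. by move=> v; exact: norm_continuous. Qed.

End cubes.

Section dpp_aspherical.
Context {R : realType} {X : topologicalType}.

Lemma lcl_cst (V : normedModType R) (F : V -> X) (u v : V) (x : X) :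
  continuous F -> (forall t, 0 <= t <= 1 -> F (line u v t) = x) ->
  lcl F u v = Pi_one x.
Proof.
move=> cF Fx; rewrite /lcl /Pi_one; congr Pi_class; apply/continuousEP => t.
by rewrite lpathE// Fx// itv01P.
Qed.

Lemma lineE (V : normedModType R) (v : V) (t : R) : line v v t = v.
Proof. by rewrite /line -scalerDl subrK scale1r. Qed.

(* As [n >= 2], the complement of the open unit ball is connected by polygons. *)
Lemma lcl_outside n (F : 'rV[R]_n -> X) (x : X) (y : 'rV[R]_n) : (1 < n)%N ->
  continuous F -> (forall y, 1 <= `|y| -> F y = x) ->
  1 <= `|y| -> lcl F (const_mx 1) y = Pi_one x.
Proof.
move=> n1 cF Fx y1.
have [|i yi] := norm_coord (lt_le_trans _ y1); first exact: ltr01.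
have [j ij] : exists j : 'I_n, j != i.
  case: (eqVneq (Ordinal (ltnW n1)) i) => [<-|h]; last by exists (Ordinal (ltnW n1)).
  by exists (Ordinal n1).
(* From the corner to y' the coordinate j stays 1; from y' to y the coordinate i, of maximal
   absolute value in y, is fixed. Neither segment enters the open ball. *)
pose y' : 'rV[R]_n := \row_k if k == j then 1 else y 0 k.
rewrite -(Pi_mul_lcl cF _ y' y) !(@lcl_cst _ F _ _ x) ?Pi_mul1c ?src_Pi_one//.
- move=> t _; apply: Fx; apply: le_trans (coord_le_norm _ i).
  by rewrite !mxE eq_sym (negbTE ij) -mulrDl subrK mul1r -yi.
- move=> t _; apply: Fx; apply: le_trans (coord_le_norm _ j).
  by rewrite !mxE eqxx -mulrDl subrK mul1r normr1.
Qed.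

Lemma homotopic_trans (T : topologicalType) (A : set T) (f g h : continuousType T X) :
  homotopic R A f g -> homotopic R A g h -> homotopic R A f h.
Proof.
move=> fg gh; apply/asboolP.
by apply: (@homotopicb_trans R T X A g f h); apply/asboolP.
Qed.

(** For [|y| >= 1] the path [ga y] is always [g (Pi_one x)], a loop at x that may fail to be
    constant. It is contracted by K over the annulus [1 <= |y| <= 2], so that H is constant on the
    outer boundary. *)
Lemma dpp_null_homotopic n (f : continuousType (cube R n) X) (x : X) : (1 < n)%N ->
  dpp R X -> (forall t, cube_boundary R n t -> f t = x) ->
  homotopic R (cube_boundary R n) f (cst x).
Proof.
move=> n1 [g [cg gK]] fx.
have gE c : Pi_class (g c) = c by rewrite -[RHS]/(id c) -gK.
pose F (y : 'rV[R]_n) := f (to_cube y).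
have cF : continuous F by apply: (cont_comp (@to_cube_continuous R n)); exact: cts_fun.
have Fx y : 1 <= `|y| -> F y = x by move=> y1; apply: fx; exact: to_cube_boundary.
pose y0 : 'rV[R]_n := const_mx 1.
have y01 : 1 <= `|y0|.
  apply: le_trans (coord_le_norm _ (Ordinal n1)); by rewrite mxE normr1.
pose Psi y := lcl F y0 y.
have cPsi : continuous Psi.
  (* A trivial factor over a constant map of the line puts [Psi] in the form of [lcl_Pi_continuous],
     where both ends are free to move. *)
  have -> : Psi = fun y => Pi_mul (Pi_mul (lcl (fun _ : R => x) 0 0) (Pi_one x)) (lcl F y0 y).
    apply/funext => y.
    rewrite lcl_refl ?Pi_mul1c ?src_Pi_mul ?src_Pi_one ?tgt_Pi_one ?src_lcl ?Fx//.
    exact: cont_cst.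
  apply: (@cont_comp _ _ _ (fun y : 'rV[R]_n => (0 : R, y))
    (fun z => Pi_mul (Pi_mul (lcl (fun _ : R => x) z.1 0) (Pi_one x)) (lcl F y0 z.2))).
    by apply: cont_pair; [exact: cont_cst|exact: cont_id].
  apply: lcl_Pi_continuous => //; rewrite ?src_Pi_one ?tgt_Pi_one ?Fx//.
  exact: cont_cst.
pose ga y := g (Psi y).
have cga : continuous ga by exact: (cont_comp cPsi cg).
have ga0 y : ga y (zero01 R) = x.
  by rewrite -src_class gE src_lcl// Fx.
have ga1 y : ga y (one01 R) = F y by rewrite -tgt_class gE tgt_lcl.
have gaE y : 1 <= `|y| -> ga y = g (Pi_one x).
  by move=> y1; rewrite /ga /Psi (@lcl_outside _ _ x).
have /hclP[K [cK K0 K1 KA]] := gE (Pi_one x).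
pose H (z : 'rV[R]_n * I01 R) := if `|z.1| <= 1 then ga z.1 z.2
  else K (z.2, clamp01 (`|z.1| - 1)).
have cn : continuous (fun z : 'rV[R]_n * I01 R => `|z.1|).
  by apply: cont_comp (@cont_norm _ _); exact: cont_fst.
have cH : continuous H.
  apply: glue_continuous => //.
  - exact: cont_uncurry.
  - apply: (@cont_comp _ _ _ (fun z : 'rV[R]_n * I01 R => (z.2, clamp01 (`|z.1| - 1)))) => //.
    apply: cont_pair; first exact: cont_snd.
    by apply: clamp01_comp_continuous; apply: contB => //; exact: cont_cst.
  - by move=> z z1; rewrite gaE ?z1// subrr clamp01_0 K0.
have cV2 : continuous (fun t : cube R n => 2 *: of_cube t).
  by apply: contZ; [exact: cont_cst|exact: of_cube_continuous].
have cFV2 : continuous (fun t : cube R n => F (2 *: of_cube t)).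
  exact: (cont_comp cV2 cF).
have H1 y : H (y, one01 R) = F y.
  rewrite /H; cbn [fst snd]; case: leP => [_|/ltW y1]; first exact: ga1.
  by rewrite KA; [rewrite -tgt_class gE tgt_Pi_one Fx|right].
(* The spheroid is first dilated to [F (2 y)], which is x as soon as [|2 y| >= 1]; this makes room
   for the annulus. *)
apply: (@homotopic_trans _ _ _ (mkcts cFV2)).
  exists (fun z => F ((1 + \val z.2) *: of_cube z.1)); split.
  - apply: (@cont_comp _ _ _ (fun z : cube R n * I01 R => (1 + \val z.2) *: of_cube z.1)) => //.
    apply: contZ; last by apply: cont_fst_comp; exact: of_cube_continuous.
    apply: contD; first exact: cont_cst.
    by apply: val01_comp_continuous; exact: cont_snd.
  - by move=> t; cbn [fst snd]; rewrite zero01E addr0 scale1r /F of_cubeK.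
  - by move=> t; cbn [fst snd]; rewrite one01E.
  - move=> t s te; cbn [fst snd]; rewrite fx//; apply: Fx.
    rewrite normrZ of_cube_boundary// mulr1 ger0_norm.
      by have := itv01P s; set u := \val s; lra.
    by have := itv01P s; set u := \val s; lra.
apply: homotopic_sym.
exists (fun z => H (2 *: of_cube z.1, z.2)); split.
- apply: (@cont_comp _ _ _ (fun z : cube R n * I01 R => (2 *: of_cube z.1, z.2)) H) => //.
  by apply: cont_pair; [exact: (cont_comp (@cont_fst _ _) cV2)|exact: cont_snd].
- move=> t; cbn [fst snd]; rewrite /H; cbn [fst snd].
  case: leP => [_|y1]; first exact: ga0.
  by rewrite KA; [rewrite -src_class gE src_Pi_one|left].
- by move=> t; cbn [fst snd]; rewrite H1.
- move=> t s te; cbn [fst snd].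
  rewrite /H; cbn [fst snd]; rewrite normrZ of_cube_boundary// mulr1 ger0_norm//.
  rewrite ifF; last by apply/negbTE; rewrite -ltNge ltr1n.
  by rewrite clamp01_ge1 ?K1//; lra.
Qed.

Lemma dpp_pi_n n (x : X) : (2 <= n)%N -> dpp R X ->
  pi_n R n x = [set hcl R (cube_boundary R n) (cst x)].
Proof.
move=> n2 dX; apply/seteqP; split => c.
  move=> [f fx ->]; apply/hclP; exact: dpp_null_homotopic.
by move=> ->; exists (cst x).
Qed.

End dpp_aspherical.

(** * CW-complexes *)

Section euclidean_norm.
Context {R : realType} {n : nat}.
Implicit Types v : 'rV[R]_n.

(** The norm [|v|] of a row is the maximum norm, whereas the discs of a CW-structure are
    Euclidean. *)
Definition nrm v : R := Num.sqrt (sqnorm v).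

Lemma sqnorm_ge0 v : 0 <= sqnorm v.
Proof. by apply: sumr_ge0 => i _; exact: sqr_ge0. Qed.

Lemma nrm_ge0 v : 0 <= nrm v. Proof. exact: sqrtr_ge0. Qed.

Lemma nrmZ (k : R) v : nrm (k *: v) = `|k| * nrm v.
Proof.
rewrite /nrm; have -> : sqnorm (k *: v) = k ^+ 2 * sqnorm v.
  by rewrite /sqnorm mulr_sumr; apply: eq_bigr => i _; rewrite mxE exprMn.
by rewrite sqrtrM ?sqr_ge0// sqrtr_sqr.
Qed.

Lemma coord_le_nrm v i : `|v 0 i| <= nrm v.
Proof.
rewrite -sqrtr_sqr; apply: ler_wsqrtr; rewrite /sqnorm (bigD1 i)//=.
by rewrite lerDl; apply: sumr_ge0 => j _; exact: sqr_ge0.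
Qed.

Lemma nrm_eq0 v : nrm v = 0 -> v = 0.
Proof.
move=> v0; apply/rowP => i; rewrite mxE; apply/eqP.
by rewrite -normr_le0 -v0 coord_le_nrm.
Qed.

Lemma nrm0 : nrm 0 = 0.
Proof. by rewrite -[X in nrm X](scale0r 0) nrmZ normr0 mul0r. Qed.

Lemma nrm_continuous : continuous nrm.
Proof.
apply: (@cont_comp _ _ _ (@sqnorm R n) Num.sqrt); last exact: sqrt_continuous.
rewrite /sqnorm; apply: (@continuous_big R).
  by apply: contD; [exact: cont_fst|exact: cont_snd].
by move=> i _; apply: contM; exact: cont_coord.
Qed.

Lemma discE v : @disc R n v <-> nrm v <= 1.
Proof. by rewrite /disc /nrm /= -{2}sqrtr1 ler_sqrt ?ltr01. Qed.

Lemma open_discE v : @open_disc R n v <-> nrm v < 1.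
Proof. by rewrite /open_disc /nrm /= -{2}sqrtr1 ltr_sqrt ?ltr01. Qed.

Lemma sphereE v : @sphere R n v <-> nrm v = 1.
Proof.
rewrite /sphere /nrm /=; split => [->|v1]; first by rewrite sqrtr1.
by rewrite -[LHS]sqr_sqrtr ?sqnorm_ge0// v1 expr1n.
Qed.

Lemma disc_closed : closed (@disc R n).
Proof.
have -> : @disc R n = [set v | nrm v <= 1] by apply/funext => v; exact/propext/discE.
by apply: closed_leR; [exact: nrm_continuous|exact: cont_cst].
Qed.

Lemma disc_compact : compact (@disc R n).
Proof.
apply: bounded_closed_compact; last exact: disc_closed.
exists 1; split; first exact: num_real.
move=> M M1 v /discE v1; apply: norm_le_coord; first by apply/ltW/(le_lt_trans _ M1)/ler01.
by move=> i; apply: le_trans (coord_le_nrm _ _) (le_trans v1 (ltW M1)).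
Qed.

Definition retract_disc v : 'rV[R]_n := (Num.max 1 (nrm v))^-1 *: v.
(* Only meant for [|v| >= 1/2], where it is the radial projection to the sphere. *)
Definition push_out v : 'rV[R]_n := (Num.max (nrm v) 2^-1)^-1 *: v.

Lemma retract_disc_continuous : continuous retract_disc.
Proof.
apply: contZ; last exact: cont_id.
apply: contV => [v|]; first by rewrite gt_eqF// lt_max ltr01.
by apply: cont_max; [exact: cont_cst|exact: nrm_continuous].
Qed.

Lemma push_out_continuous : continuous push_out.
Proof.
apply: contZ; last exact: cont_id.
apply: contV => [v|]; first by rewrite gt_eqF// lt_max invr_gt0 ltr0n orbT.
by apply: cont_max; [exact: nrm_continuous|exact: cont_cst].
Qed.

Lemma retract_disc_id v : nrm v <= 1 -> retract_disc v = v.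
Proof. by move=> v1; rewrite /retract_disc max_l// invr1 scale1r. Qed.

Lemma nrm_retract_out v : 1 <= nrm v -> nrm (retract_disc v) = 1.
Proof.
move=> v1; rewrite nrmZ max_r// ger0_norm ?invr_ge0 ?nrm_ge0// mulVf//.
by rewrite gt_eqF// (lt_le_trans _ v1).
Qed.

Lemma nrm_retract_disc v : nrm (retract_disc v) <= 1.
Proof.
by case: (leP (nrm v) 1) => [v1|/ltW/nrm_retract_out->//]; rewrite retract_disc_id.
Qed.

Lemma invr2_gt0 : 0 < 2^-1 :> R. Proof. by rewrite invr_gt0. Qed.

Lemma nrm_push_out v : 2^-1 <= nrm v -> nrm (push_out v) = 1.
Proof.
move=> v1; rewrite nrmZ max_l// ger0_norm ?invr_ge0 ?nrm_ge0// mulVf//.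
by rewrite gt_eqF// (lt_le_trans invr2_gt0).
Qed.

Lemma push_outZ v (k : R) : 0 < k -> 2^-1 <= nrm v -> 2^-1 <= nrm (k *: v) ->
  push_out (k *: v) = push_out v.
Proof.
move=> k0 v1 kv1; rewrite /push_out !max_l// nrmZ gtr0_norm// scalerA.
by rewrite invfM -mulrA [_^-1 * k]mulrC mulrA mulVf ?mul1r// gt_eqF.
Qed.

Lemma push_out_sphere v : nrm v = 1 -> push_out v = v.
Proof.
move=> v1; rewrite /push_out max_l v1 ?invr1 ?scale1r//.
by rewrite invf_le1 ?ler1n.
Qed.

Lemma retract_push_out v : 1 <= nrm v -> retract_disc v = push_out v.
Proof.
move=> v1; rewrite /retract_disc /push_out max_r// max_l//.
by apply: le_trans v1; rewrite invf_le1 ?ler1n.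
Qed.

End euclidean_norm.

Section cw.
Context {R : realType} {X : topologicalType} (K : cw_structure R X).
Implicit Types (a b : cw_cell K) (x y : X).

Local Notation dim := (@cw_dim R X K).
Local Notation cmap a := (@cw_map R X K a).

(** Extending the characteristic map constantly along rays outside the disc makes it continuous on
    the whole space, as [lcl] requires. *)
Definition chi a (v : 'rV[R]_(dim a)) : X := cmap a (retract_disc v).
Arguments chi : clear implicits.

Lemma chi_continuous a : continuous (chi a).
Proof.
apply: (@within_setT _ _ setT) => //.
apply: (@within_comp _ _ _ setT (@disc R (dim a)) _ (cmap a)).
- by apply: continuous_subspaceT; exact: retract_disc_continuous.
- exact: cw_continuous.
- by move=> v _; apply/discE; exact: nrm_retract_disc.
Qed.

Lemma chi_disc a v : nrm v <= 1 -> chi a v = cmap a v.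
Proof. by move=> v1; rewrite /chi retract_disc_id. Qed.

Lemma chi_retract a v : chi a (retract_disc v) = chi a v.
Proof. by rewrite /chi retract_disc_id// nrm_retract_disc. Qed.

Lemma chi_push_out a v : 1 <= nrm v -> chi a (push_out v) = chi a v.
Proof. by move=> v1; rewrite -retract_push_out// chi_retract. Qed.

Lemma exists_cell_code x : exists s : {a & 'rV[R]_(dim a)},
  nrm (projT2 s) < 1 /\ chi (projT1 s) (projT2 s) = x.
Proof.
have : (\bigcup_a (cmap a @` @open_disc R (dim a))) x by rewrite cw_cover.
move=> [a _ [v /open_discE v1 <-]]; exists (existT _ a v) => /=; split => //.
by rewrite chi_disc// ltW.
Qed.

Definition cell_code x := sval (cid (exists_cell_code x)).

Definition celldim x := dim (projT1 (cell_code x)).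

Lemma cell_code_chi a v : nrm v < 1 -> cell_code (chi a v) = existT _ a v.
Proof.
rewrite /cell_code; case: cid => -[b w] /= [w1 wv] v1.
have e : b = a.
  apply: (@cw_disjoint _ _ K) => //; exists (chi a v); split.
    by exists w; [exact/open_discE|rewrite -wv chi_disc// ltW].
  by exists v; [exact/open_discE|rewrite chi_disc// ltW].
subst b; congr existT.
apply: (@cw_injective _ _ K a); rewrite ?inE; [exact/open_discE|exact/open_discE|].
by move: wv; rewrite !chi_disc// ltW.
Qed.

Lemma cell_codeP x : exists a (v : 'rV[R]_(dim a)),
  [/\ nrm v < 1, x = chi a v & cell_code x = existT _ a v].
Proof.
have [[a v] /= [v1 <-]] := exists_cell_code x.
by exists a, v; split => //; exact: cell_code_chi.
Qed.

Lemma celldim_chi a v : nrm v < 1 -> celldim (chi a v) = dim a.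
Proof. by move=> v1; rewrite /celldim cell_code_chi. Qed.

Lemma chi_sphere a : exists F : set (cw_cell K),
  [/\ finite_set F, forall b, F b -> (dim b < dim a)%N &
      forall v, 1 <= nrm v -> exists b (w : 'rV[R]_(dim b)),
        [/\ F b, nrm w < 1 & chi a v = chi b w]].
Proof.
have [F [fF Fa Fc]] := cw_closure_finite a; exists F; split => // v v1.
have [|b Fb [w /open_discE w1 wv]] := Fc (chi a v).
  by exists (retract_disc v) => //; apply/sphereE/nrm_retract_out.
by exists b, w; split => //; rewrite -wv chi_disc// ltW.
Qed.

Lemma celldim_sphere a v : 1 <= nrm v -> (celldim (chi a v) < dim a)%N.
Proof.
have [F [_ Fa Fc]] := chi_sphere a.
by move=> /Fc[b [w [Fb w1 ->]]]; rewrite celldim_chi// Fa.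
Qed.

Lemma celldim_le a v : (celldim (chi a v) <= dim a)%N.
Proof.
by case: (ltP (nrm v) 1) => [/celldim_chi->//|/celldim_sphere/ltnW].
Qed.

(** The inequality is strict: this is the (m-1)-skeleton, and [skel (dim a)] is the one that
    contains the boundary of a. *)
Definition skel m : set X := [set x | (celldim x < m)%N].

Lemma cw_closed (C : set X) : (forall a, closed (chi a @^-1` C)) -> closed C.
Proof.
move=> cC; apply: (@cw_weak _ _ K) => a.
rewrite (_ : _ `&` _ = @disc R (dim a) `&` chi a @^-1` C).
  by apply: closedI => //; exact: disc_closed.
by apply/seteqP; split => v /= [dv]; rewrite chi_disc//; exact/discE.
Qed.

(* The closure-finiteness of the cells makes the topology of the skeleta weak. *)
Lemma skel_closed (C : set X) m :
  (forall a, (dim a < m)%N -> closed (chi a @^-1` C)) -> closed (C `&` skel m).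
Proof.
move=> cC; apply: cw_closed => a.
case: (ltnP (dim a) m) => am.
  rewrite (_ : _ @^-1` _ = chi a @^-1` C); first exact: cC.
  apply/seteqP; split => v /= => [[]//|Cv]; split => //.
  exact: leq_ltn_trans (celldim_le v) am.
have [F [fF Fa Fc]] := chi_sphere a.
(* When [dim a >= m] the open cell misses [skel m]. On the sphere, finitely many cells b are met,
   and each contributes a compact set. *)
pose D := \bigcup_(b in F `&` [set b | (dim b < m)%N])
  (chi b @` (@disc R (dim b) `&` chi b @^-1` C)).
rewrite (_ : _ @^-1` _ = [set v | 1 <= nrm v] `&` chi a @^-1` D).
  apply: closedI.
    by apply: closed_leR; [exact: cont_cst|exact: nrm_continuous].
  apply: preimage_closed; first by move=> v _; exact: chi_continuous.
  apply: (@closed_bigcup _ {classic cw_cell K}); first by apply: sub_finite_set fF => b [].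
  move=> b [Fb bm]; apply: compact_closed; first exact: (cw_hausdorff K).
  apply: continuous_compact.
    by apply: continuous_subspaceT; exact: chi_continuous.
  by apply: compact_closedI; [exact: disc_compact|exact: cC].
apply/seteqP; split => v /=.
  move=> [Cv vm]; case: (ltP (nrm v) 1) => v1.
    by move: vm; rewrite /skel /= celldim_chi// ltnNge am.
  split => //; have [b [w [Fb w1 vw]]] := Fc _ v1.
  exists b; first by split => //; move: vm; rewrite /skel /= vw celldim_chi.
  by exists w; rewrite -?vw//; split; rewrite /= -?vw//; apply/discE/ltW.
move=> [v1 [b [Fb bm] [w [_ Cw] wv]]]; rewrite -wv; split => //.
exact: leq_ltn_trans (celldim_le w) bm.
Qed.

(** Induction on the dimension. Sets and maps whose description on a cell refers to its boundary,
    such as stars and the collar homotopy, are handled by this principle and its two variants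
    below. *)
Lemma cw_closed_ind (C : set X) :
  (forall a, closed (C `&` skel (dim a)) -> closed (chi a @^-1` C)) -> closed C.
Proof.
move=> IH; suff H m : forall a, (dim a < m)%N -> closed (chi a @^-1` C).
  by apply: cw_closed => a; apply: (H (dim a).+1).
elim: m => // m IHm a; rewrite ltnS => am; apply: IH; apply: skel_closed => b bm.
by apply: IHm; exact: leq_trans am.
Qed.

Lemma cw_open_ind (Q : set X) :
  (forall a, closed (~` Q `&` skel (dim a)) -> open (chi a @^-1` Q)) -> open Q.
Proof.
move=> IH; rewrite -closedC; apply: cw_closed_ind => a /IH.
by rewrite -closedC.
Qed.

Lemma cw_continuous_ind (Y : topologicalType) (f : X -> Y) :
  (forall a, {within skel (dim a), continuous f} ->
    continuous (fun v => f (chi a v))) -> continuous f.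
Proof.
move=> IH; suff H m : forall a, (dim a < m)%N -> continuous (fun v => f (chi a v)).
  apply/continuous_closedP => C cC; apply: cw_closed => a.
  by apply: (preimage_closed _ cC) => v _; apply: (H (dim a).+1).
elim: m => // m IHm a; rewrite ltnS => am; apply: IH.
apply/continuous_closedP => C cC; apply/closed_subspaceP.
exists (f @^-1` C `&` skel (dim a)); last by rewrite -setIA setIid.
apply: skel_closed => b bm.
apply: (preimage_closed _ cC) => v _; apply: IHm; exact: leq_trans am.
Qed.

Definition path_component (W : set X) x : set X :=
  [set y | exists p : pathspace R X,
    [/\ range p `<=` W, p (zero01 R) = x & p (one01 R) = y]].

Lemma path_component_sub (W : set X) x : path_component W x `<=` W.
Proof. by move=> y [p [pW _ <-]]; apply: pW; eexists. Qed.

Lemma path_component_refl (W : set X) x : W x -> path_component W x x.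
Proof. by move=> Wx; exists (cst x); split => // _ [t _ <-]. Qed.

Lemma path_component_trans (W : set X) x y z :
  path_component W x y -> path_component W y z -> path_component W x z.
Proof.
move=> [p [pW p0 p1]] [q [qW q0 q1]]; exists (path_cat p q).
have pq : p (one01 R) = q (zero01 R) by rewrite p1.
by split; rewrite ?path_cat0 ?path_cat1//; exact: range_path_cat.
Qed.

Lemma path_component_sym (W : set X) x y :
  path_component W x y -> path_component W y x.
Proof.
move=> [p [pW p0 p1]]; exists (path_rev p); rewrite path_rev0 path_rev1; split => //.
by move=> _ [t _ <-]; rewrite path_revE; apply: pW; eexists.
Qed.

(** Near v, the segment from v to w is mapped into W by [chi a], so the component has an open
    preimage in every cell. *)
Lemma path_component_open (W : set X) x : open W -> open (path_component W x).
Proof.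
move=> oW; apply: cw_open_ind => a _; rewrite openE => v xv.
have Wv : W (chi a v) by exact: path_component_sub xv.
have : nbhs v (chi a @^-1` W) by apply: chi_continuous; exact: open_nbhs_nbhs.
move=> /line_near; rewrite /interior; apply: filterS => w vw /=.
apply: path_component_trans xv _; exists (lpath (chi a) v w).
have cx := @chi_continuous a.
split; rewrite ?lpath0 ?lpath1//.
by move=> _ [t _ <-]; rewrite lpathE//; apply: (vw _ (itv01P t)).1.
Qed.

Lemma cw_path_connected : connected [set: X] -> path_connected R X.
Proof.
move=> cX x y.
suff : path_component setT x y by move=> [p [_ p0 p1]]; exists p.
suff -> : path_component setT x = setT by [].
have ox z : open (path_component setT z) by apply: path_component_open; exact: openT.
apply: cX.
- by exists x; exact: path_component_refl.
- by exists (path_component setT x) => //; rewrite setTI.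
- exists (path_component setT x); last by rewrite setTI.
  rewrite -openC (_ : ~` _ = \bigcup_(z in ~` path_component setT x) path_component setT z).
    exact: bigcup_open.
  apply/seteqP; split => z /= => [xz|[w xw wz] xz].
    by exists z => //; exact: path_component_refl.
  apply: xw; apply: path_component_trans xz _; exact: path_component_sym.
Qed.

End cw.
Arguments chi {R X K} a v.
Arguments chi_continuous {R X K} a.
Arguments cell_code {R X} K x.
Arguments cell_codeP {R X} K x.
Arguments celldim {R X} K x.
Arguments skel {R X} K m.
Arguments path_component R {X} W x.

(** * Collapsing collars *)

Section collars.
Context {R : realType} {X : topologicalType} (K : cw_structure R X).
Implicit Types (a b : cw_cell K) (x y : X).

Local Notation dim := (@cw_dim R X K).

Lemma chi_inj a (u v : 'rV[R]_(dim a)) : nrm u < 1 -> nrm v < 1 ->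
  chi a u = chi a v -> u = v.
Proof.
move=> u1 v1; rewrite !chi_disc ?ltW// => uv.
by apply: (@cw_injective _ _ K a) uv; rewrite inE; exact/open_discE.
Qed.

Lemma chi_cell a b (u : 'rV[R]_(dim a)) (v : 'rV[R]_(dim b)) :
  nrm u < 1 -> nrm v < 1 -> chi a u = chi b v -> a = b.
Proof.
move=> u1 v1 uv; have := congr1 (fun x => projT1 (cell_code K x)) uv.
by rewrite !cell_code_chi.
Qed.
Lemma r01_ge0 (t : I01 R) : 0 <= \val t. Proof. by case/andP: (itv01P t). Qed.

(* The disc with the track of a homotopy [h] of its boundary glued on
   as the annulus [1 <= |w| <= 2]. *)
Definition extended_cell (h : X -> pathspace R X) a (w : 'rV[R]_(dim a)) : X :=
  if nrm w <= 1 then chi a w else h (chi a w) (clamp01 (nrm w - 1)).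

(** At time 1 a vector of norm s in [1/2, 1] is sent to norm 2, the outer end of the annulus, and
    the ball of radius 1/2 is stretched to radius 2. For s = 1 the factor is 1 + t, which makes the
    homotopy agree with the one of the boundary. *)
Definition dilation (s t : R) : R := 1 + t * (2 / Num.max s 2^-1 - 1).

Definition collar_step (h : X -> pathspace R X) x : pathspace R X :=
  let: existT a v := cell_code K x in
  to_path (fun t => extended_cell h (dilation (nrm v) (\val t) *: v)).

(** Recursion on the dimension written as an iteration: [collar_step] consults its argument only at
    points of smaller [celldim], so the value at x is stable from this number of iterations on. *)
Definition collar_homotopy x : pathspace R X :=
  iter (celldim K x).+1 collar_step (fun x => cst x) x.

Definition collar_map x : X := collar_homotopy x (one01 R).

Local Notation h := collar_homotopy.
Local Notation r := collar_map.

Lemma collar_step_eq g g' x :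
  (forall y, (celldim K y < celldim K x)%N -> g y = g' y) ->
  collar_step g x = collar_step g' x.
Proof.
have [a [v [v1 -> _]]] := cell_codeP K x; rewrite /collar_step cell_code_chi//.
rewrite celldim_chi// => gg'; congr to_path; apply/funext => t.
rewrite /extended_cell; case: leP => // w1.
by rewrite gg'//; apply: celldim_sphere; exact: ltW.
Qed.

Lemma iter_collar_step m x : (celldim K x < m)%N ->
  iter m.+1 collar_step (fun x => cst x) x = iter m collar_step (fun x => cst x) x.
Proof.
elim: m x => // m IHm x; rewrite ltnS => xm.
rewrite iterS [in RHS]iterS; apply: collar_step_eq => y yx.
by apply: IHm; exact: leq_trans yx xm.
Qed.

Lemma collar_homotopy_iter m x : (celldim K x < m)%N ->
  iter m collar_step (fun x => cst x) x = h x.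
Proof.
elim: m => // m IHm; rewrite ltnS leq_eqVlt => /orP[/eqP<-//|xm].
by rewrite iter_collar_step// IHm.
Qed.

Lemma collar_homotopyE x : h x = collar_step h x.
Proof.
rewrite /collar_homotopy iterS; apply: collar_step_eq => y yx.
exact: collar_homotopy_iter.
Qed.

Lemma to_path0 (f : I01 R -> X) : to_path f (zero01 R) = f (zero01 R).
Proof. by rewrite /to_path; case: pselect. Qed.

Lemma dilation0 s : dilation s 0 = 1.
Proof. by rewrite /dilation mul0r addr0. Qed.

Lemma dilation_sphere t : dilation 1 t = 1 + t.
Proof.
rewrite /dilation max_l; last by rewrite invf_le1 ?ler1n.
by rewrite divr1 -[2]/(1 + 1) addrK mulr1.
Qed.

Lemma dilation1 s : dilation s 1 = 2 / Num.max s 2^-1.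
Proof. by rewrite /dilation mul1r addrC subrK. Qed.

Lemma collar_homotopy0 x : h x (zero01 R) = x.
Proof.
rewrite collar_homotopyE /collar_step.
have [a [v [v1 xE ->]]] := cell_codeP K x.
by rewrite [RHS]xE to_path0 zero01E dilation0 scale1r /extended_cell ltW.
Qed.

Section skeletal_step.
Variable a : cw_cell K.
Hypothesis ch : {within skel K (dim a), continuous h}.

(** On the annulus h is evaluated at boundary points only, so continuity on [skel K (dim a)] is
    enough. The pieces agree at norm 1 because h starts at the identity. *)
Lemma extended_cell_continuous_step : continuous (@extended_cell h a).
Proof.
have cn := @nrm_continuous R (dim a).
apply: glue_le => //; first exact: cont_cst.
- by apply: continuous_subspaceT; exact: chi_continuous.
- apply: within_uncurry.
    apply: (within_comp (B := skel K (dim a))) => //.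
      by apply: continuous_subspaceT; exact: chi_continuous.
    by move=> w w1; exact: celldim_sphere.
  apply: continuous_subspaceT; apply: clamp01_comp_continuous.
  by apply: contB => //; exact: cont_cst.
- by move=> w w1; rewrite w1 subrr clamp01_0 collar_homotopy0.
Qed.

Lemma dilated_continuous_step : continuous (fun z : 'rV[R]_(dim a) * I01 R =>
  extended_cell h (dilation (nrm z.1) (\val z.2) *: z.1)).
Proof.
apply: (@cont_comp _ _ _ (fun z : 'rV[R]_(dim a) * I01 R =>
  dilation (nrm z.1) (\val z.2) *: z.1) (@extended_cell h a)); last first.
  exact: extended_cell_continuous_step.
apply: contZ; last exact: cont_fst.
apply: contD; first exact: cont_cst.
apply: contM; first by apply: val01_comp_continuous; exact: cont_snd.
apply: contB; last exact: cont_cst.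
apply: contM; first exact: cont_cst.
apply: contV => [z|]; first by rewrite gt_eqF// lt_max invr2_gt0 orbT.
apply: cont_max; last exact: cont_cst.
exact: (cont_comp (@cont_fst _ _) (@nrm_continuous R (dim a))).
Qed.

(** The recursion gives this for [nrm v < 1]. On the sphere the factor is 1 + t, and the annulus
    returns the value of h at time t on the lower cell. *)
Lemma collar_homotopy_chi_step (v : 'rV[R]_(dim a)) t : nrm v <= 1 ->
  h (chi a v) t = extended_cell h (dilation (nrm v) (\val t) *: v).
Proof.
rewrite le_eqVlt => /orP[/eqP v1|v1].
  rewrite v1 dilation_sphere.
  have nv : nrm ((1 + \val t) *: v) = 1 + \val t.
    by rewrite nrmZ v1 mulr1 ger0_norm// addr_ge0// r01_ge0.
  have cv : chi a ((1 + \val t) *: v) = chi a v.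
    rewrite -[LHS]chi_push_out ?nv ?lerDl ?r01_ge0// push_outZ ?nv ?v1 ?push_out_sphere//.
    - by apply: (lt_le_trans ltr01); rewrite lerDl r01_ge0.
    - by rewrite invf_le1 ?ler1n.
    - by apply: (@le_trans _ _ 1); rewrite ?lerDl ?r01_ge0// invf_le1 ?ler1n.
  rewrite /extended_cell nv cv; case: leP => [t1|_].
    have t0 : \val t = 0 by have := r01_ge0 t; move: t1; set u := \val t; lra.
    by rewrite -[t]clamp01K t0 clamp01_0 collar_homotopy0.
  by rewrite [1 + _]addrC addrK clamp01K.
rewrite collar_homotopyE /collar_step cell_code_chi// to_pathE//.
apply: (@cont_comp _ _ _ (fun t : I01 R => (v, t)) _ _ dilated_continuous_step).
by apply: cont_pair; [exact: cont_cst|exact: cont_id].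
Qed.

Lemma collar_homotopy_chi_continuous_step : continuous (fun v => h (chi a v)).
Proof.
apply: cont_curry.
have -> : (fun z : 'rV[R]_(dim a) * I01 R => h (chi a z.1) z.2) = fun z =>
    extended_cell h (dilation (nrm (retract_disc z.1)) (\val z.2) *: retract_disc z.1).
  apply/funext => z.
  by rewrite -chi_retract collar_homotopy_chi_step// nrm_retract_disc.
apply: (@cont_comp _ _ _ (fun z : 'rV[R]_(dim a) * I01 R => (retract_disc z.1, z.2))
  _ _ dilated_continuous_step).
apply: cont_pair; last exact: cont_snd.
exact: (cont_comp (@cont_fst _ _) (@retract_disc_continuous R (dim a))).
Qed.

End skeletal_step.

Lemma collar_homotopy_continuous : continuous h.
Proof.
apply: (cw_continuous_ind (K := K)) => a; exact: collar_homotopy_chi_continuous_step.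
Qed.

Lemma collar_homotopy_chi a (v : 'rV[R]_(dim a)) t : nrm v <= 1 ->
  h (chi a v) t = extended_cell h (dilation (nrm v) (\val t) *: v).
Proof.
apply: collar_homotopy_chi_step; apply: continuous_subspaceT.
exact: collar_homotopy_continuous.
Qed.

Lemma collar_map_continuous : continuous r.
Proof.
apply: (@cont_comp _ _ _ (fun x => (h x, one01 R)) (fun z => z.1 z.2)).
  by apply: cont_pair; [exact: collar_homotopy_continuous|exact: cont_cst].
exact: eval_path_continuous.
Qed.

Lemma invr2_le1 : 2^-1 <= 1 :> R. Proof. by rewrite invf_le1 ?ler1n. Qed.

(** At time 1 the whole collar sits at radius 2, so r depends there on the direction of v only. *)
Lemma collar_map_push_out a (v : 'rV[R]_(dim a)) : 2^-1 <= nrm v ->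
  r (chi a (push_out v)) = r (chi a v).
Proof.
move=> v2; case: (leP (nrm v) 1) => [v1|/ltW v1]; last by rewrite chi_push_out.
rewrite [RHS]/r collar_homotopy_chi// one01E dilation1 max_l//.
have v0 : 0 < nrm v by exact: lt_le_trans invr2_gt0 v2.
have nw : nrm ((2 / nrm v) *: v) = 2.
  by rewrite nrmZ gtr0_norm ?divr_gt0// mulrAC -mulrA divff ?mulr1// gt_eqF.
have w1 : 1 <= nrm ((2 / nrm v) *: v) by rewrite nw ler1n.
rewrite /extended_cell ifF ?nw; last by apply/negbTE; rewrite -ltNge ltr1n.
rewrite (_ : 2 - 1 = 1) ?clamp01_1 -/(r _); last by rewrite -[2]/(1 + 1) addrK.
rewrite -[in RHS]chi_push_out// push_outZ ?divr_gt0//.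
exact: le_trans invr2_le1 w1.
Qed.

(** One step of a discontinuous retraction: a point is pushed out of the collar of its own cell, and
    may land in the collar of a smaller cell. Only its iterates matter, and r is invariant under
    them. *)
Definition collapse x : X :=
  let: existT a v := cell_code K x in if nrm v <= 2^-1 then x else chi a (push_out v).

Lemma collapse_chi a (v : 'rV[R]_(dim a)) : nrm v < 1 ->
  collapse (chi a v) = if nrm v <= 2^-1 then chi a v else chi a (push_out v).
Proof. by move=> v1; rewrite /collapse cell_code_chi. Qed.

Lemma celldim_collapse x : collapse x = x \/ (celldim K (collapse x) < celldim K x)%N.
Proof.
have [a [v [v1 -> _]]] := cell_codeP K x; rewrite collapse_chi//.
case: leP => [_|/ltW v2]; [by left|right].
by rewrite (celldim_chi v1); apply: celldim_sphere; rewrite nrm_push_out.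
Qed.

Lemma collar_map_collapse x : r (collapse x) = r x.
Proof.
have [a [v [v1 -> _]]] := cell_codeP K x; rewrite collapse_chi//.
by case: leP => // /ltW v2; exact: collar_map_push_out.
Qed.

Lemma celldim_iter_collapse k x :
  iter k collapse x = x \/ (celldim K (iter k collapse x) < celldim K x)%N.
Proof.
elim: k => [|k IHk]; first by left.
rewrite iterS; case: (celldim_collapse (iter k collapse x)) => [->//|lt1].
right; case: IHk => [e|]; last exact: ltn_trans.
by move: lt1; rewrite {2}e.
Qed.

Lemma collar_map_iter_collapse k x : r (iter k collapse x) = r x.
Proof. by elim: k => //= k <-; rewrite collar_map_collapse. Qed.

(** The part of the open cell a over O, thickened through the collars of all the higher cells around
    it. *)
Definition star a (O : set 'rV[R]_(dim a)) : set X :=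
  [set x | exists k, exists2 u, O u & iter k collapse x = chi a u].

Definition open_ball a : set 'rV[R]_(dim a) := [set u | nrm u < 1].
Arguments open_ball : clear implicits.

(** A point of the open cell b is in the star either already in this cell or after its first
    collapse to the boundary. This recursion on the dimension drives [star_open]. *)
Lemma star_chi a b (O : set 'rV[R]_(dim a)) (v : 'rV[R]_(dim b)) :
  star O (chi b v) <-> (nrm v < 1 /\ exists2 u, O u & chi b v = chi a u) \/
    (2^-1 < nrm v /\ star O (chi b (push_out v))).
Proof.
case: (ltP (nrm v) 1) => v1; last first.
  rewrite chi_push_out//; split => [sv|[[]//|[]//]].
  by right; split => //; apply: lt_le_trans v1; rewrite invf_lt1 ?ltr1n.
split=> [[k [u Ou ku]]|].
  case: (leP (nrm v) 2^-1) => v2.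
    left; split => //; exists u => //; rewrite -ku.
    elim: {ku} k => //= k <-; by rewrite collapse_chi// v2.
  case: k ku => [ku|k]; first by left; split => //; exists u.
  rewrite iterSr collapse_chi// leNgt v2 /= => ku; right; split => //.
  by exists k; exists u.
move=> [[_ [u Ou vu]]|[v2 [k [u Ou ku]]]]; first by exists 0%N; exists u.
by exists k.+1; exists u; rewrite // iterSr collapse_chi// leNgt v2.
Qed.

Lemma star_open a (O : set 'rV[R]_(dim a)) : open O -> O `<=` open_ball a ->
  open (star O).
Proof.
move=> oO O1; apply: (cw_open_ind (K := K)) => b cQ.
pose B : set 'rV[R]_(dim b) := [set v | nrm v < 1 /\ exists2 u, O u & chi b v = chi a u].
have oB : open B.
  case: (pselect (b = a)) => [e|ba].
    subst b; rewrite (_ : B = O) //; apply/seteqP; split => v.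
      by move=> [v1 [u Ou /chi_inj ->]]//; exact: O1.
    by move=> Ov; split; [exact: O1|exists v].
  rewrite (_ : B = set0); first exact: open0.
  apply/seteqP; split => v //= [v1 [u Ou /chi_cell vu]].
  by apply: ba; apply: vu => //; exact: O1.
(* Only the trace of the complement of the star on the skeleton is known to be closed. The
   complement of this trace is open in X and agrees with the star on the skeleton, where [push_out]
   sends the collar. *)
rewrite (_ : _ @^-1` _ = B `|` ([set v | 2^-1 < nrm v] `&`
    ((fun v => chi b (push_out v)) @^-1` ~` (~` star O `&` skel K (dim b))))).
  apply: openU => //; apply: openI.
    by apply: open_ltR; [exact: cont_cst|exact: nrm_continuous].
  apply: open_preimage; last by rewrite openC.
  exact: (cont_comp (@push_out_continuous _ _) (chi_continuous (K := K) b)).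
have sk v : 2^-1 < nrm v -> skel K (dim b) (chi b (push_out v)).
  by move=> /ltW v2; apply: celldim_sphere; rewrite nrm_push_out.
apply/seteqP; split => v /=.
  move=> /star_chi[vB|[v2 vQ]]; [by left|right]; split => //.
  by move=> [].
move=> [vB|[v2 vQ]]; apply/star_chi; [by left|right]; split => //.
by apply: contrapT => nQ; apply: vQ; split => //; exact: sk.
Qed.

(** A further collapse either fixes a point or lowers its dimension, so the orbit of x meets the
    open cell a at most once. *)
Lemma star_coord_unique a (u v : 'rV[R]_(dim a)) k l x : nrm u < 1 -> nrm v < 1 ->
  iter k collapse x = chi a u -> iter l collapse x = chi a v -> u = v.
Proof.
wlog kl : k l u v / (k <= l)%N.
  move=> H u1 v1 ku lv; case: (leqP k l) => [|/ltnW] kl; first exact: (H k l).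
  by apply/esym; apply: (H l k).
move=> u1 v1 ku; rewrite -(subnK kl) iterD ku => lv; apply: chi_inj => //.
have := celldim_iter_collapse (l - k) (chi a u); rewrite lv => -[//|].
by rewrite !celldim_chi// ltnn.
Qed.

(** The retraction of the star onto the open cell, read in coordinates; the default 0 is taken off
    the star. *)
Definition star_coord a x : 'rV[R]_(dim a) :=
  xget 0 [set u | nrm u < 1 /\ exists k, iter k collapse x = chi a u].

Local Notation full_star a := (star (open_ball a)).

Lemma star_coordP a x : full_star a x ->
  nrm (star_coord a x) < 1 /\ exists k, iter k collapse x = chi a (star_coord a x).
Proof.
move=> [k [u u1 ku]]; rewrite /star_coord.
by case: xgetP => [v -> [v1 vk]//|/(_ u)[]]; split => //; exists k.
Qed.

Lemma star_coord_in a (O : set 'rV[R]_(dim a)) x : O `<=` open_ball a ->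
  star O x -> O (star_coord a x).
Proof.
move=> O1 [k [u Ou ku]].
have [v1 [l lv]] : nrm (star_coord a x) < 1 /\
    exists k, iter k collapse x = chi a (star_coord a x).
  by apply: star_coordP; exists k; exists u => //; exact: O1.
by rewrite -(star_coord_unique _ _ ku lv)//; exact: O1.
Qed.

Lemma open_ball_open a : open (open_ball a).
Proof. by apply: open_ltR; [exact: nrm_continuous|exact: cont_cst]. Qed.

Lemma full_star_open a : open (full_star a).
Proof. by apply: star_open => //; exact: open_ball_open. Qed.

(** Points of [star O] have their coordinates in O, and [star O] is open for every open O inside the
    ball. *)
Lemma star_coord_continuous a : {within full_star a, continuous (star_coord a)}.
Proof.
apply/subspace_continuousP => x sx A nA; have := nA; rewrite nbhsE => -[O [oO Ox] OA].
rewrite nbhs_simpl /= /within /=.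
have [x1 [k kx]] := star_coordP sx.
have : nbhs x (star (O `&` open_ball a)).
  apply: open_nbhs_nbhs; split.
    by apply: star_open => [|u []//]; apply: openI => //; exact: open_ball_open.
  by exists k; exists (star_coord a x).
apply: filterS => y /star_coord_in sy _; apply: OA.
by have [] := sy (@subIsetr _ _ _).
Qed.

Lemma collar_map_star a x : full_star a x -> r (chi a (star_coord a x)) = r x.
Proof. by move=> /star_coordP[_ [k <-]]; exact: collar_map_iter_collapse. Qed.

Lemma full_star_chi a (u : 'rV[R]_(dim a)) : nrm u < 1 -> full_star a (chi a u).
Proof. by move=> u1; exists 0%N; exists u. Qed.

Lemma star_coord_chi a (u : 'rV[R]_(dim a)) : nrm u < 1 ->
  star_coord a (chi a u) = u.
Proof.
move=> u1; have [v1 [k kv]] := star_coordP (full_star_chi u1).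
by apply/esym; apply: (@star_coord_unique a _ _ 0%N k (chi a u)).
Qed.

(** * Conjugation of classes by the tracks of the collar homotopy *)

Definition hcls x : Pi R X := Pi_class (h x).

Lemma src_hcls x : src (hcls x) = x.
Proof. by rewrite src_class collar_homotopy0. Qed.

Lemma tgt_hcls x : tgt (hcls x) = r x.
Proof. by rewrite tgt_class. Qed.

(** For the class of p this is the class of its image under r ([collar_conj_class]); written with
    the tracks, it can be undone by [collar_conjK]. *)
Definition collar_conj (c : Pi R X) : Pi R X :=
  Pi_mul (Pi_inv (hcls (src c))) (Pi_mul c (hcls (tgt c))).

Lemma src_collar_conj c : src (collar_conj c) = r (src c).
Proof.
by rewrite /collar_conj; Pi_ends; rewrite ?src_hcls ?tgt_hcls//; Pi_ends; rewrite src_hcls.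
Qed.

Lemma tgt_collar_conj c : tgt (collar_conj c) = r (tgt c).
Proof.
by rewrite /collar_conj; Pi_ends; rewrite ?src_hcls ?tgt_hcls//; Pi_ends; rewrite src_hcls.
Qed.

Lemma collar_conjK c :
  Pi_mul (hcls (src c)) (Pi_mul (collar_conj c) (Pi_inv (hcls (tgt c)))) = c.
Proof.
rewrite /collar_conj !Pi_mulA; Pi_ends; rewrite ?src_hcls ?tgt_hcls//; Pi_ends;
  rewrite ?src_hcls//.
by rewrite Pi_mulVK ?Pi_mulcV ?Pi_mulc1; Pi_ends; rewrite ?src_hcls.
Qed.

Lemma collar_conj_Pi_mul c d : tgt c = src d ->
  collar_conj (Pi_mul c d) = Pi_mul (collar_conj c) (collar_conj d).
Proof.
move=> cd; rewrite /collar_conj src_Pi_mul// tgt_Pi_mul//.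
rewrite !Pi_mulA; Pi_ends; rewrite ?src_hcls ?tgt_hcls//; Pi_ends;
  rewrite ?src_hcls ?tgt_hcls ?cd//.
by rewrite Pi_mulVK; Pi_ends; rewrite ?src_hcls.
Qed.

(* The two ways around the square [h (p s) t]. *)
Lemma collar_conj_class (p : pathspace R X) (V : normedModType R) (F : V -> X)
    (al : I01 R -> V) :
  continuous F -> continuous al -> (forall t, r (p t) = F (al t)) ->
  collar_conj (Pi_class p) = lcl F (al (zero01 R)) (al (one01 R)).
Proof.
move=> cF cal pF.
pose H (z : R * R) := h (p (clamp01 z.1)) (clamp01 z.2).
have cc : continuous (@clamp01 R) by exact: clamp01_continuous.
have cH : continuous H.
  apply: (@cont_comp _ _ _ (fun z : R * R => (h (p (clamp01 z.1)), clamp01 z.2))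
    (fun z => z.1 z.2)); last exact: eval_path_continuous.
  apply: cont_pair; last exact: (cont_comp (@cont_snd R R) cc).
  apply: cont_comp collar_homotopy_continuous.
  apply: cont_comp (path_continuous p).
  exact: (cont_comp (@cont_fst R R) cc).
have cv := @val01_continuous R.
have hE x t : h x t = h x (clamp01 (\val t)) by rewrite clamp01K.
have pE : Pi_class p = lcl H (0, 0) (1, 0).
  rewrite (@lcl_path _ _ _ _ cH (fun t => (\val t, 0))) ?zero01E ?one01E//.
    by apply: cont_pair => //; exact: cont_cst.
  by move=> t; rewrite /H /= clamp01K clamp01_0 collar_homotopy0.
have h0E : hcls (src (Pi_class p)) = lcl H (0, 0) (0, 1).
  rewrite /hcls (@lcl_path _ _ _ _ cH (fun t => (0, \val t))) ?zero01E ?one01E//.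
    by apply: cont_pair => //; exact: cont_cst.
  by move=> t; rewrite /H /= clamp01K clamp01_0 src_class.
have h1E : hcls (tgt (Pi_class p)) = lcl H (1, 0) (1, 1).
  rewrite /hcls (@lcl_path _ _ _ _ cH (fun t => (1, \val t))) ?zero01E ?one01E//.
    by apply: cont_pair => //; exact: cont_cst.
  by move=> t; rewrite /H /= clamp01K clamp01_1 tgt_class.
rewrite /collar_conj h0E h1E pE Pi_inv_lcl// !Pi_mul_lcl//.
have crp : continuous (fun t => r (p t)).
  exact: (cont_comp (path_continuous p) collar_map_continuous).
have <- : Pi_class (to_path (fun t => r (p t))) = lcl H (0, 1) (1, 1).
  rewrite (@lcl_path _ _ _ _ cH (fun t => (\val t, 1))) ?zero01E ?one01E//.
    by apply: cont_pair => //; exact: cont_cst.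
  by move=> t; rewrite to_pathE// /H /= clamp01K clamp01_1.
by rewrite (@lcl_path _ _ _ _ cF al)// => t; rewrite to_pathE.
Qed.

Local Notation rchi a := (fun v : 'rV[R]_(dim a) => r (chi a v)).

Lemma rchi_continuous a : continuous (rchi a).
Proof. exact: (cont_comp (chi_continuous (K := K) a) collar_map_continuous). Qed.

(** On the star r factors through the coordinates, so the image of p under r comes from a path of a
    vector space and its class depends on the ends only. *)
Lemma collar_conj_star a (p : pathspace R X) : range p `<=` full_star a ->
  collar_conj (Pi_class p) =
  lcl (rchi a) (star_coord a (p (zero01 R))) (star_coord a (p (one01 R))).
Proof.
move=> pa; rewrite (@collar_conj_class p _ (rchi a) (fun t => star_coord a (p t)))//.
- exact: rchi_continuous.
- apply: (@within_setT _ _ setT) => //.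
  apply: (@within_comp _ _ _ setT (full_star a)).
  + by apply: continuous_subspaceT; exact: path_continuous.
  + exact: star_coord_continuous.
  + by move=> t _; apply: pa; exists t.
- by move=> t; rewrite collar_map_star//; apply: pa; exists t.
Qed.

(** The image of the loop under r is trivial, and conjugation by the tracks brings this back to the
    loop itself. Triviality in X, not in the star, is what niceness asks for. *)
Lemma star_loop a (p : pathspace R X) : range p `<=` full_star a ->
  p (zero01 R) = p (one01 R) -> Pi_class p = Pi_one (p (zero01 R)).
Proof.
move=> pa p01; rewrite -[LHS]collar_conjK (collar_conj_star pa) -p01.
rewrite lcl_refl; last exact: rchi_continuous.
rewrite src_class tgt_class -p01 Pi_mul1c; Pi_ends; rewrite ?tgt_hcls ?collar_map_star//.
  by rewrite Pi_mulcV src_hcls.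
by apply: pa; exists (zero01 R).
Qed.

Lemma path_component_path (W : set X) x (p : pathspace R X) t :
  range p `<=` W -> path_component R W x (p (zero01 R)) -> path_component R W x (p t).
Proof.
move=> pW xp; apply: path_component_trans xp _.
have cq : continuous (fun s : I01 R => p (clamp01 (\val s * \val t))).
  apply: cont_comp (path_continuous p); apply: clamp01_comp_continuous.
  by apply: contM; [exact: val01_continuous|exact: cont_cst].
exists (to_path (fun s => p (clamp01 (\val s * \val t)))); split.
- by move=> _ [s _ <-]; rewrite to_pathE//; apply: pW; eexists.
- by rewrite to_pathE// zero01E mul0r clamp01_0.
- by rewrite to_pathE// one01E mul1r clamp01K.
Qed.

(** * Nice sets inside stars and the topology of Pi(X) *)

Lemma component_nice a (W : set X) x : open W -> W `<=` full_star a -> W x ->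
  nice R (path_component R W x).
Proof.
move=> oW Wa Wx; split.
- exact: (path_component_open K).
- move=> [y y'] [z z'].
  have xy : path_component R W x y := set_mem y'.
  have xz : path_component R W x z := set_mem z'.
  have [p [pW p0 p1]] := path_component_trans (path_component_sym xy) xz.
  have pU t : path_component R W x (p t).
    by apply: path_component_path => //; rewrite p0.
  pose q t : set_type (path_component R W x) := exist _ (p t) (mem_set (pU t)).
  have cq : continuous q.
    by apply: continuous_comp_initial; exact: path_continuous.
  by exists (mkcts cq); split; apply: val_inj.
- move=> y _ [f fy ->]; rewrite hclass_mapE.
  pose p : pathspace R X := @inclusion X (path_component R W x) \o f.
  have p0 : p (zero01 R) = inclusion y by rewrite /p /= fy//; left.
  have p1 : p (one01 R) = inclusion y by rewrite /p /= fy//; right.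
  rewrite -p0; apply: (@star_loop a p); last by rewrite p0.
  move=> _ [t _ <-]; exact/Wa/(path_component_sub (set_mem (valP (f t)))).
Qed.

Lemma nice_basis x (A : set X) a : nbhs x A -> full_star a x ->
  exists U : set X, [/\ nice R U, U x, U `<=` A & U `<=` full_star a].
Proof.
rewrite nbhsE => -[O [oO Ox] OA] xa.
have UO : path_component R (O `&` full_star a) x `<=` O `&` full_star a.
  exact: path_component_sub.
exists (path_component R (O `&` full_star a) x); split.
- apply: (@component_nice a) => //.
  by apply: openI => //; exact: full_star_open.
- exact: path_component_refl.
- by move=> y /UO[/OA].
- by move=> y /UO[].
Qed.

Lemma cell_star x : exists a, full_star a x.
Proof. by have [a [v [v1 -> _]]] := cell_codeP K x; exists a; exact: full_star_chi. Qed.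

Lemma Pi_basic_ends (U V : set X) (p : pathspace R X) c :
  Pi_basic U V p c -> U (src c) /\ V (tgt c).
Proof.
move=> [d1 [d2 [d1U d1p d2V d2p ->]]].
rewrite src_class tgt_class !path_cat0 ?path_cat1//.
by split; [apply: d1U|apply: d2V]; eexists.
Qed.

Lemma Pi_nbhs (c : Pi R X) (A B : set X) a b : nbhs (src c) A -> nbhs (tgt c) B ->
  full_star a (src c) -> full_star b (tgt c) ->
  exists U V : set X, [/\ U `<=` A `&` full_star a, V `<=` B `&` full_star b &
    nbhs c (Pi_basic U V (repr c))].
Proof.
move=> cA cB ca cb.
have [U [nU Uc UA Ua]] := nice_basis cA ca.
have [V [nV Vc VB Vb]] := nice_basis cB cb.
exists U, V; split => [x Ux|x Vx|].
- by split; [exact: UA|exact: Ua].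
- by split; [exact: VB|exact: Vb].
apply: open_nbhs_nbhs; split; last by rewrite -{2}[c]Pi_reprK; exact: Pi_basic_refl.
by apply: Pi_basics_open; exists U, V, (repr c).
Qed.

Lemma src_continuous : continuous (@src R X).
Proof.
move=> c A cA; have [a ca] := cell_star (src c); have [b cb] := cell_star (tgt c).
have [U [V [UA _]]] := Pi_nbhs cA filterT ca cb.
by apply: filterS => d dU; have [/UA[]] := Pi_basic_ends dU.
Qed.

Lemma tgt_continuous : continuous (@tgt R X).
Proof.
move=> c A cA; have [a ca] := cell_star (src c); have [b cb] := cell_star (tgt c).
have [U [V [_ VA]]] := Pi_nbhs filterT cA ca cb.
by apply: filterS => d dU; have [_ /VA[]] := Pi_basic_ends dU.
Qed.

(** The two paths added to c lie in stars, where [collar_conj_star] evaluates them. Near c, a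
    conjugated class is therefore a function of the coordinates of its ends. *)
Lemma collar_conj_Pi_basic a b (U V : set X) (c d : Pi R X) :
  U `<=` full_star a -> V `<=` full_star b -> Pi_basic U V (repr c) d ->
  collar_conj d = Pi_mul (Pi_mul
    (lcl (rchi a) (star_coord a (src d)) (star_coord a (src c))) (collar_conj c))
    (lcl (rchi b) (star_coord b (tgt c)) (star_coord b (tgt d))).
Proof.
move=> Ua Vb [d1 [d2 [d1U d1p d2V d2p dE]]].
have e1 : tgt (Pi_class d1) = src c by rewrite tgt_class.
have e2 : tgt c = src (Pi_class d2) by rewrite src_class.
have {dE}-> : d = Pi_mul (Pi_mul (Pi_class d1) c) (Pi_class d2).
  rewrite dE -[c in RHS]Pi_reprK Pi_mul_class// Pi_mul_class//.
  by rewrite path_cat1// -d2p.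
rewrite collar_conj_Pi_mul; last by rewrite tgt_Pi_mul.
rewrite collar_conj_Pi_mul//.
rewrite (@collar_conj_star a d1); last exact: subset_trans d1U Ua.
rewrite (@collar_conj_star b d2); last exact: subset_trans d2V Vb.
rewrite -!src_class -!tgt_class e1 -e2.
have e3 : tgt (Pi_mul (Pi_class d1) c) = src (Pi_class d2) by rewrite tgt_Pi_mul.
by rewrite (src_Pi_mul e3) (tgt_Pi_mul e3) src_Pi_mul.
Qed.

End collars.

(** * Extension of maps and of families of paths *)

Section sphere_extension.
Context {R : realType} {X : topologicalType}.

(** Only radial scaling matters for the filling below, and this notion covers products of Euclidean
    balls and cylinders over them. *)
Definition gauge (V : normedModType R) (q : V -> R) : Prop :=
  [/\ continuous q, forall v, v != 0 -> 0 < q v &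
      forall c v, q (c *: v) = `|c| * q v].

Lemma gauge0 (V : normedModType R) (q : V -> R) : gauge q -> q 0 = 0.
Proof. by move=> [_ _ qZ]; rewrite -(scale0r 0) qZ normr0 mul0r. Qed.

Lemma gaugeZ (V : normedModType R) (q : V -> R) c v : gauge q -> 0 <= c ->
  q (c *: v) = c * q v.
Proof. by move=> [_ _ qZ] c0; rewrite qZ ger0_norm. Qed.

Lemma gauge_ge0 (V : normedModType R) (q : V -> R) v : gauge q -> 0 <= q v.
Proof.
move=> gq; have [->|v0] := eqVneq v 0; first by rewrite gauge0.
by have [_ q0 _] := gq; exact/ltW/q0.
Qed.

Lemma to_cubeK n (y : 'rV[R]_n) : `|y| <= 1 -> of_cube (to_cube y) = y.
Proof.
move=> y1; apply/rowP => i; rewrite !mxE.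
have := le_trans (coord_le_norm y i) y1; rewrite ler_norml => yi.
by rewrite val_clamp01; lra.
Qed.

Section wrapping.
Variables (k : nat).
Local Notation V := 'rV[R]_k.

(* Maps the cube [|y| <= 1] onto the sphere [|v| + |d| = 1/2] of [V * R],
   collapsing the boundary of the cube to the south pole. *)
Definition wrap (y : V) : (V * R)%type :=
  (Num.min 1 ((1 - `|y|) / Num.max `|y| 2^-1) *: y, 2^-1 - `|y|).

Arguments wrap : simpl never.

Lemma wrap_continuous : continuous wrap.
Proof.
have cn := @cont_norm R 'rV[R]_k.
apply: cont_pair; last by apply: contB => //; exact: cont_cst.
apply: contZ; last exact: cont_id.
apply: cont_min; first exact: cont_cst.
apply: contM; first by apply: contB => //; exact: cont_cst.
apply: contV => [v|]; first by rewrite gt_eqF// lt_max invr_gt0 ltr0n orbT.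
by apply: cont_max => //; exact: cont_cst.
Qed.

Lemma wrap_low (y : V) : `|y| <= 2^-1 -> wrap y = (y, 2^-1 - `|y|).
Proof.
move=> y2; rewrite /wrap min_l ?scale1r// max_r// invrK.
by have := normr_ge0 y; lra.
Qed.

Lemma wrap_high (y : V) : 2^-1 <= `|y| -> `|y| <= 1 ->
  wrap y = (((1 - `|y|) / `|y|) *: y, 2^-1 - `|y|).
Proof.
move=> y2 y1; rewrite /wrap [Num.max _ _]max_l// min_r//.
have y0 : 0 < `|y| by apply: lt_le_trans y2; rewrite invr_gt0.
by rewrite ler_pdivrMr// mul1r; lra.
Qed.

Lemma wrap_norm (y : V) : `|y| <= 1 -> `|(wrap y).1| + `|(wrap y).2| = 2^-1.
Proof.
move=> y1; case: (leP `|y| 2^-1) => [y2|/ltW y2].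
  by rewrite wrap_low//= [X in _ + X]ger0_norm ?subr_ge0// addrC subrK.
have y0 : 0 < `|y| by apply: lt_le_trans y2; rewrite invr_gt0.
rewrite wrap_high//= normrZ ger0_norm ?divr_ge0 ?subr_ge0// ?ltW//.
by rewrite divfK ?gt_eqF// ler0_norm ?subr_le0//; lra.
Qed.

Lemma wrap_neq0 (y : V) : `|y| <= 1 -> wrap y != 0.
Proof.
move=> /wrap_norm wy; apply/eqP => w0; move: wy; rewrite w0 /= !normr0 addr0.
by move/eqP; rewrite eq_sym gt_eqF// invr_gt0.
Qed.

Lemma wrap_pole (y : V) : `|y| = 1 -> wrap y = (0, - 2^-1).
Proof.
move=> y1; rewrite wrap_high ?y1 ?invf_le1 ?ler1n// subrr mul0r scale0r.
by congr pair; lra.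
Qed.

Lemma sum_normZ (l : R) (z : V * R) : 0 <= l ->
  `|(l *: z).1| + `|(l *: z).2| = l * (`|z.1| + `|z.2|).
Proof. by case: z => v d l0; rewrite /= !normrZ ger0_norm// mulrDr. Qed.

(** The positive factor l is there because [theta] below rescales [wrap] to the unit sphere of a
    gauge. Only boundary points of the cube are identified. *)
Lemma wrap_inj (y y' : V) (l : R) : `|y| <= 1 -> `|y'| <= 1 -> 0 < l ->
  wrap y = l *: wrap y' -> y = y' \/ (`|y| = 1 /\ `|y'| = 1).
Proof.
move=> y1 y'1 l0 yy'.
have l1 : l = 1.
  have := wrap_norm y1; rewrite yy' sum_normZ ?ltW// wrap_norm//.
  have h0 : 2^-1 != 0 :> R by rewrite invr_eq0 pnatr_eq0.
  by rewrite -[RHS]mul1r; exact: mulIf.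
move: yy'; rewrite l1 scale1r => yy'.
have ny : `|y| = `|y'|.
  by have := congr1 snd yy'; rewrite /wrap /= => /addrI/oppr_inj.
move: y1 {y'1}; rewrite le_eqVlt => /orP[/eqP y1|y1]; first by right; rewrite -ny.
left; have := congr1 fst yy'; rewrite /wrap /= -ny; apply: scalerI.
rewrite gt_eqF// lt_min ltr01 divr_gt0 ?subr_gt0//.
by rewrite lt_max invr_gt0 ltr0n orbT.
Qed.

Lemma wrap_surj (z : V * R) : (0 < k)%N -> `|z.1| + `|z.2| = 2^-1 ->
  exists2 y, `|y| <= 1 & wrap y = z.
Proof.
case: z => v d k0 /= vd.
case: (leP 0 d) => d0.
  move: vd; rewrite (ger0_norm d0) => vd.
  have v0 := normr_ge0 v.
  exists v; first lra.
  by rewrite wrap_low; [congr pair; lra|lra].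
move: vd; rewrite (ltr0_norm d0) => vd.
have [v0|v0] := eqVneq v 0.
  move: vd; rewrite v0 normr0 => vd.
  exists (const_mx 1); last first.
    rewrite wrap_pole; first by congr pair; lra.
    apply/eqP; rewrite eq_le; apply/andP; split.
      by apply: norm_le_coord => // i; rewrite mxE normr1.
    by apply: le_trans (coord_le_norm _ (Ordinal k0)); rewrite mxE normr1.
  by apply: norm_le_coord => // i; rewrite mxE normr1.
have v1 : 0 < `|v| by rewrite normr_gt0.
have ny : `|((1 - `|v|) / `|v|) *: v| = 1 - `|v|.
  rewrite normrZ ger0_norm ?divfK ?gt_eqF// divr_ge0//; lra.
exists (((1 - `|v|) / `|v|) *: v); first by rewrite ny; lra.
rewrite wrap_high ny; [|lra|lra].
congr pair; last lra.
rewrite scalerA opprB addrC subrK.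
have nv : 1 - `|v| != 0 by rewrite gt_eqF//; lra.
by rewrite mulrA divfK// divff ?scale1r// gt_eqF.
Qed.

End wrapping.

(** The spheroid is f on the unit sphere of q, parametrized by the cube through [theta]. A
    null-homotopy of it descends along (y, s) -> (1 - s) theta y to the ball, by compactness
    ([compact_factor]). *)
Lemma sphere_extension k (q : 'rV[R]_k * R -> R) (f : 'rV[R]_k * R -> X) :
  (0 < k)%N -> gauge q ->
  {within [set z | 1 <= q z], continuous f} ->
  (forall (phi : continuousType (cube R k) X) (x : X),
    (forall t, cube_boundary R k t -> phi t = x) ->
    homotopic R (cube_boundary R k) phi (cst x)) ->
  exists2 F : 'rV[R]_k * R -> X, continuous F & forall z, 1 <= q z -> F z = f z.
Proof.
move=> k0 gq cf null; have [cq q_gt0 _] := gq; have qZ c v := @gaugeZ _ q c v gq.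
pose theta (y : 'rV[R]_k) := (q (wrap y))^-1 *: wrap y.
have qw y : `|y| <= 1 -> 0 < q (wrap y) by move=> y1; apply: q_gt0; exact: wrap_neq0.
have qth y : `|y| <= 1 -> q (theta y) = 1.
  by move=> y1; rewrite qZ ?invr_ge0 ?ltW ?qw// mulVf// gt_eqF// qw.
have qcth (c : R) y : 0 <= c -> `|y| <= 1 -> q (c *: theta y) = c.
  by move=> c0 y1; rewrite qZ// qth// mulr1.
have cth : {within [set y : 'rV[R]_k | `|y| <= 1], continuous theta}.
  apply/subspace_continuousP => y /= y1; apply: cvg_within_filter.
  apply: cvgZ; last exact: wrap_continuous.
  apply: cvgV; first by rewrite gt_eqF// qw.
  by apply: continuous_comp; [exact: wrap_continuous|exact: cq].
have cphi : continuous (fun t : cube R k => f (theta (of_cube t))).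
  apply: (@within_setT _ _ setT) => //.
  apply: (@within_comp _ _ _ setT [set y : 'rV[R]_k | `|y| <= 1] _ (fun y => f (theta y))).
  - by apply: continuous_subspaceT; exact: of_cube_continuous.
  - by apply: (within_comp cth cf) => y y1 /=; rewrite qth.
  - by move=> t _; exact: of_cube_le1.
pose pole : 'rV[R]_k * R := (q (0, - 2^-1))^-1 *: (0, - 2^-1).
have thpole y : `|y| = 1 -> theta y = pole by move=> y1; rewrite /theta wrap_pole.
pose phi : continuousType (cube R k) X := mkcts cphi.
have phiE t : phi t = f (theta (of_cube t)) by [].
have [|H [cH H0 H1 HB]] := null phi (f pole).
  by move=> t te; rewrite phiE thpole// of_cube_boundary.
pose A := [set y : 'rV[R]_k | `|y| <= 1] `*` `[0 : R, 1]%classic.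
have cA : compact A.
  apply: compact_setX; last exact: segment_compact.
  apply: bounded_closed_compact; last by apply: closed_leR; [exact: cont_norm|exact: cont_cst].
  exists 1; split; first exact: num_real.
  by move=> M M1 y /= /le_trans; apply; exact: ltW.
have A01 y s : A (y, s) -> `|y| <= 1 /\ 0 <= s <= 1.
  by move=> [/= y1]; rewrite in_itv.
have hT : hausdorff_space ('rV[R]_k * R)%type by exact: norm_hausdorff.
have [] := @compact_factor _ _ X A (fun z => (1 - z.2) *: theta z.1)
    (fun z => H (to_cube z.1, clamp01 z.2)) cA hT.
- apply: (@within_cont_comp _ _ _ A (fun z : 'rV[R]_k * R => (1 - z.2, theta z.1))
    (fun w : R * ('rV[R]_k * R) => w.1 *: w.2)).
    apply: within_pair.
      by apply: continuous_subspaceT; apply: contB; [exact: cont_cst|exact: cont_snd].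
    apply: cont_within_comp cth _; first exact: cont_fst.
    by move=> -[y s] /A01[].
  by apply: contZ; [exact: cont_fst|exact: cont_snd].
- apply: continuous_subspaceT.
  apply: (@cont_comp _ _ _ (fun z : 'rV[R]_k * R => (to_cube z.1, clamp01 z.2)) H) => //.
  apply: cont_pair.
    exact: (cont_comp (@cont_fst _ _) (@to_cube_continuous R k)).
  exact: (cont_comp (@cont_snd _ _) (@clamp01_continuous R)).
(* Equal images give equal values: q recovers 1 - s; at s = 1 the homotopy is constant; otherwise y
   and y' agree or both lie on the boundary of the cube, where H is constant. *)
- move=> [y s] [y' s'] /A01[y1 s1] /A01[y'1 s'1] /= e.
  have ss' : s = s'.
    have := congr1 q e; rewrite !qcth//; [lra| |]; clear e; lra.
  rewrite -ss' in e *; have [s_1|sn1] := eqVneq s 1; first by rewrite s_1 clamp01_1 !H1.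
  have {}e : theta y = theta y'.
    by apply: scalerI e; rewrite subr_eq0 eq_sym.
  have l0 : 0 < q (wrap y) / q (wrap y') by rewrite divr_gt0// qw.
  have le : wrap y = (q (wrap y) / q (wrap y')) *: wrap y'.
    by rewrite -scalerA -/(theta y') -e scalerA divff ?scale1r// gt_eqF// qw.
  have [->//|[ny ny']] := wrap_inj y1 y'1 l0 le.
  rewrite !HB; [|by apply: to_cube_boundary; rewrite ny'
    |by apply: to_cube_boundary; rewrite ny].
    by rewrite !phiE !thpole// of_cube_boundary//; apply: to_cube_boundary; rewrite ?ny ?ny'.
- exists (0, 1); split; rewrite /= ?normr0 ?ler01//.
  by rewrite in_itv /= ler01 lexx.
move=> F0 cF0 F0E.
(* The ray through z meets the sphere [|v| + |d| = 1/2], which is covered by [wrap]; this yields y,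
   and s is 1 - q z. *)
have img z : q z <= 1 -> exists y, [/\ `|y| <= 1, 0 <= 1 - q z <= 1 & z = q z *: theta y].
  move=> q1; have q0 := gauge_ge0 z gq.
  have [->|z0] := eqVneq z 0.
    by exists 0; rewrite (gauge0 gq) scale0r; split; rewrite ?normr0//; lra.
  pose N := `|z.1| + `|z.2|.
  have N0 : 0 < N.
    rewrite lt_neqAle addr_ge0// andbT eq_sym paddr_eq0// !normr_eq0.
    by apply: contra z0 => /andP[/eqP z1 /eqP z2]; rewrite [z]surjective_pairing z1 z2.
  have [|y y1 wy] := @wrap_surj k ((2^-1 / N) *: z) k0.
    rewrite sum_normZ; last by rewrite ltW// divr_gt0 ?invr_gt0.
    by rewrite -/N divfK// gt_eqF.
  exists y; split => //; first lra.
  have l0 : 0 < 2^-1 / N by rewrite divr_gt0 ?invr_gt0.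
  have qz0 := q_gt0 _ z0.
  rewrite /theta wy qZ ?ltW// !scalerA; set l := 2^-1 / N in l0 *.
  rewrite (_ : _ * _ = 1) ?scale1r//; field.
  by rewrite !gt_eqF.
exists (fun z => if q z <= 1 then F0 z else f z) => [|z].
  apply: glue_le => //; first exact: cont_cst.
    apply: continuous_subspaceW cF0 => z /= /img[y [y1 s1 zE]].
    exists (y, 1 - q z); last by rewrite /= opprB addrC subrK -zE.
    by split; rewrite //= in_itv.
  move=> z z1; have [|y [y1 s1 zE]] := img z; first by rewrite z1.
  rewrite z1 scale1r in zE.
  have yA : A (y, 0) by split; rewrite //= in_itv /= lexx ler01.
  have := F0E _ yA; rewrite /= subr0 scale1r -zE => ->.
  by rewrite clamp01_0 H0 phiE to_cubeK// -zE.
rewrite le_eqVlt => /orP[/eqP z1|z1]; last by rewrite leNgt z1.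
rewrite -z1 lexx; have [|y [y1 s1 zE]] := img z; first by rewrite -z1.
rewrite -z1 scale1r in zE.
have yA : A (y, 0) by split; rewrite //= in_itv /= lexx ler01.
have := F0E _ yA; rewrite /= subr0 scale1r -zE => ->.
by rewrite clamp01_0 H0 phiE to_cubeK// -zE.
Qed.
End sphere_extension.

(** * Filling families of paths *)

Section path_extension.
Context {R : realType} {X : topologicalType}.

Lemma path_cat_first (p q : pathspace R X) (x : R) : p (one01 R) = q (zero01 R) ->
  0 <= x <= 1 -> path_cat p q (clamp01 (x / 2)) = p (clamp01 x).
Proof.
move=> pq x01; rewrite path_catE// /path_cat_fun val_clamp01; last lra.
by rewrite ifT; [congr (p (clamp01 _)); lra|lra].
Qed.

Lemma path_cat_second (p q : pathspace R X) (x : R) : p (one01 R) = q (zero01 R) ->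
  0 <= x <= 1 -> path_cat p q (clamp01 ((1 + x) / 2)) = q (clamp01 x).
Proof.
move=> pq x01; rewrite path_catE// /path_cat_fun val_clamp01; last lra.
case: leP => x2; last by congr (q (clamp01 _)); lra.
have {x01 x2}-> : x = 0 by lra.
by rewrite addr0 mulrCA divff ?pnatr_eq0// mulr1 clamp01_1 clamp01_0.
Qed.

(* The square is swept out by the segments joining opposite points of the two
   paths from the corner (0, 0) to the corner (1, 1) of its boundary. *)
Lemma square_extension (b r l t : pathspace R X) :
  b (one01 R) = r (zero01 R) -> l (one01 R) = t (zero01 R) ->
  Pi_mul (Pi_class b) (Pi_class r) = Pi_mul (Pi_class l) (Pi_class t) ->
  exists2 F : R * R -> X,
    {within `[0 : R, 1]%classic `*` `[0 : R, 1]%classic, continuous F} &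
    forall x, 0 <= x <= 1 -> [/\ F (x, 0) = b (clamp01 x), F (1, x) = r (clamp01 x),
      F (0, x) = l (clamp01 x) & F (x, 1) = t (clamp01 x)].
Proof.
move=> br lt; rewrite !Pi_mul_class// => /hclP[M [cM M0 M1 ME]].
(* The point (lo t, hi t) runs along the bottom and then the right side, (hi t, lo t) along the left
   side and then the top; [Th] joins them by a segment. *)
pose lo (t : R) : R := Num.min (2 * t) 1.
pose hi (t : R) : R := Num.max (2 * t - 1) 0.
pose Th (z : R * R) := ((1 - z.2) * lo z.1 + z.2 * hi z.1, (1 - z.2) * hi z.1 + z.2 * lo z.1).
pose A := `[0 : R, 1]%classic `*` `[0 : R, 1]%classic.
have A01 x y : A (x, y) <-> (0 <= x <= 1) /\ (0 <= y <= 1).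
  by rewrite /A /= !in_itv.
have lohi x : 0 <= x <= 1 -> [/\ lo x + hi x = 2 * x, 0 <= hi x, hi x <= lo x, lo x <= 1 &
    hi x = lo x -> x = 0 \/ x = 1].
  move=> x01; rewrite /lo /hi; case: (leP x 2^-1) => x2.
    rewrite min_l ?max_r; [|lra|lra]; split; [lra..|].
    by move=> x0; left; lra.
  rewrite min_r ?max_l; [|lra|lra]; split; [lra..|].
  by move=> x0; right; lra.
have c2 (i : R * R -> R) : continuous i -> continuous (fun z => 2 * i z).
  by move=> ci; apply: contM => //; exact: cont_cst.
have clo : continuous (fun z : R * R => lo z.1).
  apply: cont_min; last exact: cont_cst.
  by apply: c2; exact: cont_fst.
have chi : continuous (fun z : R * R => hi z.1).
  apply: cont_max; last exact: cont_cst.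
  by apply: contB; [apply: c2; exact: cont_fst|exact: cont_cst].
have c1s : continuous (fun z : R * R => 1 - z.2).
  by apply: contB; [exact: cont_cst|exact: cont_snd].
have cs : continuous (fun z : R * R => z.2) by exact: cont_snd.
have cTh : continuous Th by apply: cont_pair; apply: contD; exact: contM.
have cA : compact A by apply: compact_setX; exact: segment_compact.
have hT : hausdorff_space (R * R)%type by exact: norm_hausdorff.
have [] := @compact_factor _ _ X A Th (fun z => M (clamp01 z.1, clamp01 z.2)) cA hT.
- exact: continuous_subspaceT.
- apply: continuous_subspaceT.
  apply: (@cont_comp _ _ _ (fun z : R * R => (clamp01 z.1, clamp01 z.2)) M) => //.
  apply: cont_pair.
    exact: (cont_comp (@cont_fst R R) (@clamp01_continuous R)).
  exact: (cont_comp (@cont_snd R R) (@clamp01_continuous R)).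
- move=> [x s] [x' s'] /A01[x1 s1] /A01[x'1 s'1] [e1 e2].
  have [xe _ _ _ xend] := lohi _ x1; have [x'e _ _ _ _] := lohi _ x'1.
  (* The coordinates of [Th (x, s)] have sum 2 x and difference (1 - 2 s)(lo x - hi x). *)
  have xx' : x = x' by nra.
  subst x'; cbn [fst snd].
  case: (eqVneq (hi x) (lo x)) => [/xend[]->|hl].
  + by rewrite clamp01_0 !ME//; left.
  + by rewrite clamp01_1 !ME//; right.
  + congr (M (_, clamp01 _)).
    have : (s - s') * (hi x - lo x) = 0 by lra.
    by move/eqP; rewrite mulf_eq0 !subr_eq0 (negbTE hl) orbF => /eqP.
- by exists (0, 0); apply/A01; split; rewrite lexx ler01.
move=> F cF FE.
have Aimg x y : 0 <= x <= 1 -> 0 <= y <= 1 -> exists2 z, A z & Th z = (x, y).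
  move=> x1 y1.
  have u1 : 0 <= (x + y) / 2 <= 1 by lra.
  have [ue h0 hl l1 uend] := lohi _ u1.
  set u := (x + y) / 2 in u1 ue h0 hl l1 uend.
  have uE : 2 * u = x + y by rewrite /u; lra.
  have xy : - (lo u - hi u) <= x - y <= lo u - hi u.
    move: ue h0 hl l1 uE; rewrite /lo /hi; case: (leP u 2^-1) => u2.
      by rewrite min_l ?max_r; [|lra|lra] => *; lra.
    by rewrite min_r ?max_l; [|lra|lra] => *; lra.
  case: (eqVneq (hi u) (lo u)) => hl'.
    exists (u, 0); first by apply/A01; split; rewrite ?lexx ?ler01.
    by rewrite /Th /= subr0 !mul1r !mul0r !addr0; congr pair; lra.
  have d0 : 0 < lo u - hi u by rewrite subr_gt0 lt_neqAle hl'.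
  (* This v is 1 - 2 s for the sought parameter s. *)
  pose v := (x - y) / (lo u - hi u).
  have vE : v * (lo u - hi u) = x - y by rewrite divfK// gt_eqF.
  have v1 : -1 <= v <= 1.
    by rewrite /v ler_pdivlMr// ler_pdivrMr// mulN1r mul1r.
  exists (u, (1 - v) / 2); first by apply/A01; split => //; lra.
  by rewrite /Th /=; congr pair; lra.
exists F.
  apply: continuous_subspaceW cF => -[x y] /A01[x1 y1].
  by have [z Az <-] := Aimg _ _ x1 y1; exists z.
move=> x x1.
have lo1 : lo (x / 2) = x by rewrite /lo min_l; lra.
have hi1 : hi (x / 2) = 0 by rewrite /hi max_r; lra.
have lo2 : lo ((1 + x) / 2) = 1 by rewrite /lo min_r; lra.
have hi2 : hi ((1 + x) / 2) = x by rewrite /hi max_l; lra.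
have A1 s : 0 <= s <= 1 -> A (x / 2, s) by move=> s1; apply/A01; split; lra.
have A2 s : 0 <= s <= 1 -> A ((1 + x) / 2, s) by move=> s1; apply/A01; split; lra.
have s0 : 0 <= (0 : R) <= 1 by rewrite lexx ler01.
have s1 : 0 <= (1 : R) <= 1 by rewrite lexx ler01.
split.
- have -> : (x, 0) = Th (x / 2, 0).
    by rewrite /Th /= lo1 hi1 subr0 !mul1r !mul0r !addr0.
  by rewrite (FE _ (A1 _ s0)) clamp01_0 M0 path_cat_first.
- have -> : (1, x) = Th ((1 + x) / 2, 0).
    by rewrite /Th /= lo2 hi2 subr0 !mul1r !mul0r !addr0.
  by rewrite (FE _ (A2 _ s0)) clamp01_0 M0 path_cat_second.
- have -> : (0, x) = Th (x / 2, 1).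
    by rewrite /Th /= lo1 hi1 subrr !mul1r !mul0r !add0r.
  by rewrite (FE _ (A1 _ s1)) clamp01_1 M1 path_cat_first.
- have -> : (x, 1) = Th ((1 + x) / 2, 1).
    by rewrite /Th /= lo2 hi2 subrr !mul1r !mul0r !add0r.
  by rewrite (FE _ (A2 _ s1)) clamp01_1 M1 path_cat_second.
Qed.

Definition null_spheroids (k : nat) : Prop :=
  forall (phi : continuousType (cube R k) X) (x : X),
    (forall t, cube_boundary R k t -> phi t = x) ->
    homotopic R (cube_boundary R k) phi (cst x).

Lemma two_halves : (1 + 1) / 2 = 1 :> R. Proof. lra. Qed.

Section path_families.
Variables (k : nat) (q : 'rV[R]_k -> R) (al be : 'rV[R]_k -> X)
  (ga : 'rV[R]_k -> pathspace R X).
Hypotheses (gq : gauge q) (cal : continuous al) (cbe : continuous be)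
  (cga : {within [set w | 1 <= q w], continuous ga})
  (ga0 : forall w, 1 <= q w -> ga w (zero01 R) = al w)
  (ga1 : forall w, 1 <= q w -> ga w (one01 R) = be w).

Definition cylinder_gauge (z : 'rV[R]_k * R) : R := Num.max (q z.1) `|z.2|.

Lemma cylinder_gaugeP : gauge cylinder_gauge.
Proof.
have [cq q0 qZ] := gq; split.
- apply: cont_max; first exact: (cont_comp (@cont_fst _ _) cq).
  exact: (cont_comp (@cont_snd _ _) (@cont_norm R R)).
- move=> [w s] ws; rewrite /cylinder_gauge lt_max /=.
  have [w0|w0] := eqVneq w 0; last by rewrite q0.
  rewrite normr_gt0; apply/orP; right; apply: contra ws => /eqP s0.
  by rewrite w0 s0.
- move=> c [w s]; rewrite /cylinder_gauge /= qZ normrZ.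
  by rewrite maxr_pMr.
Qed.

(** The prescribed paths on the side of the cylinder over [-1, 1], with the prescribed ends on its
    bottom and top. Where [q z.1 < 1] it is only meant for [|z.2| >= 1]. *)
Definition cylinder_map (z : 'rV[R]_k * R) : X :=
  if 1 <= q z.1 then ga z.1 (clamp01 ((z.2 + 1) / 2))
  else if z.2 <= 0 then al z.1 else be z.1.

Lemma cylinder_map_continuous :
  {within [set z | 1 <= cylinder_gauge z], continuous cylinder_map}.
Proof.
have [cq q0 qZ] := gq.
have cq1 : continuous (fun z : 'rV[R]_k * R => q z.1).
  exact: (cont_comp (@cont_fst _ _) cq).
have c2 : continuous (fun z : 'rV[R]_k * R => z.2) by exact: cont_snd.
have -> : [set z | 1 <= cylinder_gauge z] = [set z | 1 <= q z.1] `|`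
    ([set z | z.2 <= -1] `|` [set z | 1 <= z.2]).
  apply/seteqP; split => -[w s] /=; rewrite /cylinder_gauge le_max ler_normr /=.
    case/orP => [w1|/orP[s1|s1]]; [by left|by right; right|].
    by right; left; rewrite lerNr.
  by case=> [->//|[s1|->]]; rewrite ?orbT// lerNr s1 !orbT.
have c_1 (c : R) : continuous (fun _ : 'rV[R]_k * R => c) by exact: cont_cst.
apply: withinU_continuous; [exact: closed_leR| | |].
- by apply: closedU; exact: closed_leR.
- apply: (@within_eq _ _ _ (fun z : 'rV[R]_k * R => ga z.1 (clamp01 ((z.2 + 1) / 2)))).
    by move=> z /= z1; rewrite /cylinder_map z1.
  apply: within_uncurry.
    by apply: cont_within_comp cga _ => //; exact: cont_fst.
  apply: continuous_subspaceT; apply: clamp01_comp_continuous.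
  by apply: contM => //; exact: contD.
- apply: withinU_continuous; [exact: closed_leR|exact: closed_leR| |].
  + apply: (@within_eq _ _ _ (fun z : 'rV[R]_k * R => al z.1)).
      move=> z /= z1; rewrite /cylinder_map; case: leP => qz; last by rewrite ifT//; lra.
      by rewrite clamp01_le0 ?ga0//; lra.
    by apply: continuous_subspaceT; exact: (cont_comp (@cont_fst _ _) cal).
  + apply: (@within_eq _ _ _ (fun z : 'rV[R]_k * R => be z.1)).
      move=> z /= z1; rewrite /cylinder_map; case: leP => qz.
        by rewrite clamp01_ge1 ?ga1//; lra.
      by rewrite ifF//; apply/negbTE; rewrite -ltNge; lra.
    by apply: continuous_subspaceT; exact: (cont_comp (@cont_fst _ _) cbe).
Qed.

Lemma path_family_extension :
  (exists2 F : 'rV[R]_k * R -> X, continuous F &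
    forall z, 1 <= cylinder_gauge z -> F z = cylinder_map z) ->
  exists ga' : 'rV[R]_k -> pathspace R X, [/\ continuous ga',
    forall w, 1 <= q w -> ga' w = ga w,
    forall w, ga' w (zero01 R) = al w & forall w, ga' w (one01 R) = be w].
Proof.
move=> [F cF FE].
pose G (z : 'rV[R]_k * I01 R) := F (z.1, 2 * \val z.2 - 1).
have cG : continuous G.
  apply: (@cont_comp _ _ _ (fun z : 'rV[R]_k * I01 R => (z.1, 2 * \val z.2 - 1)) F) => //.
  apply: cont_pair; first exact: cont_fst.
  exact: (cont_comp (@cont_snd _ _) (@val01MB_continuous R 2 1)).
pose ga' w := to_path (fun t => G (w, t)).
have ga'E w t : ga' w t = G (w, t).
  rewrite to_pathE//; apply: (@cont_comp _ _ _ (fun t : I01 R => (w, t)) G) => //.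
  by apply: cont_pair; [exact: cont_cst|exact: cont_id].
exists ga'; split.
- apply: cont_curry.
  by rewrite (_ : (fun z => _) = G)//; apply/funext => -[w t]; rewrite ga'E.
- move=> w w1; apply/continuousEP => t; rewrite ga'E /G FE; last first.
    by rewrite /cylinder_gauge le_max w1.
  rewrite /cylinder_map /= w1 -[in RHS](clamp01K t); congr (ga w (clamp01 _)).
  by rewrite subrK mulrC mulrA mulVf ?mul1r// pnatr_eq0.
- move=> w; rewrite ga'E /G zero01E mulr0 sub0r FE; last first.
    by rewrite /cylinder_gauge le_max normrN normr1 lexx orbT.
  rewrite /cylinder_map /= addNr mul0r clamp01_0; case: leP => [/ga0//|_].
  by rewrite ifT// lerN10.
- move=> w; rewrite ga'E /G one01E mulr1 (_ : 2 - 1 = 1); last by rewrite -[2]/(1 + 1) addrK.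
  rewrite FE; last by rewrite /cylinder_gauge le_max normr1 lexx orbT.
  rewrite /cylinder_map /= two_halves clamp01_1; case: leP => [/ga1//|_].
  by rewrite ifF// lt_geF.
Qed.

End path_families.

Lemma path_extension_high k (q : 'rV[R]_k -> R) (al be : 'rV[R]_k -> X)
    (ga : 'rV[R]_k -> pathspace R X) :
  (0 < k)%N -> gauge q -> continuous al -> continuous be ->
  {within [set w | 1 <= q w], continuous ga} ->
  (forall w, 1 <= q w -> ga w (zero01 R) = al w) ->
  (forall w, 1 <= q w -> ga w (one01 R) = be w) ->
  null_spheroids k ->
  exists ga' : 'rV[R]_k -> pathspace R X, [/\ continuous ga',
    forall w, 1 <= q w -> ga' w = ga w,
    forall w, ga' w (zero01 R) = al w & forall w, ga' w (one01 R) = be w].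
Proof.
move=> k0 gq cal cbe cga ga0 ga1 null; apply: path_family_extension => //.
apply: sphere_extension => //; first exact: cylinder_gaugeP.
exact: cylinder_map_continuous.
Qed.

(** Here the cylinder is a square, and the condition on classes, taken at the two vectors w0 and w1
    of gauge 1, says that its boundary loop can be filled. *)
Lemma path_extension_line (q : 'rV[R]_1 -> R) (al be : 'rV[R]_1 -> X)
    (ga : 'rV[R]_1 -> pathspace R X) :
  gauge q -> continuous al -> continuous be ->
  {within [set w | 1 <= q w], continuous ga} ->
  (forall w, 1 <= q w -> ga w (zero01 R) = al w) ->
  (forall w, 1 <= q w -> ga w (one01 R) = be w) ->
  (forall w w', 1 <= q w -> 1 <= q w' ->
    Pi_mul (lcl al w w') (Pi_class (ga w')) = Pi_mul (Pi_class (ga w)) (lcl be w w')) ->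
  exists ga' : 'rV[R]_1 -> pathspace R X, [/\ continuous ga',
    forall w, 1 <= q w -> ga' w = ga w,
    forall w, ga' w (zero01 R) = al w & forall w, ga' w (one01 R) = be w].
Proof.
move=> gq cal cbe cga ga0 ga1 gacl; apply: path_family_extension => //.
have [cq q0 qZ] := gq.
pose e : 'rV[R]_1 := const_mx 1.
have wE (w : 'rV[R]_1) : w = w 0 0 *: e.
  by apply/rowP => i; rewrite !mxE mulr1 ord1.
have qe : 0 < q e.
  apply: q0; apply/eqP => /rowP/(_ 0); rewrite !mxE => /eqP.
  by rewrite oner_eq0.
have qw w : q w = `|w 0 0 * q e| by rewrite [w in LHS]wE qZ normrM (gtr0_norm qe).
pose w0 := - (q e)^-1 *: e; pose w1 := (q e)^-1 *: e.
have qw0 : q w0 = 1 by rewrite qZ normrN gtr0_norm ?invr_gt0// mulVf// gt_eqF.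
have qw1 : q w1 = 1 by rewrite qZ gtr0_norm ?invr_gt0// mulVf// gt_eqF.
have [|||F cF FE] := @square_extension (lpath al w0 w1) (ga w1) (ga w0) (lpath be w0 w1).
- by rewrite lpath1// ga0// qw1.
- by rewrite lpath0// ga1// qw0.
- by apply: gacl; rewrite ?qw0 ?qw1.
pose sq (z : 'rV[R]_1 * R) := ((z.1 0 0 * q e + 1) / 2, (z.2 + 1) / 2).
have csq : continuous sq.
  apply: cont_pair; apply: contM; try exact: cont_cst; apply: contD; try exact: cont_cst.
    apply: contM; last exact: cont_cst.
    exact: (cont_comp (@cont_fst _ _) (@cont_coord _ 1 0)).
  exact: cont_snd.
have cg1 z : cylinder_gauge q z <= 1 ->
    -1 <= z.1 0 0 * q e <= 1 /\ -1 <= z.2 <= 1.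
  by rewrite /cylinder_gauge ge_max qw !ler_norml => /andP.
have lineE (w : 'rV[R]_1) : line w0 w1 ((w 0 0 * q e + 1) / 2) = w.
  rewrite /line /w0 /w1 !scalerA -scalerDl [RHS]wE; congr (_ *: _).
  by field; rewrite gt_eqF.
have agree z : cylinder_gauge q z = 1 -> F (sq z) = cylinder_map q al be ga z.
  move=> z1; have [u1 s1] : -1 <= z.1 0 0 * q e <= 1 /\ -1 <= z.2 <= 1.
    by apply: cg1; rewrite z1.
  have x1 : 0 <= (z.1 0 0 * q e + 1) / 2 <= 1 by lra.
  have y1 : 0 <= (z.2 + 1) / 2 <= 1 by lra.
  have [Fb _ _ Ft] := FE _ x1; have [_ Fr Fl _] := FE _ y1.
  rewrite /cylinder_map; case: leP => qz.
    have : z.1 0 0 * q e = 1 \/ z.1 0 0 * q e = -1.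
      by move: qz; rewrite qw ler_normr => /orP[] ?; [left|right]; lra.
    move=> [] uE.
      have zE : z.1 = w1 by rewrite [LHS]wE -[z.1 0 0](mulfK (lt0r_neq0 qe)) uE mul1r.
      by rewrite /sq uE two_halves Fr zE.
    have zE : z.1 = w0 by rewrite [LHS]wE -[z.1 0 0](mulfK (lt0r_neq0 qe)) uE mulN1r.
    by rewrite /sq uE addNr mul0r Fl zE.
  have : z.2 = 1 \/ z.2 = -1.
    move: z1; rewrite /cylinder_gauge => z1.
    have : 1 <= `|z.2|.
      by move: z1; rewrite /Num.max; case: ifP => [_ ->//|_ qz1]; move: qz; rewrite qz1 ltxx.
    by rewrite ler_normr => /orP[] ?; [left|right]; lra.
  move=> [] sE; rewrite sE.
    rewrite ifF ?lt_geF// /sq sE two_halves Ft lpathE//.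
    by rewrite val_clamp01// lineE.
  rewrite ifT ?lerN10// /sq sE addNr mul0r Fb lpathE//.
  by rewrite val_clamp01// lineE.
have [cg _ _] := cylinder_gaugeP gq.
exists (fun z => if cylinder_gauge q z <= 1 then F (sq z) else cylinder_map q al be ga z).
  apply: glue_le => //; first exact: cont_cst.
    apply: cont_within_comp csq cF _ => z /= /cg1[u1 s1].
    by rewrite !in_itv /=; split; lra.
  exact: cylinder_map_continuous.
move=> z; rewrite le_eqVlt => /orP[/eqP z1|z1]; last by rewrite leNgt z1.
by rewrite -z1 lexx agree.
Qed.

End path_extension.

Section path_extension_any.
Context {R : realType} {X : topologicalType}.

Lemma path_extension k (q : 'rV[R]_k -> R) (al be : 'rV[R]_k -> X)
    (ga : 'rV[R]_k -> pathspace R X) :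
  (0 < k)%N -> gauge q -> continuous al -> continuous be ->
  {within [set w | 1 <= q w], continuous ga} ->
  (forall w, 1 <= q w -> ga w (zero01 R) = al w) ->
  (forall w, 1 <= q w -> ga w (one01 R) = be w) ->
  (forall w w', 1 <= q w -> 1 <= q w' ->
    Pi_mul (lcl al w w') (Pi_class (ga w')) = Pi_mul (Pi_class (ga w)) (lcl be w w')) ->
  ((2 <= k)%N -> @null_spheroids R X k) ->
  exists ga' : 'rV[R]_k -> pathspace R X, [/\ continuous ga',
    forall w, 1 <= q w -> ga' w = ga w,
    forall w, ga' w (zero01 R) = al w & forall w, ga' w (one01 R) = be w].
Proof.
case: k q al be ga => [//|[|k]] q al be ga _ gq cal cbe cga ga0 ga1 gacl null.
  exact: path_extension_line.
by apply: path_extension_high => //; exact: null.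
Qed.

(** The family is a map on [V * R], where all paths with the same ends have the same class. So the
    class known at one point of the boundary determines it inside. *)
Lemma path_family_class (V : normedModType R) (al be : V -> X)
    (ga : V -> pathspace R X) (w w' : V) :
  continuous al -> continuous be -> continuous ga ->
  (forall w, ga w (zero01 R) = al w) -> (forall w, ga w (one01 R) = be w) ->
  Pi_class (ga w) =
  Pi_mul (Pi_mul (lcl al w w') (Pi_class (ga w'))) (lcl be w' w).
Proof.
move=> cal cbe cga ga0 ga1.
pose F (z : V * R) := ga z.1 (clamp01 z.2).
have cF : continuous F.
  apply: (@cont_comp _ _ _ (fun z : V * R => (z.1, clamp01 z.2)) (fun z => ga z.1 z.2)).
    apply: cont_pair; first exact: cont_fst.
    exact: (cont_comp (@cont_snd V R) (@clamp01_continuous R)).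
  exact: cont_uncurry.
have gaE v : Pi_class (ga v) = lcl F (v, 0) (v, 1).
  rewrite (@lcl_path _ _ _ _ cF (fun t => (v, \val t))) ?zero01E ?one01E//.
    by apply: cont_pair; [exact: cont_cst|exact: val01_continuous].
  by move=> t; rewrite /F /= clamp01K.
have cv (s : R) : continuous (fun v : V => (v, s)).
  by apply: cont_pair; [exact: cont_id|exact: cont_cst].
have -> : al = fun v => F (v, 0) by apply/funext => v; rewrite /F /= clamp01_0 ga0.
have -> : be = fun v => F (v, 1) by apply/funext => v; rewrite /F /= clamp01_1 ga1.
by rewrite (lcl_comp _ _ cF (cv 0)) (lcl_comp _ _ cF (cv 1)) !gaE !Pi_mul_lcl.
Qed.

End path_extension_any.

(** * Sections that are constant along collars *)

Section distinguished_paths.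
Context {R : realType} {X : topologicalType} (K : cw_structure R X).
Implicit Types (a b : cw_cell K) (x y : X) (c e z : Pi R X).

Local Notation dim := (@cw_dim R X K).
Local Notation h := (collar_homotopy K).
Local Notation r := (collar_map K).
Local Notation full_star a := (star (@open_ball _ _ K a)).
Local Notation rchi a := (fun v : 'rV[R]_(dim a) => r (chi a v)).

Lemma lcl_sandwich (V W : normedModType R) (A : V -> X) (B : W -> X) c
    (u u' u'' : V) (v v' v'' : W) : continuous A -> continuous B ->
  src c = A u'' -> tgt c = B v'' ->
  Pi_mul (Pi_mul (lcl A u u') (Pi_mul (Pi_mul (lcl A u' u'') c) (lcl B v'' v'))) (lcl B v' v) =
  Pi_mul (Pi_mul (lcl A u u'') c) (lcl B v'' v).
Proof.
move=> cA cB cu cv.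
have e1 : tgt (lcl A u' u'') = src c by rewrite tgt_lcl.
have e2 : tgt c = src (lcl B v'' v') by rewrite src_lcl.
have e3 : tgt (Pi_mul (lcl A u' u'') c) = src (lcl B v'' v') by rewrite tgt_Pi_mul.
have e4 : tgt (lcl A u u') = src (Pi_mul (lcl A u' u'') c).
  by rewrite src_Pi_mul// src_lcl// tgt_lcl.
rewrite -(Pi_mulA e4 e3).
rewrite -[Pi_mul (lcl A u u') _]Pi_mulA//; last by rewrite src_lcl// tgt_lcl.
rewrite Pi_mul_lcl//.
have e5 : tgt (lcl A u u'') = src c by rewrite tgt_lcl.
rewrite Pi_mulA; [|by rewrite tgt_Pi_mul|by rewrite tgt_lcl// src_lcl].
by rewrite Pi_mul_lcl.
Qed.

(** The class at (u, v) on the sheet labelled by z, obtained by transport along radii;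
    [center_class] recovers the label. *)
Definition cell_class a b z (u : 'rV[R]_(dim a)) (v : 'rV[R]_(dim b)) : Pi R X :=
  Pi_mul (Pi_mul (lcl (rchi a) u 0) z) (lcl (rchi b) 0 v).

Arguments cell_class : clear implicits.

Definition center_class a b c (u : 'rV[R]_(dim a)) (v : 'rV[R]_(dim b)) : Pi R X :=
  Pi_mul (Pi_mul (lcl (rchi a) 0 u) c) (lcl (rchi b) v 0).

Arguments center_class : clear implicits.

Definition joins x y c : Prop := src c = x /\ tgt c = y.

Lemma joins_sandwich (V W : normedModType R) (A : V -> X) (B : W -> X) c
    (u u' : V) (v v' : W) : continuous A -> continuous B ->
  joins (A u) (B v) c -> joins (A u') (B v') (Pi_mul (Pi_mul (lcl A u' u) c) (lcl B v v')).
Proof.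
move=> cA cB [cu cv].
have e1 : tgt (lcl A u' u) = src c by rewrite tgt_lcl.
have e2 : tgt (Pi_mul (lcl A u' u) c) = src (lcl B v v') by rewrite tgt_Pi_mul// src_lcl.
by split; rewrite ?(src_Pi_mul e2) ?(tgt_Pi_mul e2) ?src_Pi_mul ?src_lcl ?tgt_lcl.
Qed.

Lemma joins_cell a b z u v : joins (r (chi a 0)) (r (chi b 0)) z ->
  joins (r (chi a u)) (r (chi b v)) (cell_class a b z u v).
Proof.
by apply: (joins_sandwich (A := rchi a) (B := rchi b)); exact: rchi_continuous.
Qed.

Lemma joins_center a b c u v : joins (r (chi a u)) (r (chi b v)) c ->
  joins (r (chi a 0)) (r (chi b 0)) (center_class a b c u v).
Proof.
by apply: (joins_sandwich (A := rchi a) (B := rchi b)); exact: rchi_continuous.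
Qed.

Lemma cell_class_shift a b c u v u' v' : joins (r (chi a u)) (r (chi b v)) c ->
  cell_class a b (center_class a b c u v) u' v' =
  Pi_mul (Pi_mul (lcl (rchi a) u' u) c) (lcl (rchi b) v v').
Proof.
by move=> [cu cv]; apply: lcl_sandwich => //; exact: rchi_continuous.
Qed.

Lemma trivial_sandwich a b c u v : joins (r (chi a u)) (r (chi b v)) c ->
  Pi_mul (Pi_mul (lcl (rchi a) u u) c) (lcl (rchi b) v v) = c.
Proof.
move=> [cu cv]; rewrite !lcl_refl; [|exact: rchi_continuous|exact: rchi_continuous].
by rewrite Pi_mul1c// Pi_mulc1.
Qed.

Lemma cell_class_center a b c u v : joins (r (chi a u)) (r (chi b v)) c ->
  cell_class a b (center_class a b c u v) u v = c.
Proof. by move=> cuv; rewrite cell_class_shift// trivial_sandwich. Qed.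

Lemma center_cell_class a b z u v : joins (r (chi a 0)) (r (chi b 0)) z ->
  center_class a b (cell_class a b z u v) u v = z.
Proof.
move=> [zu zv]; rewrite /center_class /cell_class lcl_sandwich//; try exact: rchi_continuous.
exact: trivial_sandwich.
Qed.

(** The segment from u to its push-out is radial and stays at norm at least 1/2, where r is
    constant. Labels of sheets are thus insensitive to pushing out. *)
Lemma lcl_push_out a (u : 'rV[R]_(dim a)) : 2^-1 <= nrm u ->
  lcl (rchi a) (push_out u) 0 = lcl (rchi a) u 0 /\
  lcl (rchi a) 0 (push_out u) = lcl (rchi a) 0 u.
Proof.
move=> u2; have cr := @rchi_continuous _ _ K a.
have u0 : 0 < nrm u by exact: lt_le_trans invr2_gt0 u2.
have E : lcl (rchi a) (push_out u) u = Pi_one (r (chi a u)).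
  apply: lcl_cst => // t /andP[t0 t1].
  pose k := (1 - t) * (nrm u)^-1 + t.
  have -> : line (push_out u) u t = k *: u.
    by rewrite /line /push_out max_l// scalerA -scalerDl.
  have k0 : 0 < k.
    have [t00|tn] := eqVneq t 0; first by rewrite /k t00 subr0 mul1r addr0 invr_gt0.
    apply: ltr_wpDl; last by rewrite lt_neqAle eq_sym tn.
    by rewrite mulr_ge0 ?subr_ge0// invr_ge0 ltW.
  have ku : 2^-1 <= nrm (k *: u).
    rewrite nrmZ gtr0_norm// /k mulrDl mulrAC -mulrA divff ?gt_eqF// mulr1.
    have : 2^-1 * t <= t * nrm u by rewrite mulrC; apply: ler_wpM2l.
    by lra.
  by rewrite -collar_map_push_out// push_outZ// collar_map_push_out.
have E' : lcl (rchi a) u (push_out u) = Pi_one (r (chi a u)).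
  rewrite -Pi_inv_lcl// E /Pi_one -Pi_class_rev; congr Pi_class.
  by apply/continuousEP => t; rewrite path_revE.
rewrite -(Pi_mul_lcl cr (push_out u) u 0) -(Pi_mul_lcl cr 0 u (push_out u)) E E'.
by rewrite Pi_mul1c ?src_lcl// Pi_mulc1 ?tgt_lcl.
Qed.

(** This jumps at radius 1/2, so the continuity of what is built on it comes from constancy of the
    section along collars. *)
Definition push a (u : 'rV[R]_(dim a)) : 'rV[R]_(dim a) :=
  if 2^-1 <= nrm u then push_out u else u.

Lemma r_push a (u : 'rV[R]_(dim a)) : r (chi a (push u)) = r (chi a u).
Proof. by rewrite /push; case: ifP => // u2; rewrite collar_map_push_out. Qed.

Local Notation Gtype := (X -> X -> Pi R X -> pathspace R X).

(* Constancy along the collars of each of the two cells, and not only along a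
   collar of the boundary of their product, is what yields continuity for the
   product topology. *)
Definition collared_section (D : set nat) (G : Gtype) : Prop :=
  [/\ forall x y e, D (celldim K x + celldim K y)%N -> joins (r x) (r y) e ->
        Pi_class (G x y e) = e,
      forall a u y e, 2^-1 <= nrm u -> D (celldim K (chi a u) + celldim K y)%N ->
        joins (r (chi a u)) (r y) e -> G (chi a (push_out u)) y e = G (chi a u) y e,
      forall b v x e, 2^-1 <= nrm v -> D (celldim K x + celldim K (chi b v))%N ->
        joins (r x) (r (chi b v)) e -> G x (chi b (push_out v)) e = G x (chi b v) e &
      forall a b z, D (dim a + dim b)%N -> joins (r (chi a 0)) (r (chi b 0)) z ->
        continuous (fun w : 'rV[R]_(dim a) * 'rV[R]_(dim b) =>
          G (chi a w.1) (chi b w.2) (cell_class a b z w.1 w.2))].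

Definition lower_set (D : set nat) := forall m n, (m <= n)%N -> D n -> D m.

(** Collapsing moves points along collars, where G is constant, and lowers dimensions, so that the
    pair stays in the lower set D. *)
Lemma collared_collapse D G x y e k l : lower_set D -> collared_section D G ->
  D (celldim K x + celldim K y)%N -> joins (r x) (r y) e ->
  G (iter k (collapse K) x) (iter l (collapse K) y) e = G x y e.
Proof.
move=> lD [_ Gl Gr _].
have cle m x' : (celldim K (iter m (collapse K) x') <= celldim K x')%N.
  by case: (celldim_iter_collapse K m x') => [->//|/ltnW].
elim: k x y l => [|k IHk] x y l.
  elim: l y => [//|l IHl] y Dxy exy; rewrite iterSr.
  have [b [v [v1 yE _]]] := cell_codeP K y; subst y; rewrite collapse_chi//.
  case: leP => [_|/ltW v2]; first exact: IHl.
  have De : D (celldim K x + celldim K (chi b (push_out v)))%N.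
    apply: lD Dxy; rewrite leq_add2l (celldim_chi v1); apply: ltnW.
    by apply: celldim_sphere; rewrite nrm_push_out.
  by rewrite IHl// ?collar_map_push_out// Gr.
move=> Dxy exy; rewrite iterSr.
have [a [u [u1 xE _]]] := cell_codeP K x; subst x; rewrite collapse_chi//.
case: leP => [_|/ltW u2]; first exact: IHk.
have De : D (celldim K (chi a (push_out u)) + celldim K y)%N.
  apply: lD Dxy; rewrite leq_add2r (celldim_chi u1); apply: ltnW.
  by apply: celldim_sphere; rewrite nrm_push_out.
by rewrite IHk// ?collar_map_push_out// Gl.
Qed.

(* Near a class [c] the section only depends on the coordinates of the ends in
   the stars of the two cells that contain the ends of [c]. *)
Lemma collared_section_continuous D G : lower_set D -> collared_section D G ->
  {within [set c | D (celldim K (src c) + celldim K (tgt c))%N],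
    continuous (fun c => G (src c) (tgt c) (collar_conj K c))}.
Proof.
move=> lD GD; have [_ _ _ G4] := GD.
apply/subspace_continuousP => c0 /= Dc0 N nN.
have [a [u0 [u01 su0 _]]] := cell_codeP K (src c0).
have [b [v0 [v01 tv0 _]]] := cell_codeP K (tgt c0).
have jc0 : joins (r (chi a u0)) (r (chi b v0)) (collar_conj K c0).
  by split; rewrite ?src_collar_conj ?tgt_collar_conj ?su0 ?tv0.
(* The label of the sheet through c0. *)
pose z := center_class a b (collar_conj K c0) u0 v0.
have Dab : D (dim a + dim b)%N.
  by move: Dc0; rewrite su0 tv0 !celldim_chi.
have := G4 a b z Dab (joins_center jc0) (u0, v0).
rewrite /continuous_at /= cell_class_center// -su0 -tv0 => /(_ N nN).
move=> [[A B] [/= Au Bv] ABN].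
have star_nbhs a' (u : 'rV[R]_(dim a')) (A' : set 'rV[R]_(dim a')) x :
    nrm u < 1 -> x = chi a' u -> nbhs u A' ->
    nbhs x (star (A'^° `&` open_ball (a := a'))).
  move=> u1 -> nA; apply: open_nbhs_nbhs; split.
    apply: star_open => [|? []//]; apply: openI; first exact: open_interior.
    exact: open_ball_open.
  by exists 0%N; exists u.
have [||U [V [UA VB cUV]]] := Pi_nbhs
  (star_nbhs _ _ _ _ u01 su0 Au) (star_nbhs _ _ _ _ v01 tv0 Bv)
  (a := a) (b := b).
- by rewrite su0; exact: full_star_chi.
- by rewrite tv0; exact: full_star_chi.
rewrite nbhs_simpl /= /within /=; apply: filterS cUV => d dUV Dd.
have [/UA[sdA sda] /VB[tdB tdb]] := Pi_basic_ends dUV.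
have [Asd _] := star_coord_in (@subIsetr _ _ _) sdA.
have [Btd _] := star_coord_in (@subIsetr _ _ _) tdB.
have [_ [k ku]] := star_coordP sda; have [_ [l lv]] := star_coordP tdb.
change (N (G (src d) (tgt d) (collar_conj K d))).
(* Both ends of d are collapsed into the open cells a and b; the class there lies on the same sheet
   z, where G is continuous. *)
rewrite -(collared_collapse k l lD GD) //; last first.
  by split; rewrite ?src_collar_conj ?tgt_collar_conj.
rewrite ku lv.
have -> : collar_conj K d = cell_class a b z (star_coord a (src d)) (star_coord b (tgt d)).
  have Ua : U `<=` full_star a by move=> x /UA[].
  have Vb : V `<=` full_star b by move=> x /VB[].
  rewrite (collar_conj_Pi_basic Ua Vb dUV) /z (cell_class_shift _ _ jc0) su0 tv0.
  by rewrite (star_coord_chi u01) (star_coord_chi v01).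
by apply: (ABN (_, _)); split; apply: interior_subset.
Qed.

End distinguished_paths.
Arguments cell_class {R X K} a b z u v.
Arguments center_class {R X K} a b c u v.

(** * Extension over one product of cells *)

Section section_step.
Context {R : realType} {X : topologicalType} (K : cw_structure R X).
Implicit Types (a b : cw_cell K) (x y : X) (c e z : Pi R X).

Local Notation dim := (@cw_dim R X K).
Local Notation h := (collar_homotopy K).
Local Notation r := (collar_map K).
Local Notation rchi a := (fun v : 'rV[R]_(dim a) => r (chi a v)).
Local Notation Gtype := (X -> X -> Pi R X -> pathspace R X).

(* The lift to the space of classes of the product of two characteristic maps. *)
Definition cell_lift a b z (w : 'rV[R]_(dim a) * 'rV[R]_(dim b)) : Pi R X :=
  Pi_mul (Pi_mul (lcl (chi a) w.1 0)
    (Pi_mul (hcls K (chi a 0)) (Pi_mul z (Pi_inv (hcls K (chi b 0))))))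
    (lcl (chi b) 0 w.2).
Arguments cell_lift : clear implicits.

Section lift.
Variables (a b : cw_cell K) (z : Pi R X).
Hypothesis jz : joins (r (chi a 0)) (r (chi b 0)) z.

Let z' := Pi_mul (hcls K (chi a 0)) (Pi_mul z (Pi_inv (hcls K (chi b 0)))).

Let e1 : tgt z = src (Pi_inv (hcls K (chi b 0))).
Proof. by case: jz => _ ->; rewrite src_Pi_inv tgt_hcls. Qed.

Let e2 : tgt (hcls K (chi a 0)) = src (Pi_mul z (Pi_inv (hcls K (chi b 0)))).
Proof. by rewrite src_Pi_mul// tgt_hcls; case: jz. Qed.

Let sz' : src z' = chi a 0. Proof. by rewrite src_Pi_mul// src_hcls. Qed.

Let tz' : tgt z' = chi b 0.
Proof. by rewrite tgt_Pi_mul// tgt_Pi_mul// tgt_Pi_inv src_hcls. Qed.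

Let collar_conj_z' : collar_conj K z' = z.
Proof.
rewrite /collar_conj sz' tz' /z'.
have e3 : tgt (Pi_inv (hcls K (chi b 0))) = src (hcls K (chi b 0)).
  by rewrite tgt_Pi_inv.
have e4 : tgt (Pi_mul z (Pi_inv (hcls K (chi b 0)))) = src (hcls K (chi b 0)).
  by rewrite tgt_Pi_mul.
rewrite (Pi_mulA e2 e4) (Pi_mulA e1 e3) Pi_mulVc tgt_hcls Pi_mulc1; last by case: jz.
by rewrite Pi_mulKV// tgt_hcls; case: jz.
Qed.

Lemma cell_lift_continuous : continuous (cell_lift a b z).
Proof. by apply: lcl_Pi_continuous => //; exact: chi_continuous. Qed.

Let joins_cell_lift w : joins (chi a w.1) (chi b w.2) (cell_lift a b z w).
Proof. by apply: joins_sandwich; [exact: chi_continuous|exact: chi_continuous|split]. Qed.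

Lemma src_cell_lift w : src (cell_lift a b z w) = chi a w.1.
Proof. by case: (joins_cell_lift w). Qed.

Lemma tgt_cell_lift w : tgt (cell_lift a b z w) = chi b w.2.
Proof. by case: (joins_cell_lift w). Qed.

Lemma collar_conj_lcl a' (u v : 'rV[R]_(dim a')) :
  collar_conj K (lcl (chi a') u v) = lcl (rchi a') u v.
Proof.
rewrite /lcl (@collar_conj_class _ _ K _ _ (rchi a') (fun t => line u v (\val t))).
- by rewrite zero01E one01E line0 line1.
- exact: rchi_continuous.
- by apply: cont_line; [exact: cont_cst|exact: cont_cst|exact: val01_continuous].
- by move=> t; rewrite lpathE//; exact: chi_continuous.
Qed.

Lemma collar_conj_cell_lift w :
  collar_conj K (cell_lift a b z w) = cell_class a b z w.1 w.2.
Proof.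
have ca : continuous (chi a) by exact: chi_continuous.
have cb : continuous (chi b) by exact: chi_continuous.
have d1 : tgt (lcl (chi a) w.1 0) = src z' by rewrite tgt_lcl// sz'.
rewrite /cell_lift -/z' collar_conj_Pi_mul; last first.
  by rewrite tgt_Pi_mul// tz' src_lcl.
by rewrite collar_conj_Pi_mul// !collar_conj_lcl collar_conj_z'.
Qed.

End lift.

Lemma lsubmx_continuous m n : continuous (@lsubmx R 1 m n).
Proof.
have -> : @lsubmx R 1 m n = fun w => \row_i w 0 (lshift n i).
  by apply/funext => w; apply/rowP => i; rewrite !mxE.
by apply: cont_row => i; exact: cont_coord.
Qed.

Lemma rsubmx_continuous m n : continuous (@rsubmx R 1 m n).
Proof.
have -> : @rsubmx R 1 m n = fun w => \row_i w 0 (rshift m i).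
  by apply/funext => w; apply/rowP => i; rewrite !mxE.
by apply: cont_row => i; exact: cont_coord.
Qed.

Lemma row_mx_continuous m n :
  continuous (fun w : 'rV[R]_m * 'rV[R]_n => row_mx w.1 w.2).
Proof.
have -> : (fun w : 'rV[R]_m * 'rV[R]_n => row_mx w.1 w.2) =
    fun w => \row_i row_mx w.1 w.2 0 i.
  by apply/funext => w; apply/rowP => i; rewrite !mxE.
apply: cont_row => i; case: (split_ordP i) => j ->.
  have -> : (fun w : 'rV[R]_m * 'rV[R]_n => row_mx w.1 w.2 0 (lshift n j)) =
      fun w => w.1 0 j by apply/funext => w; rewrite row_mxEl.
  exact: (cont_comp (@cont_fst _ _) (@cont_coord _ m j)).
have -> : (fun w : 'rV[R]_m * 'rV[R]_n => row_mx w.1 w.2 0 (rshift m j)) =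
    fun w => w.2 0 j by apply/funext => w; rewrite row_mxEr.
exact: (cont_comp (@cont_snd _ _) (@cont_coord _ n j)).
Qed.

(** With the factor 2 the unit ball is the product of the balls of radius 1/2. Its complement is in
    the union of the two collars, where lower cells already prescribe the paths. *)
Definition bidisc_gauge m n (w : 'rV[R]_(m + n)) : R :=
  2 * Num.max (nrm (lsubmx w)) (nrm (rsubmx w)).

Lemma bidisc_gauge_ge1 m n (w : 'rV[R]_(m + n)) :
  1 <= bidisc_gauge w <-> 2^-1 <= nrm (lsubmx w) \/ 2^-1 <= nrm (rsubmx w).
Proof.
have -> : (1 <= bidisc_gauge w) = (2^-1 <= Num.max (nrm (lsubmx w)) (nrm (rsubmx w))).
  by rewrite /bidisc_gauge -ler_pdivrMl// mulr1.
by rewrite le_max; split => /orP.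
Qed.

Lemma bidisc_gaugeP m n : gauge (@bidisc_gauge m n).
Proof.
split.
- apply: contM; first exact: cont_cst.
  apply: cont_max.
    exact: (cont_comp (@lsubmx_continuous m n) (@nrm_continuous R m)).
  exact: (cont_comp (@rsubmx_continuous m n) (@nrm_continuous R n)).
- move=> w w0; rewrite /bidisc_gauge mulr_gt0// lt_max !lt_neqAle !nrm_ge0 !andbT.
  rewrite -negb_and; apply: contra w0 => /andP[/eqP l0 /eqP r0].
  rewrite -(hsubmxK w) (nrm_eq0 (esym l0)) (nrm_eq0 (esym r0)).
  by rewrite row_mx0.
- move=> c w; rewrite /bidisc_gauge !linearZ /= !nrmZ -maxr_pMr//.
  by rewrite mulrCA.
Qed.

Section cell_extension.
Variables (n : nat) (G : Gtype).
Hypotheses (GD : collared_section K [set m | (m < n)%N] G)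
  (null : forall k, (2 <= k)%N -> @null_spheroids R X k).
Variables (a b : cw_cell K) (z : Pi R X).
Hypotheses (abn : (dim a + dim b)%N = n) (jz : joins (r (chi a 0)) (r (chi b 0)) z).

Local Notation Gab u v :=
  (G (chi a (push u)) (chi b (push v)) (cell_class a b z u v)).

Lemma celldim_push_out a' (u : 'rV[R]_(dim a')) : 2^-1 <= nrm u ->
  (celldim K (chi a' (push_out u)) < dim a')%N.
Proof. by move=> u2; apply: celldim_sphere; rewrite nrm_push_out. Qed.

Lemma celldim_lt_left (u : 'rV[R]_(dim a)) (v : 'rV[R]_(dim b)) : 2^-1 <= nrm u ->
  (celldim K (chi a (push_out u)) + celldim K (chi b v) < n)%N.
Proof.
by move=> u2; rewrite -abn -addSn; apply: leq_add; [exact: celldim_push_out|exact: celldim_le].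
Qed.

Lemma celldim_lt_right (u : 'rV[R]_(dim a)) (v : 'rV[R]_(dim b)) : 2^-1 <= nrm v ->
  (celldim K (chi a u) + celldim K (chi b (push_out v)) < n)%N.
Proof.
by move=> v2; rewrite -abn -addnS; apply: leq_add; [exact: celldim_le|exact: celldim_push_out].
Qed.

Lemma celldim_push_lt (u : 'rV[R]_(dim a)) (v : 'rV[R]_(dim b)) :
  2^-1 <= nrm u \/ 2^-1 <= nrm v ->
  (celldim K (chi a (push u)) + celldim K (chi b (push v)) < n)%N.
Proof.
move=> [u2|v2].
  by rewrite {1}/push u2; exact: celldim_lt_left.
by rewrite {2}/push v2; exact: celldim_lt_right.
Qed.

Lemma Gab_class u v : 2^-1 <= nrm u \/ 2^-1 <= nrm v ->
  Pi_class (Gab u v) = cell_class a b z u v.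
Proof.
case: GD => G1 _ _ _ uv; apply: G1; first exact: celldim_push_lt.
by rewrite !r_push; exact: joins_cell.
Qed.

(** By constancy along the collar of v, only u has to be pushed; the right-hand side avoids the jump
    of [push v]. *)
Lemma Gab_left u v : 2^-1 <= nrm u ->
  Gab u v = G (chi a (push_out u)) (chi b v) (cell_class a b z (push_out u) v).
Proof.
move=> u2; have [_ _ G3 _] := GD.
rewrite {1}/push u2 {2}/cell_class (lcl_push_out u2).1 /push; case: ifP => // v2.
apply: G3 => //; first exact: celldim_lt_left.
by rewrite collar_map_push_out//; exact: joins_cell.
Qed.

Lemma Gab_right u v : 2^-1 <= nrm v ->
  Gab u v = G (chi a u) (chi b (push_out v)) (cell_class a b z u (push_out v)).
Proof.
move=> v2; have [_ G2 _ _] := GD.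
rewrite {2}/push v2 {2}/cell_class (lcl_push_out v2).2 /push; case: ifP => // u2.
apply: G2 => //; first exact: celldim_lt_right.
by rewrite collar_map_push_out//; exact: joins_cell.
Qed.

Lemma lower_ltn m : lower_set [set k | (k < m)%N].
Proof. by move=> i j /= ij; exact: leq_ltn_trans. Qed.

Local Notation GG := (fun c => G (src c) (tgt c) (collar_conj K c)).

Lemma GG_cell_lift w :
  GG (cell_lift a b z w) = G (chi a w.1) (chi b w.2) (cell_class a b z w.1 w.2).
Proof. by rewrite /= src_cell_lift// tgt_cell_lift// collar_conj_cell_lift. Qed.

(** On each of the two collars the family is the section already built, composed with the lift to
    Pi(X) of a continuous push-out; the dimensions there add up to less than n. *)
Lemma Gab_continuous : {within [set w | 2^-1 <= nrm w.1] `|` [set w | 2^-1 <= nrm w.2],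
  continuous (fun w : 'rV[R]_(dim a) * 'rV[R]_(dim b) => Gab w.1 w.2)}.
Proof.
have cGG := collared_section_continuous (@lower_ltn n) GD.
have cp := @push_out_continuous R.
have n1 : continuous (fun w : 'rV[R]_(dim a) * 'rV[R]_(dim b) => nrm w.1).
  exact: (cont_comp (@cont_fst _ _) (@nrm_continuous R _)).
have n2 : continuous (fun w : 'rV[R]_(dim a) * 'rV[R]_(dim b) => nrm w.2).
  exact: (cont_comp (@cont_snd _ _) (@nrm_continuous R _)).
have aux (A : set ('rV[R]_(dim a) * 'rV[R]_(dim b)))
    (p : 'rV[R]_(dim a) * 'rV[R]_(dim b) -> 'rV[R]_(dim a) * 'rV[R]_(dim b)) :
    continuous p ->
    (forall w, A w -> (celldim K (chi a (p w).1) + celldim K (chi b (p w).2) < n)%N) ->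
    (forall w, A w -> Gab w.1 w.2 =
      G (chi a (p w).1) (chi b (p w).2) (cell_class a b z (p w).1 (p w).2)) ->
    {within A, continuous (fun w : 'rV[R]_(dim a) * 'rV[R]_(dim b) => Gab w.1 w.2)}.
  move=> cpw pA AE; apply: (@within_eq _ _ _ (fun w => GG (cell_lift a b z (p w)))).
    move=> w Aw; rewrite AE//; exact: GG_cell_lift.
  apply: (cont_within_comp _ cGG).
    exact: (cont_comp cpw (cell_lift_continuous jz)).
  by move=> w Aw /=; rewrite src_cell_lift// tgt_cell_lift// pA.
apply: withinU_continuous.
- by apply: closed_leR => //; exact: cont_cst.
- by apply: closed_leR => //; exact: cont_cst.
- apply: (aux _ (fun w => (push_out w.1, w.2))).
  + apply: cont_pair; last exact: cont_snd.
    exact: (cont_comp (@cont_fst _ _) (@push_out_continuous R _)).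
  + by move=> w /= w2; exact: celldim_lt_left.
  + by move=> w /= w2; rewrite Gab_left.
- apply: (aux _ (fun w => (w.1, push_out w.2))).
  + apply: cont_pair; first exact: cont_fst.
    exact: (cont_comp (@cont_snd _ _) (@push_out_continuous R _)).
  + by move=> w /= w2; exact: celldim_lt_right.
  + by move=> w /= w2; rewrite Gab_right.
Qed.

Lemma cell_class_move u v u' v' : cell_class a b z u v =
  Pi_mul (Pi_mul (lcl (rchi a) u u') (cell_class a b z u' v')) (lcl (rchi b) v' v).
Proof.
have [jz1 jz2] := jz.
by rewrite {2}/cell_class lcl_sandwich//; exact: rchi_continuous.
Qed.

Lemma cell_extension : exists F : 'rV[R]_(dim a) * 'rV[R]_(dim b) -> pathspace R X,
  [/\ continuous F,
      forall u v, 2^-1 <= nrm u \/ 2^-1 <= nrm v -> F (u, v) = Gab u v &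
      forall u v, Pi_class (F (u, v)) = cell_class a b z u v].
Proof.
(* In total dimension 0 the product of the cells is a point, and any representative of the class
   will do. *)
have [n0|n_gt0] := posnP n.
  have triv a' (u : 'rV[R]_(dim a')) : dim a' = 0%N -> u = 0.
    by move=> a0; apply/rowP => -[i il]; exfalso; rewrite a0 in il.
  have [a0 b0] : dim a = 0%N /\ dim b = 0%N.
    by have := abn; rewrite n0 => /eqP; rewrite addn_eq0 => /andP[/eqP -> /eqP ->].
  exists (fun _ => repr (cell_class a b z 0 0)); split.
  - exact: cont_cst.
  - by move=> u v; rewrite (triv _ u a0) (triv _ v b0) !nrm0 leNgt invr2_gt0 => -[].
  - by move=> u v; rewrite (triv _ u a0) (triv _ v b0) Pi_reprK.
have gq := @bidisc_gaugeP (dim a) (dim b).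
pose al (w : 'rV[R]_(dim a + dim b)) := r (chi a (lsubmx w)).
pose be (w : 'rV[R]_(dim a + dim b)) := r (chi b (rsubmx w)).
pose ga (w : 'rV[R]_(dim a + dim b)) := Gab (lsubmx w) (rsubmx w).
have cl := @lsubmx_continuous (dim a) (dim b).
have cr := @rsubmx_continuous (dim a) (dim b).
have cra := @rchi_continuous _ _ K a; have crb := @rchi_continuous _ _ K b.
have cal : continuous al by exact: (cont_comp cl cra).
have cbe : continuous be by exact: (cont_comp cr crb).
have cga : {within [set w | 1 <= bidisc_gauge w], continuous ga}.
  apply: (cont_within_comp (f := fun w : 'rV[R]_(dim a + dim b) => (lsubmx w, rsubmx w))
    _ Gab_continuous); first exact: cont_pair.
  by move=> w /= /bidisc_gauge_ge1.
have gaE w : 1 <= bidisc_gauge w ->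
    Pi_class (ga w) = cell_class a b z (lsubmx w) (rsubmx w).
  by move=> /bidisc_gauge_ge1; exact: Gab_class.
have jga w : joins (al w) (be w) (cell_class a b z (lsubmx w) (rsubmx w)).
  exact: joins_cell.
have lal w w' : lcl al w w' = lcl (rchi a) (lsubmx w) (lsubmx w') by exact: lcl_comp.
have lbe w w' : lcl be w w' = lcl (rchi b) (rsubmx w) (rsubmx w') by exact: lcl_comp.
have [|||||ga' [cga' ga'E ga'0 ga'1]] :=
    @path_extension R X _ _ al be ga _ gq cal cbe cga.
- by rewrite abn.
- by move=> w /gaE w1; rewrite -src_class w1; case: (jga w).
- by move=> w /gaE w1; rewrite -tgt_class w1; case: (jga w).
- move=> w w' w1 w'1; rewrite (gaE _ w1) (gaE _ w'1) lal lbe.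
  rewrite (cell_class_move (lsubmx w) (rsubmx w) (lsubmx w') (rsubmx w')).
  have [j1 j2] := jga w'.
  rewrite [RHS]Pi_mulA.
  + by rewrite Pi_mul_lcl// lcl_refl// Pi_mulc1// tgt_Pi_mul// tgt_lcl.
  + by rewrite tgt_Pi_mul ?src_lcl// tgt_lcl.
  + by rewrite tgt_lcl// src_lcl.
- exact: null.
exists (fun w => ga' (row_mx w.1 w.2)); split.
- exact: (cont_comp (@row_mx_continuous _ _) cga').
- move=> u v uv /=; rewrite ga'E /ga ?row_mxKl ?row_mxKr//.
  by apply/bidisc_gauge_ge1; rewrite row_mxKl row_mxKr.
- move=> u v /=.
  (* A point of gauge 1, where the class is known; [path_family_class] transports it to (u, v). *)
  have [w1 w1q] : exists w1 : 'rV[R]_(dim a + dim b), 1 <= bidisc_gauge w1.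
    have e0 : (const_mx 1 : 'rV[R]_(dim a + dim b)) != 0.
      have k0 : (0 < dim a + dim b)%N by rewrite abn.
      apply/eqP => /rowP/(_ (Ordinal k0)); rewrite !mxE => /eqP.
      by rewrite oner_eq0.
    have [_ q0 _] := gq; have qe := q0 _ e0.
    exists ((bidisc_gauge (const_mx 1 : 'rV[R]_(dim a + dim b)))^-1 *: const_mx 1).
    rewrite (gaugeZ _ gq); last by rewrite invr_ge0 ltW.
    by rewrite mulVf// gt_eqF.
  rewrite (path_family_class (row_mx u v) w1 cal cbe cga' ga'0 ga'1) (ga'E _ w1q) (gaE _ w1q).
  by rewrite lal lbe row_mxKl row_mxKr -cell_class_move.
Qed.

End cell_extension.
End section_step.

(** * Induction on the total dimension and the distinguished paths *)

Section final.
Context {R : realType} {X : topologicalType} (K : cw_structure R X).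
Implicit Types (a b : cw_cell K) (x y : X) (c e z : Pi R X).

Local Notation dim := (@cw_dim R X K).
Local Notation h := (collar_homotopy K).
Local Notation r := (collar_map K).
Local Notation Gtype := (X -> X -> Pi R X -> pathspace R X).
Hypothesis null : forall k, (2 <= k)%N -> @null_spheroids R X k.

Lemma collared_step n (G : Gtype) : collared_section K [set m | (m < n)%N] G ->
  exists2 G' : Gtype, collared_section K [set m | (m < n.+1)%N] G' &
    forall x y e, (celldim K x + celldim K y < n)%N -> G' x y e = G x y e.
Proof.
move=> GD; have [G1 G2 G3 G4] := GD.
pose P a b z (F : 'rV[R]_(dim a) * 'rV[R]_(dim b) -> pathspace R X) :=
  [/\ continuous F,
      forall u v, 2^-1 <= nrm u \/ 2^-1 <= nrm v ->
        F (u, v) = G (chi a (push u)) (chi b (push v)) (cell_class a b z u v) &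
      forall u v, Pi_class (F (u, v)) = cell_class a b z u v].
pose Fext a b z : 'rV[R]_(dim a) * 'rV[R]_(dim b) -> pathspace R X :=
  if pselect (exists F, P a b z F) is left ex then sval (cid ex) else fun=> repr z.
have FP a b z : (dim a + dim b)%N = n -> joins (r (chi a 0)) (r (chi b 0)) z ->
    P a b z (Fext a b z).
  move=> abn jz; rewrite /Fext; case: pselect => [ex|[]]; first by case: cid.
  exact: (cell_extension GD null abn jz).
(* On a pair of open cells of total dimension n, the class e selects a sheet through its label, and
   the extension chosen for that sheet is used. *)
pose G' : Gtype := fun x y e => if (celldim K x + celldim K y == n)%N then
    let: existT a u := cell_code K x in let: existT b v := cell_code K y in
    Fext a b (center_class a b e u v) (u, v)
  else G x y e.
have low x y e : (celldim K x + celldim K y < n)%N -> G' x y e = G x y e.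
  by move=> xy; rewrite /G' ltn_eqF.
have top a b u v e : nrm u < 1 -> nrm v < 1 -> (dim a + dim b)%N = n ->
    G' (chi a u) (chi b v) e = Fext a b (center_class a b e u v) (u, v).
  by move=> u1 v1 abn; rewrite /G' !celldim_chi// abn eqxx !cell_code_chi.
have pushed a b u v e : (2^-1 <= nrm u \/ 2^-1 <= nrm v) -> nrm u < 1 -> nrm v < 1 ->
    (dim a + dim b)%N = n -> joins (r (chi a u)) (r (chi b v)) e ->
    G' (chi a u) (chi b v) e = G (chi a (push u)) (chi b (push v)) e.
  move=> uv u1 v1 abn je; rewrite top//.
  have [_ -> // _] := FP a b _ abn (joins_center je).
  by rewrite cell_class_center.
exists G' => //; split.
- move=> x y e /=; rewrite ltnS leq_eqVlt => /orP[/eqP xyn|xyn] je; last by rewrite low// G1.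
  have [a [u [u1 xE _]]] := cell_codeP K x; have [b [v [v1 yE _]]] := cell_codeP K y.
  subst x y; rewrite !celldim_chi// in xyn; rewrite top//.
  have [_ _ ->] := FP a b _ xyn (joins_center je).
  by rewrite cell_class_center.
- move=> a u y e u2 /=; rewrite ltnS leq_eqVlt => /orP[/eqP yn|yn] je; last first.
    rewrite !low// ?G2//.
    apply: leq_ltn_trans yn; rewrite leq_add2r.
    case: (ltP (nrm u) 1) => u1; last by rewrite chi_push_out.
    by rewrite (celldim_chi u1); apply/ltnW/celldim_push_out.
  case: (ltP (nrm u) 1) => u1; last by rewrite chi_push_out.
  have [b [v [v1 yE _]]] := cell_codeP K y; subst y; rewrite !celldim_chi// in yn.
  have lt1 := @celldim_lt_left _ _ K _ _ _ yn u v u2.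
  rewrite (pushed _ _ _ _ _ (or_introl u2))//.
  rewrite low// /push u2; case: ifP => // v2; rewrite G3//.
  by rewrite collar_map_push_out.
- move=> b v x e v2 /=; rewrite ltnS leq_eqVlt => /orP[/eqP xn|xn] je; last first.
    rewrite !low// ?G3//.
    apply: leq_ltn_trans xn; rewrite leq_add2l.
    case: (ltP (nrm v) 1) => v1; last by rewrite chi_push_out.
    by rewrite (celldim_chi v1); apply/ltnW/celldim_push_out.
  case: (ltP (nrm v) 1) => v1; last by rewrite chi_push_out.
  have [a [u [u1 xE _]]] := cell_codeP K x; subst x; rewrite !celldim_chi// in xn.
  have lt1 := @celldim_lt_right _ _ K _ _ _ xn u v v2.
  rewrite (pushed _ _ _ _ _ (or_intror v2))//.
  rewrite low// /push v2; case: ifP => // u2; rewrite G2//.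
  by rewrite collar_map_push_out.
- move=> a b z /=; rewrite ltnS leq_eqVlt => /orP[/eqP abn|abn] jz; last first.
    have -> : (fun w : 'rV[R]_(dim a) * 'rV[R]_(dim b) =>
        G' (chi a w.1) (chi b w.2) (cell_class a b z w.1 w.2)) =
        fun w => G (chi a w.1) (chi b w.2) (cell_class a b z w.1 w.2).
      apply/funext => w; apply: low; apply: leq_ltn_trans abn.
      by apply: leq_add; exact: celldim_le.
    exact: G4.
  have [cF Fb _] := FP a b z abn jz.
  have -> : (fun w : 'rV[R]_(dim a) * 'rV[R]_(dim b) =>
      G' (chi a w.1) (chi b w.2) (cell_class a b z w.1 w.2)) = Fext a b z; last exact: cF.
  apply/funext => -[u v] /=.
  have je : joins (r (chi a u)) (r (chi b v)) (cell_class a b z u v) by exact: joins_cell.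
  (* If u or v is outside the open disc, the pair has smaller total dimension and G' is still G; it
     agrees with [Fext], which is prescribed on the collars. *)
  case: (ltP (nrm u) 1) => u1; last first.
    have u2 : 2^-1 <= nrm u by exact: le_trans invr2_le1 u1.
    have lt1 := @celldim_lt_left _ _ K _ _ _ abn u v u2.
    rewrite Fb; last by left.
    rewrite -{1}[chi a u]chi_push_out// low// /push u2; case: ifP => // v2.
    by rewrite G3// collar_map_push_out.
  case: (ltP (nrm v) 1) => v1; last first.
    have v2 : 2^-1 <= nrm v by exact: le_trans invr2_le1 v1.
    have lt1 := @celldim_lt_right _ _ K _ _ _ abn u v v2.
    rewrite Fb; last by right.
    rewrite -{1}[chi b v]chi_push_out// low// /push v2; case: ifP => // u2.
    by rewrite G2// collar_map_push_out.
  by rewrite top// center_cell_class.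
Qed.

Lemma collared_section_exists : exists G : Gtype, collared_section K setT G.
Proof.
have base : collared_section K [set m | (m < 0)%N] (fun _ _ e => repr e).
  by split.
pose next n (s : {G : Gtype | collared_section K [set m | (m < n)%N] G}) :
    {G : Gtype | collared_section K [set m | (m < n.+1)%N] G} :=
  let G' := cid2 (collared_step (svalP s)) in
  exist _ (s2val G') (s2valP G').
pose fix seqG n : {G : Gtype | collared_section K [set m | (m < n)%N] G} :=
  if n is m.+1 then next m (seqG m) else exist _ _ base.
pose G n := sval (seqG n).
have GP n : collared_section K [set m | (m < n)%N] (G n) by exact: svalP.
have Gstep n x y e : (celldim K x + celldim K y < n)%N -> G n.+1 x y e = G n x y e.
  by move=> xyn; rewrite /G /= /next /=; case: cid2 => /= G' _ ->.
(* Stage n covers total dimensions below n, hence the successor. Later stages do not change the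
   value, so continuity over two cells is checked at a single stage. *)
pose GG x y e := G (celldim K x + celldim K y).+1 x y e.
have GE n x y e : (celldim K x + celldim K y < n)%N -> GG x y e = G n x y e.
  elim: n => // n IHn; rewrite ltnS leq_eqVlt => /orP[/eqP <-//|xyn].
  by rewrite Gstep// IHn.
exists GG; split.
- move=> x y e _ je; have [G1 _ _ _] := GP (celldim K x + celldim K y).+1.
  by apply: G1 => //=; exact: ltnSn.
- move=> a u y e u2 _ je.
  have [_ G2 _ _] := GP (dim a + celldim K y).+1.
  rewrite !(GE (dim a + celldim K y).+1) ?ltnS ?leq_add2r ?celldim_le// G2//=.
  by rewrite ltnS leq_add2r celldim_le.
- move=> b v x e v2 _ je.
  have [_ _ G3 _] := GP (celldim K x + dim b).+1.
  rewrite !(GE (celldim K x + dim b).+1) ?ltnS ?leq_add2l ?celldim_le// G3//=.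
  by rewrite ltnS leq_add2l celldim_le.
- move=> a b z _ jz; have [_ _ _ G4] := GP (dim a + dim b).+1.
  have -> : (fun w : 'rV[R]_(dim a) * 'rV[R]_(dim b) =>
      GG (chi a w.1) (chi b w.2) (cell_class a b z w.1 w.2)) =
      fun w => G (dim a + dim b).+1 (chi a w.1) (chi b w.2) (cell_class a b z w.1 w.2).
    by apply/funext => w; apply: GE; rewrite ltnS; apply: leq_add; exact: celldim_le.
  by apply: G4 => //=; exact: ltnSn.
Qed.

Lemma null_spheroids_dpp : dpp R X.
Proof.
have [G GT] := collared_section_exists; have [G1 _ _ _] := GT.
have jc c : joins (r (src c)) (r (tgt c)) (collar_conj K c).
  by split; rewrite ?src_collar_conj ?tgt_collar_conj.
pose k c := G (src c) (tgt c) (collar_conj K c).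
have kE c : Pi_class (k c) = collar_conj K c by exact: G1.
have ck : continuous k.
  have := collared_section_continuous (D := setT) _ GT.
  by move=> H; apply: within_setT; last exact: H.
have ch := @collar_homotopy_continuous _ _ K.
have hk c : h (src c) (one01 R) = k c (zero01 R).
  by rewrite -src_class kE src_collar_conj.
have kh c : k c (one01 R) = path_rev (h (tgt c)) (zero01 R).
  by rewrite path_rev0 -tgt_class kE tgt_collar_conj.
have hkh c : path_cat (h (src c)) (k c) (one01 R) = path_rev (h (tgt c)) (zero01 R).
  by rewrite path_cat1.
exists (fun c => path_cat (path_cat (h (src c)) (k c)) (path_rev (h (tgt c)))); split.
  apply: path_cat_cvg => //.
    apply: path_cat_cvg => //; exact: (cont_comp (@src_continuous _ _ K) ch).
  apply: (cont_comp (f := fun c => h (tgt c)) _ (@path_rev_cvg R X)).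
  exact: (cont_comp (@tgt_continuous _ _ K) ch).
apply/funext => c /=.
rewrite -Pi_mul_class// -Pi_mul_class// kE Pi_class_rev -/(hcls K _) -/(hcls K _).
rewrite Pi_mulA ?collar_conjK//.
  by rewrite tgt_hcls src_collar_conj.
by rewrite src_Pi_inv tgt_hcls tgt_collar_conj.
Qed.

End final.

Lemma aspherical_null_spheroids (R : realType) (X : topologicalType) k :
  aspherical R X -> (2 <= k)%N -> @null_spheroids R X k.
Proof.
move=> [_ pi0] k2 phi x phix; apply/hclP.
have : pi_n R k x (hcl R (cube_boundary R k) phi) by exists phi.
by rewrite pi0.
Qed.

Theorem corollary4p4 (R : realType) (X : topologicalType)
    (K : cw_structure R X)
    (X_connected : connected [set: X])
    (K_small : cw_locally_finite K \/ cw_countable K) :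
  aspherical R X <-> dpp R X.
Proof.
split=> [aX|dX].
  by apply: (null_spheroids_dpp K) => k; exact: aspherical_null_spheroids.
split; first exact: (cw_path_connected K).
by move=> n x n2; exact: dpp_pi_n.
Qed.
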